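(* Let $\varphi\in\big(B^1_{\infty1}\big)_+$. Then for every contraction $T$ and every bounded linear operator $Q$ on a Hilbert space the following formula holds: $$ \varphi(T)Q-Q\varphi(T)=\iint\limits_{\mathbb{T}\times\mathbb{T}}\frac{\varphi(\zeta)-\varphi(\tau)}{\zeta-\tau}\,d\mathcal{E}_T(\zeta)\,(TQ-QT)\,d\mathcal{E}_T(\tau), $$ where $\mathcal{E}_T$ is a semi-spectral measure of $T$.
   Context: $\mathbb{D}$ is the open unit disk, $\mathbb{T}$ the unit circle. A contraction is an operator of norm at most $1$. $C_A$ is the disk-algebra (functions analytic in $\mathbb{D}$ and continuous on the closed disk). For $f\in C_A$ and a contraction $T$, $f(T)$ is defined by extending the polynomial calculus by continuity using von Neumann's inequality $\|f(T)\|\le\max_{|\zeta|\le1}|f(\zeta)|$. Besov class: let $w\ge0$ be the piecewise linear function on $\mathbb{R}$ supported in $[1/2,2]$, with $w(1)=1$ and linear on $[1/2,1]$ and on $[1,2]$. Put $W_n(z)=\sum_{k\in\mathbb{Z}}w(k/2^n)z^k$ for $n\ge1$, $W_0(z)=\bar z+1+z$, $W_n^\#=\overline{W_n}$. For $s>0$, $1\le p,q\le\infty$, $B^s_{pq}$ consists of functions $f$ on $\mathbb{T}$ with $\{2^{ns}\|f*W_n\|_{L^p}\}_{n\ge0}\in\ell^q$ and $\{2^{ns}\|f*W_n^\#\|_{L^p}\}_{n\ge1}\in\ell^q$. $\big(B^s_{pq}\big)_+$ is the set of $f\in B^s_{pq}$ with $\hat f(k)=0$ for $k<0$; such functions are identified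 with their analytic extensions to $\mathbb{D}$. Semi-spectral measures: for a measurable space $(\mathcal{X},\mathcal{B})$ and a Hilbert space $\mathcal{H}$, a semi-spectral measure is a map $\mathcal{E}$ from $\mathcal{B}$ to the bounded operators on $\mathcal{H}$ with $\mathcal{E}(\Delta)\ge0$, $\mathcal{E}(\varnothing)=0$, $\mathcal{E}(\mathcal{X})=I$, countably additive in the weak operator topology. By Naimark's theorem it has a spectral dilation, i.e., a spectral measure $E$ on a Hilbert space $\mathcal{K}\supset\mathcal{H}$ with $\mathcal{E}(\Delta)=P_{\mathcal{H}}E(\Delta)|\mathcal{H}$, and $\int f\,d\mathcal{E}:=P_{\mathcal{H}}\left(\int f\,dE\right)\big|\mathcal{H}$ for bounded measurable $f$ (independent of the dilation). A semi-spectral measure of a contraction $T$ on $\mathcal{H}$ is $\mathcal{E}_T(\Delta)=P_{\mathcal{H}}E_U(\Delta)|\mathcal{H}$, $\Delta\subset\mathbb{T}$ Borel, where $E_U$ is the spectral measure of a unitary dilation $U$ of $T$ (a unitary operator on some $\mathcal{K}\supset\mathcal{H}$ with $T^n=P_{\mathcal{H}}U^n|\mathcal{H}$, $n\ge0$); thus $T^n=\int_{\mathbb{T}}\zeta^n\,d\mathcal{E}_T(\zeta)$, $n\ge0$. Double operator integrals: if $\Phi(\zeta,\tau)=\sum_{n}f_n(\zeta)g_n(\tau)$ with $f_n,g_n\in C_A$ and $\sum_n\|f_n\|_\infty\|g_n\|_\infty<\infty$ (i.e. $\Phi$ belongs to the projective tensor product $C_A\hat\otimes C_A$), then for a bounded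 operator $K$, $\iint\Phi\,d\mathcal{E}_T\,K\,d\mathcal{E}_T:=\sum_n\left(\int f_n\,d\mathcal{E}_T\right)K\left(\int g_n\,d\mathcal{E}_T\right)$, which does not depend on the representation. For $\varphi\in\big(B^1_{\infty1}\big)_+$ the divided difference $\frac{\varphi(\zeta)-\varphi(\tau)}{\zeta-\tau}$ (equal to $\varphi'(\zeta)$ when $\zeta=\tau$) is known to belong to $C_A\hat\otimes C_A$. *)

(* Defs.v *)
From HB Require Import structures.
From mathcomp Require Import all_boot all_order all_algebra.
From mathcomp Require Import complex.
From mathcomp Require Import all_classical all_reals all_analysis.
Set Implicit Arguments.
Unset Strict Implicit.
Unset Printing Implicit Defensive.
Import Order.TTheory GRing.Theory Num.Theory.
Import numFieldNormedType.Exports.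
Local Open Scope classical_set_scope.
Local Open Scope complex_scope.
Local Open Scope ring_scope.

(* MathComp-Analysis puts the usual topology on R[i]^o only; it is copied to
   R[i] itself, as the library does for its abstract number fields. *)
HB.instance Definition _ (R : realType) :=
  PseudoPointedMetric.copy R[i] (R[i]^o).
HB.instance Definition _ (R : realType) := GRing.ComAlgebra.copy R[i] (R[i]^o).
HB.instance Definition _ (R : realType) := Vector.copy R[i] (R[i]^o).
HB.instance Definition _ (R : realType) := NormedModule.copy R[i] (R[i]^o).

(* The norm of a normed space over R[i] takes its values in R[i]; rnorm is the
   same real number as an element of R. *)
Definition rnorm (R : realType) (V : normedModType R[i]) (x : V) : R :=
  complex.Re `|x|.

(** Disk, circle, disk algebra *)

Section disk_and_circle.
Context (R : realType).

Definition disk : set R[i] := [set z | `|z| < 1].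
Definition cdisk : set R[i] := [set z | `|z| <= 1].

Definition disk_algebra (f : R[i] -> R[i]) : Prop :=
  (forall z, disk z -> derivable f z 1) /\ {within cdisk, continuous f}.

Definition supnorm (f : R[i] -> R[i]) : R := sup [set rnorm (f z) | z in cdisk].

Definition circle : Type := {z : R[i] | `|z| == 1}.

HB.instance Definition _ := Choice.on circle.
HB.instance Definition _ := isPointed.Build circle
  (exist (fun z : R[i] => `|z| == 1) 1 (introT eqP (normr1 _))).
HB.instance Definition _ :=
  Topological.copy circle (initial_topology (sval : circle -> R[i])).
(* the Borel sigma-algebra *)
HB.instance Definition _ :=
  Measurable.copy circle (g_sigma_algebraType (@open circle)).

Lemma expi_subproof (t : R) : `|(cos t +i* sin t : R[i])| == 1.
Proof. by rewrite normc_def /= cos2Dsin2 sqrtr1. Qed.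

Definition expi (t : R) : circle := exist _ (cos t +i* sin t) (expi_subproof t).

Lemma two_pi_gt0 : 0 < 2 * pi :> R.
Proof. by rewrite mulr_gt0 ?pi_gt0. Qed.

(* Normalized Lebesgue measure on the circle is the image of this probability
   on R under expi; integrals and norms on the circle are pulled back to it. *)
Definition angle : probability (measurableTypeR R) R := uniform_prob two_pi_gt0.

Definition circle_integrable (f : circle -> R[i]) : Prop :=
  angle.-integrable setT (fun t => (complex.Re (f (expi t)))%:E) /\
  angle.-integrable setT (fun t => (complex.Im (f (expi t)))%:E).

Definition circle_integral (f : circle -> R[i]) : R[i] :=
  (\int[angle]_t complex.Re (f (expi t))) +i*
  (\int[angle]_t complex.Im (f (expi t))).

Definition circle_Lnorm (p : \bar R) (f : circle -> R[i]) : \bar R :=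
  Lnorm angle p (fun t => (rnorm (f (expi t)))%:E).

End disk_and_circle.
Arguments disk {R}.
Arguments cdisk {R}.
Arguments expi {R}.

(** Besov classes *)

Section besov.
Context {R : realType}.
Implicit Types f : circle R -> R[i].

Definition fourier f (k : int) : R[i] :=
  circle_integral (fun z => f z * sval z ^ (- k)).

Definition convolution f (g : R[i] -> R[i]) (z : circle R) : R[i] :=
  circle_integral (fun u => f u * g (sval z / sval u)).

Definition besov_window (x : R) : R :=
  if (2^-1 <= x) && (x <= 1) then 2 * x - 1
  else if (1 <= x) && (x <= 2) then 2 - x
  else 0.

(* Only finitely many terms of the sum over int are nonzero. *)
Definition besov_W (n : nat) (z : R[i]) : R[i] :=
  if n is 0 then z^* + 1 + z
  else \sum_(k \in [set: int]) (besov_window (k%:~R / 2 ^+ n))%:C * z ^ k.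

Definition besov_Wsharp (n : nat) (z : R[i]) : R[i] := (besov_W n z)^*.

Definition in_ell (q : \bar R) (a : nat -> \bar R) : Prop :=
  (Lnorm counting q a < +oo)%E.

Definition besov (s : R) (p q : \bar R) f : Prop :=
  [/\ circle_integrable f,
      in_ell q (fun n => (2 `^ (n%:R * s))%:E *
                         circle_Lnorm p (convolution f (besov_W n)))%E
    & in_ell q (fun n => (2 `^ (n.+1%:R * s))%:E *
                         circle_Lnorm p (convolution f (besov_Wsharp n.+1)))%E].

Definition besov_plus (s : R) (p q : \bar R) f : Prop :=
  besov s p q f /\ forall k : int, k < 0 -> fourier f k = 0.

Definition power_series_extension f (z : R[i]) : R[i] :=
  limn (series (fun k : nat => fourier f k%:Z * z ^+ k)).

(* The analytic extension to the open disk, prolonged by continuity to the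
   closed disk. *)
Definition analytic_extension f (z : R[i]) : R[i] :=
  if `|z| < 1 then power_series_extension f z
  else lim (power_series_extension f w @[w --> within disk (nbhs z)]).

End besov.

(* the derivative at z of a function on the closed disk (z may lie on the
   boundary) *)
Definition cdisk_derive (R : realType) (f : R[i] -> R[i]) (z : R[i]) : R[i] :=
  lim ((f w - f z) / (w - z) @[w --> within cdisk z^']).

Definition divided_difference (R : realType) (f : R[i] -> R[i])
    (z u : circle R) : R[i] :=
  if z == u then cdisk_derive f (sval z)
  else (f (sval z) - f (sval u)) / (sval z - sval u).

(** Hilbert spaces and bounded operators *)

HB.mixin Record CompleteNormedModule_isHilbert (R : realType) (H : Type)
    & CompleteNormedModule R[i] H := {
  inner : H -> H -> R[i] ;
  inner_linearl : forall (a : R[i]) (x y z : H),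
    inner (a *: x + y) z = a * inner x z + inner y z ;
  inner_conj : forall x y : H, inner y x = (inner x y)^* ;
  inner_norm : forall x : H, inner x x = `|x| ^+ 2 }.

#[short(type="hilbertType")]
HB.structure Definition Hilbert (R : realType) :=
  {H of CompleteNormedModule R[i] H & CompleteNormedModule_isHilbert R H}.

Section operators.
Context {R : realType}.
Implicit Types H K : hilbertType R.

Definition bounded_op H K (A : H -> K) : Prop := linear A /\ continuous A.

Definition opnorm H K (A : H -> K) : R :=
  sup [set rnorm (A x) | x in [set x : H | rnorm x <= 1]].

Definition op_cvg H K (A : nat -> H -> K) (B : H -> K) : Prop :=
  opnorm (A n \- B) @[n --> \oo] --> (0 : R).

Definition contraction_op H (T : H -> H) : Prop := bounded_op T /\ opnorm T <= 1.

Definition embedding H K (V : H -> K) : Prop :=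
  linear V /\ forall x y, inner (V x) (V y) = inner x y.

Definition unitary_op H (U : H -> H) : Prop :=
  embedding U /\ forall y, exists x, U x = y.

(* H being regarded as a subspace of K through the embedding V, B is the
   compression P_H A | H: V (B x) is the orthogonal projection of A (V x) onto
   the range of V. *)
Definition compression H K (V : H -> K) (A : K -> K) (B : H -> H) : Prop :=
  forall x y, inner (A (V x) - V (B x)) (V y) = 0.

Definition poly_op H (p : {poly R[i]}) (T : H -> H) : H -> H :=
  fun x => \sum_(k < size p) p`_k *: iter k T x.

Definition is_disk_calculus H (f : R[i] -> R[i]) (T A : H -> H) : Prop :=
  bounded_op A /\ exists p : nat -> {poly R[i]},
    {uniform cdisk, (fun n z => (p n).[z]) @ \oo --> f} /\
    op_cvg (fun n => poly_op (p n) T) A.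

(* f(T): the norm limit of p_n(T) for polynomials p_n converging to f uniformly
   on the closed disk. By von Neumann's inequality the limit does not depend on
   the sequence; the default value 0 is for f that are not such limits. *)
Definition disk_calculus H (f : R[i] -> R[i]) (T : H -> H) : H -> H :=
  xget (fun=> 0) [set A | is_disk_calculus f T A].

End operators.

(** Spectral and semi-spectral measures *)

Section measures.
Context {R : realType} {d : measure_display} {X : measurableType d}.
Implicit Types H K : hilbertType R.

(* Operator-valued set functions are total on [set X]; only their values on
   measurable sets are constrained and used. *)
Record semispectral_measure H (E : set X -> H -> H) : Prop := {
  semispectral_bounded : forall D, measurable D -> bounded_op (E D) ;
  semispectral_ge0 : forall D, measurable D -> forall x, 0 <= inner (E D x) x ;
  semispectral0 : forall x, E set0 x = 0 ;
  semispectralT : forall x, E setT x = x ;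
  semispectral_sigma_additive : forall F : nat -> set X,
    (forall n, measurable (F n)) -> trivIset setT F ->
    forall x y, \sum_(k < n) inner (E (F k) x) y @[n --> \oo] -->
                inner (E (\bigcup_n F n) x) y }.

(* a positive idempotent operator is an orthogonal projection *)
Definition spectral_measure H (E : set X -> H -> H) : Prop :=
  semispectral_measure E /\
  forall D, measurable D -> forall x, E D (E D x) = E D x.

(* A list of pairs (c, D) represents the simple function \sum c \1_D. *)
Definition simple_fun (s : seq (R[i] * set X)) (x : X) : R[i] :=
  \sum_(cD <- s) cD.1 * \1_(cD.2) x.

Definition simple_integral H (E : set X -> H -> H) (s : seq (R[i] * set X)) :
    H -> H :=
  fun x => \sum_(cD <- s) cD.1 *: E cD.2 x.

(* A is the integral of f: the norm limit of integrals of simple functions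
   converging uniformly to f (which forces f to be bounded and measurable). *)
Definition is_spectral_integral H (E : set X -> H -> H) (f : X -> R[i])
    (A : H -> H) : Prop :=
  bounded_op A /\ exists s : nat -> seq (R[i] * set X),
    [/\ forall n k, measurable (nth (0, set0) (s n) k).2,
        {uniform, (fun n => simple_fun (s n)) @ \oo --> f}
      & op_cvg (fun n => simple_integral E (s n)) A].

Definition spectral_dilation H K (V : H -> K)
    (E : set X -> H -> H) (F : set X -> K -> K) : Prop :=
  [/\ embedding V, spectral_measure F &
      forall D, measurable D -> compression V (F D) (E D)].

Definition is_semispectral_integral H (E : set X -> H -> H) (f : X -> R[i])
    (A : H -> H) : Prop :=
  bounded_op A /\
  exists (K : hilbertType R) (V : H -> K) (F : set X -> K -> K) (B : K -> K),
    [/\ spectral_dilation V E F, is_spectral_integral F f B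
      & compression V B A].

(* Naimark: a dilation exists, and the integral does not depend on it. *)
Definition semispectral_integral H (E : set X -> H -> H) (f : X -> R[i]) :
    H -> H :=
  xget (fun=> 0) [set A | is_semispectral_integral E f A].

End measures.

Section double_operator_integrals.
Context {R : realType}.
Implicit Types H K : hilbertType R.

Definition unitary_dilation H K (V : H -> K) (T : H -> H) (U : K -> K) : Prop :=
  [/\ embedding V, unitary_op U &
      forall n, compression V (iter n U) (iter n T)].

Definition spectral_measure_of K (U : K -> K) (F : set (circle R) -> K -> K) :
    Prop :=
  spectral_measure F /\ is_spectral_integral F sval U.

Definition semispectral_measure_of H (T : H -> H)
    (E : set (circle R) -> H -> H) : Prop :=
  exists (K : hilbertType R) (V : H -> K) (U : K -> K)
         (F : set (circle R) -> K -> K),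
    [/\ unitary_dilation V T U, spectral_measure_of U F &
        forall D, measurable D -> compression V (F D) (E D)].

(* Phi = \sum_n f_n (x) g_n in the projective tensor square of the disk
   algebra *)
Definition tensor_representation (Phi : circle R -> circle R -> R[i])
    (f g : nat -> R[i] -> R[i]) : Prop :=
  [/\ forall n, disk_algebra (f n) /\ disk_algebra (g n),
      cvgn (series (fun n => supnorm (f n) * supnorm (g n)))
    & forall z u, series (fun n => f n (sval z) * g n (sval u)) @ \oo -->
                  Phi z u].

Definition is_double_operator_integral H (E1 E2 : set (circle R) -> H -> H)
    (Phi : circle R -> circle R -> R[i]) (K S : H -> H) : Prop :=
  bounded_op S /\ exists f g : nat -> R[i] -> R[i],
    tensor_representation Phi f g /\
    op_cvg (fun N => \sum_(n < N)
              (semispectral_integral E1 (f n \o sval) \o K \o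
               semispectral_integral E2 (g n \o sval))) S.

(* \iint Phi dE1 K dE2, the first variable of Phi going with E1; the default
   value 0 is for Phi outside the projective tensor product. *)
Definition double_operator_integral H (E1 E2 : set (circle R) -> H -> H)
    (Phi : circle R -> circle R -> R[i]) (K : H -> H) : H -> H :=
  xget (fun=> 0) [set S | is_double_operator_integral E1 E2 Phi K S].

End double_operator_integrals.

(* Main.v *)
Require Import Defs.
From mathcomp Require Import all_boot all_order all_algebra.
From mathcomp Require Import cyclic separable cyclotomic complex ring lra zify.
From mathcomp Require Import all_classical all_reals all_analysis.
From mathcomp Require Import measurable_realfun ess_sup_inf.
Set Implicit Arguments.
Unset Strict Implicit.
Unset Printing Implicit Defensive.
Import Order.TTheory GRing.Theory Num.Theory.
Import numFieldNormedType.Exports.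
Local Open Scope classical_set_scope.
Local Open Scope complex_scope.
Local Open Scope ring_scope.

(** For [Psi z u = \sum_n f_n z * g_n u] with [\sum_n |f_n| |g_n| < oo] the double
    operator integral is the norm limit of Riemann sums
    [\sum_(i, j) Psi z_i z_j *: E_i K E_j] over fine partitions [(E_i)] of the
    circle.  These sums involve [Psi] only through its values, so the integral
    does not depend on the representation, and [Psi z u = z * Phi z u - u * Phi z u]
    with [Phi] the divided difference yields the theorem: on one side
    [f_n(T) T Q g_n(T) - f_n(T) Q T g_n(T)], on the other the representation
    [phi z * 1 - 1 * phi u] of the same function.  Here [z f_n(z)] integrates to
    [f_n(T) T] because the [f_n] can be taken to be polynomials.

    A representation of [Phi] comes from the blocks [p = f * W_n], polynomials with
    frequencies in [m, 4m], where [m = 2^(n-1)].  With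
    [min(1, j/m) + (1 - j/m)_+ = 1] inserted in
    [\sum_(j, k) p_(j+k+1) z^j u^k], the second half is a sum of [m] terms
    [z^j * u^-(j+1) p(u)], and the first one a sum of [4m] terms [G_k(z) * u^k] in
    which [G_k] is, up to a power of [z], [p] minus a de la Vallee Poussin mean of
    [p].  Hence the projective norm of the block is [O(2^n |p|)]. *)

(** * The real-valued norm and inner products *)

(** The block estimate has to avoid sharp truncations of frequencies, which are not bounded in the
    sup norm uniformly in the degree: expanding the Hankel sum by rows alone produces truncated
    shifts of [p]. A shift by at most [m] loses no coefficient, since those below [m] vanish, which
    is why one weight lives on [j < m]; the complementary weight makes the truncation in the other
    variable a ramp of length [m], comparable to the degree, and Fejer means bound ramps. Cauchy and
    Fejer integrals are replaced throughout by averages over roots of unity, which are exact for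
    polynomials.

    The Riemann sums make it unnecessary to know that an element of the projective tensor product is
    determined by its values. They are controlled by positivity alone: AM-GM on each cell bounds
    [\sum_i c_i E_i] by [max |c_i|], without a dilation.

    The calculus, the integrals and the double integrals are defined by choice with default value 0,
    so each of them needs an existence proof and a uniqueness proof. *)

Section real_norm.
Context {R : realType}.
Implicit Types V : normedModType R[i].

Lemma normr_rnorm V (x : V) : `|x| = (rnorm x)%:C.
Proof.
have := normr_ge0 x; rewrite lecE /rnorm => /andP[/eqP /= h _].
by case: `|x| h => a b /= ->.
Qed.

Lemma rnorm_ge0 V (x : V) : 0 <= rnorm x.
Proof. by have := normr_ge0 x; rewrite normr_rnorm lecR. Qed.

Lemma rnorm0 V : rnorm (0 : V) = 0.
Proof. by rewrite /rnorm normr0. Qed.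

Lemma rnorm0_eq0 V (x : V) : rnorm x = 0 -> x = 0.
Proof. by move=> h; apply/normr0_eq0; rewrite normr_rnorm h. Qed.

Lemma rnorm_gt0 V (x : V) : x != 0 -> 0 < rnorm x.
Proof.
move=> x0; rewrite lt_neqAle rnorm_ge0 andbT eq_sym.
by apply: contra_neq x0; exact: rnorm0_eq0.
Qed.

Lemma rnormN V (x : V) : rnorm (- x) = rnorm x.
Proof. by rewrite /rnorm normrN. Qed.

Lemma rnormD V (x y : V) : rnorm (x + y) <= rnorm x + rnorm y.
Proof. by have := ler_normD x y; rewrite !normr_rnorm -rmorphD lecR. Qed.

Lemma rnormB V (x y : V) : rnorm (x - y) <= rnorm x + rnorm y.
Proof. by rewrite -(rnormN y) rnormD. Qed.

Lemma rdistC V (x y : V) : rnorm (x - y) = rnorm (y - x).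
Proof. by rewrite -rnormN opprB. Qed.

Lemma rnormZ V (a : R[i]) (x : V) : rnorm (a *: x) = rnorm a * rnorm x.
Proof.
apply: (@complexI R); rewrite rmorphM /= -!normr_rnorm.
by rewrite normrZ.
Qed.

Lemma rnormM (a b : R[i]) : rnorm (a * b) = rnorm a * rnorm b.
Proof. by apply: (@complexI R); rewrite rmorphM /= -!normr_rnorm normrM. Qed.

Lemma rnorm1 : rnorm (1 : R[i]) = 1.
Proof. by rewrite /rnorm normr1. Qed.

Lemma rnormX (a : R[i]) n : rnorm (a ^+ n) = rnorm a ^+ n.
Proof. by elim: n => [|n ih]; rewrite ?expr0 ?rnorm1 // !exprS rnormM ih. Qed.

Lemma rnormC (a : R) : rnorm (a%:C : R[i]) = `|a|.
Proof. by apply: (@complexI R);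
  rewrite -normr_rnorm normc_def /= expr0n addr0 sqrtr_sqr. Qed.

Lemma rnormV (a : R[i]) : rnorm (a^-1) = (rnorm a)^-1.
Proof. by apply: (@complexI R); rewrite fmorphV /= -!normr_rnorm normfV. Qed.

Lemma rnorm_sum V I (r : seq I) (P : pred I) (F : I -> V) :
  rnorm (\sum_(i <- r | P i) F i) <= \sum_(i <- r | P i) rnorm (F i).
Proof.
elim/big_rec2: _ => [|i y x _ h]; first by rewrite rnorm0.
by apply: le_trans (rnormD _ _) _; rewrite lerD2l.
Qed.

Lemma disk_rnorm (z : R[i]) : disk z = is_true (rnorm z < 1).
Proof. by rewrite /disk /= normr_rnorm -(ltcR (rnorm z) 1). Qed.

Lemma cdisk_rnorm (z : R[i]) : cdisk z = is_true (rnorm z <= 1).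
Proof. by rewrite /cdisk /= normr_rnorm -(lecR (rnorm z) 1). Qed.

Lemma circle_rnorm (z : circle R) : rnorm (sval z) = 1.
Proof. by case: z => z /= /eqP; rewrite normr_rnorm => /complexI. Qed.

Lemma rnorm_Re (z : R[i]) : `|complex.Re z| <= rnorm z.
Proof. by have := normc_ge_Re z; rewrite normr_rnorm lecR. Qed.

Lemma rnorm_Im (z : R[i]) : `|complex.Im z| <= rnorm z.
Proof.
have -> : complex.Im z = - complex.Re ('i * z).
  by case: z => a b /=; rewrite !(mul0r, mul1r, sub0r, opprK).
rewrite normrN; apply: le_trans (rnorm_Re _) _.
by rewrite rnormM /rnorm normc_def /= expr0n add0r expr1n sqrtr1 /= mul1r.
Qed.

Lemma rnorm_le_ReIm (z : R[i]) :
  rnorm z <= `|complex.Re z| + `|complex.Im z|.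
Proof.
have {1}-> : z = (complex.Re z)%:C + 'i * (complex.Im z)%:C.
  by case: z => a b; apply/eqP;
    rewrite eq_complex /= !(mul0r, mul1r, mulr0, subr0, addr0, add0r) !eqxx.
apply: le_trans (rnormD _ _) _; rewrite rnormM !rnormC.
by rewrite [X in _ + X * _]/rnorm normc_def /= expr0n add0r expr1n sqrtr1 /= mul1r.
Qed.

(** The order of [R[i]] compares only numbers with equal imaginary parts, so a positive [e] is real
    and the complex epsilons of the library become real ones. *)
Lemma gt0_complex (e : R[i]) : 0 < e -> exists2 d : R, 0 < d & e = d%:C.
Proof.
case: e => a b; rewrite ltcE /= => /andP[/eqP -> h]; exists a => //.
Qed.

Lemma rcvgP V (T : Type) (F : set_system T) {FF : Filter F} (u : T -> V) (l : V) :
  u @ F --> l <-> forall e : R, 0 < e -> \forall x \near F, rnorm (u x - l) < e.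
Proof.
split => [/cvgrPdist_lt h e e0|h].
  have e0' : (0 : R[i]) < e%:C by rewrite ltcR.
  near=> x; rewrite rdistC -ltcR -normr_rnorm; near: x; exact: h.
apply/cvgrPdist_lt => e /gt0_complex[d d0 ->]; near=> x.
rewrite normr_rnorm ltcR rdistC; near: x; exact: h.
Unshelve. all: by end_near. Qed.

Lemma rcauchy_cvg (V : completeNormedModType R[i]) (u : nat -> V) :
  (forall e : R, 0 < e -> exists N, forall m n, (N <= m)%N -> (N <= n)%N ->
     rnorm (u m - u n) < e) -> exists l : V, u @ \oo --> l.
Proof.
move=> h; have : cauchy_ex (u n @[n --> \oo]).
  move=> e /gt0_complex[d d0 ->]; have [N hN] := h d d0; exists (u N).
  by exists N => // n /= Nn; rewrite -ball_normE /= normr_rnorm ltcR; exact: hN.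
move=> /cauchy_exP/cauchy_cvg c; exists (lim (u n @[n --> \oo])); exact: c.
Qed.

Lemma nat_rcvgP V (u : nat -> V) (l : V) :
  u @ \oo --> l <-> forall e : R, 0 < e ->
    exists N, forall n, (N <= n)%N -> rnorm (u n - l) < e.
Proof.
split => [/rcvgP h e /h[N _ hN]|h]; first by exists N => n; apply: hN.
by apply/rcvgP => e /h[N hN]; exists N.
Qed.

Lemma Re_add (u v : R[i]) : complex.Re (u + v) = complex.Re u + complex.Re v.
Proof. by case: u; case: v. Qed.

Lemma Im_add (u v : R[i]) : complex.Im (u + v) = complex.Im u + complex.Im v.
Proof. by case: u; case: v. Qed.

End real_norm.
#[export] Hint Extern 0 (is_true (0 <= rnorm _)%R) => solve [apply: rnorm_ge0] :
  core.

(** * Inner products and sesquilinear bounds *)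

Section hilbert.
Context {R : realType}.
Implicit Types H K : hilbertType R.

Lemma innerDl H (x y z : H) : inner (x + y) z = inner x z + inner y z.
Proof. by have := inner_linearl 1 x y z; rewrite scale1r mul1r. Qed.

Lemma inner0l H (z : H) : inner 0 z = 0.
Proof. by apply: (addIr (inner 0 z)); rewrite -innerDl !add0r. Qed.

Lemma innerZl H a (x z : H) : inner (a *: x) z = a * inner x z.
Proof. by have := inner_linearl a x 0 z; rewrite addr0 inner0l addr0. Qed.

Lemma innerNl H (x z : H) : inner (- x) z = - inner x z.
Proof. by rewrite -scaleN1r innerZl mulN1r. Qed.

Lemma innerBl H (x y z : H) : inner (x - y) z = inner x z - inner y z.
Proof. by rewrite innerDl innerNl. Qed.

Lemma inner_suml H I (r : seq I) (P : pred I) (F : I -> H) z :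
  inner (\sum_(i <- r | P i) F i) z = \sum_(i <- r | P i) inner (F i) z.
Proof.
elim/big_rec2: _ => [|i y x _ h]; first by rewrite inner0l.
by rewrite innerDl h.
Qed.

Lemma innerDr H (x y z : H) : inner z (x + y) = inner z x + inner z y.
Proof. by rewrite inner_conj innerDl rmorphD /= -!inner_conj. Qed.

Lemma innerZr H a (x z : H) : inner z (a *: x) = Num.conj a * inner z x.
Proof. by rewrite inner_conj innerZl rmorphM /= -inner_conj. Qed.

Lemma inner0r H (z : H) : inner z 0 = 0.
Proof. by rewrite inner_conj inner0l rmorph0. Qed.

Lemma inner_normE H (x : H) : inner x x = (rnorm x ^+ 2)%:C.
Proof. by rewrite inner_norm normr_rnorm -rmorphXn. Qed.

Lemma inner_ext H (x y : H) : (forall z, inner x z = inner y z) -> x = y.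
Proof.
move=> h; apply/eqP; rewrite -subr_eq0; apply/eqP/rnorm0_eq0.
have := h (x - y); move/eqP; rewrite -subr_eq0 -innerBl inner_normE.
by move/eqP/complexI/eqP; rewrite expf_eq0 /= => /eqP.
Qed.

(* The AM-GM form of Cauchy-Schwarz, which adds up over the cells of a
   partition. *)
Lemma hermitian_pos_le (V : lmodType R[i]) (B : V -> V -> R[i]) :
  (forall x y z, B (x + y) z = B x z + B y z) ->
  (forall x y z, B z (x + y) = B z x + B z y) ->
  (forall a x z, B (a *: x) z = a * B x z) ->
  (forall a x z, B z (a *: x) = Num.conj a * B z x) ->
  (forall x, 0 <= B x x) ->
  forall x y, 2 * rnorm (B x y) <= complex.Re (B x x) + complex.Re (B y y).
Proof.
move=> Dl Dr Zl Zr pos x y.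
have key a : rnorm a = 1 ->
    0 <= B x x + B y y + Num.conj a * B x y + a * B y x.
  move=> a1; have := pos (x + a *: y).
  rewrite !(Dl, Dr) !(Zl, Zr) mulrA.
  have -> : a * Num.conj a = 1.
    by rewrite -normCK normr_rnorm a1 expr1n.
  by rewrite mul1r !addrA => h; apply: le_trans h _; rewrite le_eqVlt; apply/orP;
    left; apply/eqP; ring.
have im z : 0 <= z -> complex.Im z = 0 :> R.
  by rewrite lecE => /andP[/eqP].
(* Symmetry is not assumed: positivity makes [B] real on the diagonal, and [a = 1], [a = 'i] recover
   it by polarisation. *)
have herm : B y x = Num.conj (B x y).
  have ImD (u v : R[i]) : complex.Im (u + v) = complex.Im u + complex.Im v by case:
    u; case: v.
  have h1 := im _ (key 1 rnorm1).
  have i1 : rnorm ('i : R[i]) = 1 by rewrite /rnorm normc_def /= expr0n add0r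
    expr1n sqrtr1.
  have h2 := im _ (key 'i i1).
  move: h1 h2; rewrite !ImD !(im _ (pos _)) !add0r.
  case: (B x y) => a b; case: (B y x) => c d /= h1 h2.
  apply/eqP; rewrite eq_complex /=; apply/andP; split; apply/eqP; nra.
(* [e] rotates [B x y] onto the negative real axis, which turns positivity at [x + e y] into the
   bound. *)
have [e e1 he] : exists2 e, rnorm e = 1 & Num.conj e * B x y = - (rnorm (B x y))%:C.
  have [b0|b0] := eqVneq (B x y) 0.
    by exists 1; rewrite ?rnorm1 // b0 mulr0 rnorm0 oppr0.
  have n0 : rnorm (B x y) != 0 by apply: contra_neq b0; exact: rnorm0_eq0.
  exists (- ((rnorm (B x y))^-1)%:C * B x y).
    rewrite rnormM rnormN rnormC ger0_norm;
      [exact: mulVf|by rewrite invr_ge0 rnorm_ge0].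
  rewrite rmorphM rmorphN /= -mulrA [_^* * _]mulrC -normCK normr_rnorm.
  have -> : Num.conj ((rnorm (B x y))^-1%:C) = ((rnorm (B x y))^-1)%:C.
    by rewrite conj_Creal // complex_real.
  by rewrite mulNr expr2 mulrA -rmorphM mulVf // rmorph1 mul1r.
have := key e e1; rewrite herm he.
have -> : e * Num.conj (B x y) = Num.conj (Num.conj e * B x y).
  by rewrite rmorphM /= conjCK.
rewrite he rmorphN /= conj_Creal ?complex_real //.
case: (B x x) (im _ (pos x)) => a a' /= ->;
  case: (B y y) (im _ (pos y)) => b b' /= ->.
rewrite lecE /= => /andP[_]; lra.
Qed.

Lemma inner_le H (x y : H) : 2 * rnorm (inner x y) <= rnorm x ^+ 2 + rnorm y ^+ 2.
Proof.
have := @hermitian_pos_le H (@inner R H) _ _ _ _ _ x y.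
rewrite !inner_normE /=; apply => *; rewrite ?innerDl ?innerDr ?innerZl ?innerZr //.
by rewrite inner_normE lecR sqr_ge0.
Qed.

(** Turns the AM-GM form back into a norm bound: [y = t a] with [t = r / |a|] balances the two
    squares. For [r = 0] a small [t] contradicts [a != 0]. *)
Lemma rnorm_le_inner H (a : H) (C r : R) : 0 <= C -> 0 <= r ->
  (forall y, 2 * rnorm (inner a y) <= C * (r ^+ 2 + rnorm y ^+ 2)) ->
  rnorm a <= C * r.
Proof.
move=> C0 r0 h; have [->|a0] := eqVneq a 0; first by rewrite rnorm0 mulr_ge0.
have na : 0 < rnorm a.
  exact: rnorm_gt0.
have key t : 0 < t -> 2 * (t * rnorm a ^+ 2) <= C * (r ^+ 2 + t ^+ 2 * rnorm a ^+
  2).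
  move=> t0; have := h (t%:C *: a).
  rewrite innerZr inner_normE rnormM rnormZ !rnormC ger0_norm ?sqr_ge0 //.
  rewrite /rnorm norm_conjC normc_def /= expr0n addr0 sqrtr_sqr -/(rnorm a).
  by rewrite (gtr0_norm t0) exprMn.
move: r0; rewrite le_eqVlt => /predU1P[r0|r0].
  have C1 : 0 < C + 1 by lra.
  have t0 : 0 < (C + 1)^-1 by rewrite invr_gt0.
  have Ct : C * (C + 1)^-1 < 1 by rewrite ltr_pdivrMr //; lra.
  have := key _ t0; rewrite -r0 expr0n add0r; set t := (C + 1)^-1 in t0 Ct *.
  have q0 : 0 < t * rnorm a ^+ 2 by rewrite mulr_gt0 // exprn_gt0.
  have -> : C * (t ^+ 2 * rnorm a ^+ 2) = (C * t) * (t * rnorm a ^+ 2) by ring.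
  move: (t * _) q0 => q q0; nra.
have := key (r / rnorm a); rewrite divr_gt0 // => /(_ isT).
have nn : rnorm a != 0 by rewrite gt_eqF.
have -> : r / rnorm a * rnorm a ^+ 2 = r * rnorm a by field.
have -> : (r / rnorm a) ^+ 2 * rnorm a ^+ 2 = r ^+ 2 by field.
nra.
Qed.

End hilbert.

(** * Bounded operators *)

Section bounded_operators.
Context {R : realType}.
Implicit Types H K : hilbertType R.

Definition op_bound H K (A : H -> K) (c : R) := forall x, rnorm (A x) <= c * rnorm
  x.

Lemma linear_fun_add H K (A : H -> K) : linear A -> forall x y, A (x + y) = A x + A
  y.
Proof. by move=> lA x y; have := lA 1 x y; rewrite !scale1r. Qed.

Lemma linear_fun0 H K (A : H -> K) : linear A -> A 0 = 0.
Proof. by move=> lA; apply: (addIr (A 0)); rewrite -linear_fun_add // !add0r. Qed.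

Lemma linear_fun_scale H K (A : H -> K) : linear A -> forall a x, A (a *: x) = a *:
  A x.
Proof. by move=> lA a x; rewrite -[a *: x]addr0 lA (linear_fun0 lA) addr0. Qed.

Lemma linear_fun_sub H K (A : H -> K) : linear A -> forall x y, A (x - y) = A x - A
  y.
Proof. by move=> lA x y;
  rewrite linear_fun_add // -scaleN1r linear_fun_scale // scaleN1r. Qed.

Lemma linear_fun_sum H K (A : H -> K) : linear A ->
  forall I (r : seq I) (P : pred I) (F : I -> H),
  A (\sum_(i <- r | P i) F i) = \sum_(i <- r | P i) A (F i).
Proof.
move=> lA I r P F; elim/big_rec2: _ => [|i y x _ <-]; first exact: linear_fun0.
exact: linear_fun_add.
Qed.

Lemma bounded_op_bound H K (A : H -> K) : bounded_op A ->
  exists2 c, 0 <= c & op_bound A c.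
Proof.
move=> [lA cA]; have /rcvgP := cA 0; rewrite linear_fun0 // => /(_ 1 ltr01).
move=> /(@nbhs_ballP R[i] H) [e /= /gt0_complex[d d0 ->] hd].
exists (2 / d); first by rewrite divr_ge0 // ltW.
move=> x; have [->|x0] := eqVneq x 0; first by rewrite linear_fun0 // !rnorm0 mulr0.
have nx : 0 < rnorm x.
  exact: rnorm_gt0.
have t0 : 0 < d / (2 * rnorm x) by rewrite divr_gt0 // mulr_gt0.
have := hd ((d / (2 * rnorm x))%:C *: x); rewrite -ball_normE /= sub0r normrN.
rewrite normr_rnorm ltcR rnormZ rnormC gtr0_norm //.
have -> : d / (2 * rnorm x) * rnorm x = d / 2 by field; rewrite gt_eqF.
move=> /(_ _) h; have := h ltac:(lra).
rewrite subr0 linear_fun_scale // rnormZ rnormC gtr0_norm // => h'.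
rewrite mulrAC ler_pdivlMr // ltW //.
move: h'; rewrite mulrAC ltr_pdivrMr ?mulr_gt0 //; lra.
Qed.

Lemma bound_bounded_op H K (A : H -> K) c : linear A -> op_bound A c -> bounded_op
  A.
Proof.
move=> lA hA; split => // x; apply/rcvgP => e e0.
have c0 : 0 < `|c| + 1 by have := normr_ge0 c; lra.
apply/(@nbhs_ballP R[i] H); exists ((e / (`|c| + 1))%:C) => /=.
  by rewrite ltcR divr_gt0.
move=> y; rewrite -ball_normE /= normr_rnorm ltcR ltr_pdivlMr // => h.
rewrite -linear_fun_sub // rdistC in h *; apply: le_lt_trans (hA _) _.
apply: le_lt_trans h; have := ler_norm c; have := rnorm_ge0 (y - x); nra.
Qed.

Lemma opnorm_le H K (A : H -> K) c : 0 <= c -> op_bound A c -> opnorm A <= c.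
Proof.
move=> c0 hA; apply: ge_sup.
  by exists (rnorm (A 0)); exists 0 => //=; rewrite rnorm0.
move=> _ [x /= x1 <-]; apply: le_trans (hA x) _; rewrite ler_piMr //.
Qed.

Lemma opnorm_bound H K (A : H -> K) : bounded_op A -> op_bound A (opnorm A).
Proof.
move=> bA; have [c c0 hc] := bounded_op_bound bA; have lA := bA.1.
move=> x; have [->|x0] := eqVneq x 0; first by rewrite linear_fun0 // !rnorm0 mulr0.
have nx : 0 < rnorm x.
  exact: rnorm_gt0.
rewrite -ler_pdivrMr //.
have -> : rnorm (A x) / rnorm x = rnorm (A ((rnorm x)^-1%:C *: x)).
  by rewrite linear_fun_scale // rnormZ rnormC gtr0_norm ?invr_gt0 // mulrC.
apply: ub_le_sup; last first.
  exists ((rnorm x)^-1%:C *: x) => //=.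
  by rewrite rnormZ rnormC gtr0_norm ?invr_gt0 // mulVf // gt_eqF.
exists c => _ [y /= y1 <-]; apply: le_trans (hc y) _; exact: ler_piMr.
Qed.

Lemma opnorm_ge0 H K (A : H -> K) : bounded_op A -> 0 <= opnorm A.
Proof.
move=> bA; have := opnorm_bound bA; have [c c0 hc] := bounded_op_bound bA;
  have lA := bA.1.
move=> _; apply: ub_le_sup; last by exists 0; rewrite /= ?linear_fun0 // rnorm0.
exists c => _ [y /= y1 <-]; apply: le_trans (hc y) _; exact: ler_piMr.
Qed.

Lemma bounded_op0 H K : bounded_op (0 : H -> K).
Proof.
apply: (@bound_bounded_op _ _ _ 0) => [a x y|x]; first by rewrite scaler0 addr0.
by rewrite rnorm0 mul0r.
Qed.

Lemma bounded_op_comp H K (L : hilbertType R) (A : K -> L) (B : H -> K) :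
  bounded_op A -> bounded_op B -> bounded_op (A \o B).
Proof.
move=> bA bB; have [c c0 hc] := bounded_op_bound bA.
have [d d0 hd] := bounded_op_bound bB.
apply: (@bound_bounded_op _ _ _ (c * d)) => [a x y|x] /=;
  first by rewrite bB.1 bA.1.
by apply: le_trans (hc _) _; rewrite -mulrA ler_wpM2l.
Qed.

Lemma bounded_opZ H K (A : H -> K) a : bounded_op A -> bounded_op (fun x => a *: A
  x).
Proof.
move=> bA; have [c c0 hc] := bounded_op_bound bA.
apply: (@bound_bounded_op _ _ _ (rnorm a * c)) => [b x y|x].
  by rewrite bA.1 scalerDr !scalerA [b * a]mulrC.
by rewrite rnormZ -mulrA ler_wpM2l.
Qed.

Lemma bounded_opD H K (A B : H -> K) :
  bounded_op A -> bounded_op B -> bounded_op (fun x => A x + B x).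
Proof.
move=> bA bB; have [c c0 hc] := bounded_op_bound bA.
have [d d0 hd] := bounded_op_bound bB.
apply: (@bound_bounded_op _ _ _ (c + d)) => [b x y|x].
  by rewrite bA.1 bB.1 scalerDr addrACA.
by apply: le_trans (rnormD _ _) _; rewrite mulrDl lerD.
Qed.

Lemma bounded_opB H K (A B : H -> K) :
  bounded_op A -> bounded_op B -> bounded_op (A \- B).
Proof.
move=> bA bB; have -> : A \- B = fun x => A x + (-1) *: B x.
  by apply/funext => x; rewrite scaleN1r.
by apply: bounded_opD => //; exact: bounded_opZ.
Qed.

Lemma bounded_op_sum H K I (r : seq I) (P : pred I) (F : I -> H -> K) :
  (forall i, bounded_op (F i)) -> bounded_op (fun x => \sum_(i <- r | P i) F i x).
Proof.
move=> bF; elim: r => [|i r ih].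
  rewrite (_ : (fun x => \sum_(i <- [::] | P i) F i x) = 0);
    first exact: bounded_op0.
  by apply/funext => x; rewrite big_nil.
have -> : (fun x => \sum_(j <- i :: r | P j) F j x) =
    (fun x => (if P i then F i else 0) x + \sum_(j <- r | P j) F j x).
  by apply/funext => x; rewrite big_cons; case: ifP => //; rewrite add0r.
by apply: bounded_opD => //; case: ifP => // _; exact: bounded_op0.
Qed.

(** [opnorm] is a [sup], meaningful for operators bounded on the unit ball; under these hypotheses
    convergence is expressed through [op_bound], the form used from here on. *)
Lemma op_cvgP H K (A : nat -> H -> K) (B : H -> K) :
  (forall n, bounded_op (A n)) -> bounded_op B ->
  op_cvg A B <-> (forall e, 0 < e -> exists N, forall n, (N <= n)%N ->
    op_bound (A n \- B) e).
Proof.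
move=> bA bB; have bAB n : bounded_op (A n \- B) by exact: bounded_opB.
rewrite /op_cvg; split=> h.
  move=> e e0; have /cvgrPdist_lt/(_ e e0) [N _ hN] := h.
  exists N => n Nn x; apply: le_trans (opnorm_bound (bAB n) x) _.
  rewrite ler_wpM2r //; have := hN n Nn; rewrite sub0r normrN => h'.
  by apply: le_trans (ler_norm _) _; exact: ltW.
apply/cvgrPdist_lt => e e0; have e20 : 0 < e / 2 by lra.
have [N hN] := h _ e20; exists N => // n /= Nn; rewrite sub0r normrN.
rewrite ger0_norm ?opnorm_ge0 //; apply: le_lt_trans (_ : _ <= e / 2) _;
  last by lra.
by apply: opnorm_le; [exact: ltW|exact: hN].
Qed.

End bounded_operators.

(** * Semi-spectral measures and simple functions *)

Lemma uniform_rcvgP (R : realType) (X : choiceType) (D : set X)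
    (u : nat -> X -> R[i]) (f : X -> R[i]) :
  {uniform D, u @ \oo --> f} <-> (forall e : R, 0 < e ->
    exists N, forall n, (N <= n)%N -> forall z, D z -> rnorm (u n z - f z) < e).
Proof.
split=> [h e e0|h P /uniform_nbhs [E [entE EP]]].
  have [] := h [set g | forall y, D y -> rnorm (g y - f y) < e].
    apply/uniform_nbhs; exists [set xy | ball xy.1 e%:C xy.2]; split.
      by rewrite -entourage_ballE; exists e%:C => //=; rewrite ltcR.
    by move=> g /= hg y /hg; rewrite -ball_normE /= normr_rnorm ltcR rdistC.
  by move=> N _ hN; exists N => n Nn z Dz; exact: hN.
move: entE; rewrite -entourage_ballE => -[e /= /gt0_complex[d d0 ->] he].
have [N hN] := h d d0; exists N => // n /= Nn; apply: EP => /= y Dy.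
by apply: he => /=; rewrite -ball_normE /= normr_rnorm ltcR rdistC hN.
Qed.

Section semispectral.
Context {R : realType} {d : measure_display} {X : measurableType d}.
Implicit Types H K : hilbertType R.
Implicit Types (s t : seq (R[i] * set X)).

Section semi.
Context (H : hilbertType R) (E : set X -> H -> H) (hE : semispectral_measure E).

Lemma semispectral_linear D : measurable D -> linear (E D).
Proof. by move=> mD; exact: (semispectral_bounded hE mD).1. Qed.

Lemma semispectralU A B x : measurable A -> measurable B -> A `&` B = set0 ->
  E (A `|` B) x = E A x + E B x.
Proof.
move=> mA mB AB; apply: inner_ext => y; rewrite innerDl.
have mF n : measurable (bigcup2 A B n) by rewrite /bigcup2; do 2!case: ifP => // _.
have tF : trivIset setT (bigcup2 A B) by rewrite -trivIset_bigcup2.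
have := @semispectral_sigma_additive _ _ _ _ _ hE _ mF tF x y;
  rewrite bigcup2E => h.
suff h' : \sum_(k < n) inner (E (bigcup2 A B k) x) y @[n --> \oo] -->
    (inner (E A x) y + inner (E B x) y).
  exact: (cvg_unique _ h h').
apply/nat_rcvgP => e e0; exists 2%N => -[|[|n]] // _.
rewrite !big_ord_recl /= big1 ?addr0 ?subrr ?rnorm0 // => i _.
by rewrite (semispectral0 hE) inner0l.
Qed.

(** * Finite measurable partitions, given as the fibres of a map to a finite type *)

Section fibers.
Context (I : finType) (h : X -> I) (mh : forall i, measurable [set x | h x = i]).

Lemma fiber_measurable (r : seq I) : measurable [set x | h x \in r].
Proof.
elim: r => [|i r ih]; first by rewrite [X in measurable X](_ : _ = set0) //;
  apply/seteqP; split.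
rewrite [X in measurable X](_ : _ = [set x | h x = i] `|` [set x | h x \in r]);
  first exact: measurableU.
apply/seteqP; split => x /=; rewrite in_cons; first by case/predU1P; [left|right].
by case=> [->|->]; rewrite ?eqxx ?orbT.
Qed.

Lemma fiber_sum (r : seq I) x : uniq r ->
  E [set x | h x \in r] x = \sum_(i <- r) E [set x | h x = i] x.
Proof.
elim: r => [_|i r ih /= /andP[ir ur]].
  rewrite big_nil -(semispectral0 hE x); congr (E _ x).
  by apply/seteqP; split.
rewrite big_cons -ih // -semispectralU //; first 1 last.
- exact: fiber_measurable.
- apply/seteqP; split => // y [/= ->]; by rewrite (negbTE ir).
congr (E _ x); apply/seteqP; split => y /=; rewrite in_cons; first by case/predU1P;
  [left|right].
by case=> [->|->]; rewrite ?eqxx ?orbT.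
Qed.

Lemma fiber_pred (P : pred I) x :
  E [set x | P (h x)] x = \sum_(i | P i) E [set x | h x = i] x.
Proof.
rewrite -big_enum /= -fiber_sum ?enum_uniq //; congr (E _ x).
by apply/seteqP; split=> y /=; rewrite mem_enum.
Qed.

Lemma fiber_sum_all x : \sum_i E [set x | h x = i] x = x.
Proof.
rewrite -(fiber_pred xpredT) /=.
by rewrite [X in E X](_ : _ = setT) ?(semispectralT hE) //; apply/seteqP; split.
Qed.

Lemma semispectral_pos_le D x y : measurable D ->
  2 * rnorm (inner (E D x) y) <=
  complex.Re (inner (E D x) x) + complex.Re (inner (E D y) y).
Proof.
move=> mD; have lE := semispectral_linear mD.
apply: (@hermitian_pos_le R H (fun x y => inner (E D x) y)) => *.
- by rewrite (linear_fun_add lE) innerDl.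
- by rewrite innerDr.
- by rewrite (linear_fun_scale lE) innerZl.
- by rewrite innerZr.
- exact: (semispectral_ge0 hE).
Qed.

(** The AM-GM inequalities for the forms [inner (E_i x) y] add up over the cells, because the
    numbers [inner (E_i x) x] sum to [|x|^2]. *)
Lemma fiber_bound (c : I -> R[i]) C : 0 <= C -> (forall z, rnorm (c (h z)) <= C) ->
  op_bound (fun x => \sum_i c i *: E [set x | h x = i] x) C.
Proof.
move=> C0 hc x; apply: rnorm_le_inner => // y.
rewrite inner_suml; apply: le_trans (_ : 2 * (\sum_i rnorm (inner (c i *: E [set x
  | h x = i] x) y)) <= _).
  by rewrite ler_wpM2l // rnorm_sum.
rewrite mulr_sumr.
pose q x i := complex.Re (inner (E [set x | h x = i] x) x).
have sq z : \sum_i q z i = rnorm z ^+ 2.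
  have -> : rnorm z ^+ 2 = complex.Re (inner z z) by rewrite inner_normE.
  rewrite -[X in complex.Re (inner X z)](fiber_sum_all z) inner_suml /q.
  elim/big_rec2: _ => [|i a b _ ->]; first by [].
  by rewrite Re_add.
rewrite -!sq -big_split /= mulr_sumr; apply: ler_sum => i _.
rewrite innerZl rnormM mulrCA.
(* [c i] is controlled only on nonempty cells; an empty cell contributes nothing. *)
have [[z zi]|ne] := pselect (exists z, h z = i).
  have := hc z; rewrite zi => h1; apply: ler_pM => //; first by rewrite mulr_ge0.
  exact: semispectral_pos_le.
have -> : [set x | h x = i] = set0 by apply/seteqP; split => // z zi; apply: ne;
  exists z.
rewrite /q; have -> : [set x | h x = i] = set0 by apply/seteqP; split => // z zi;
  apply: ne; exists z.
by rewrite !(semispectral0 hE) !inner0l rnorm0 !mulr0 /= addr0 mulr0.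
Qed.

End fibers.

Definition meas_list s := forall k, measurable (nth (0, set0) s k).2.

(** The sets in [s] may overlap. They are refined into atoms, the fibres of the map [h] that records
    membership in each of them; on an atom the simple function is constant. *)
Lemma simple_integral_bound s C : meas_list s -> 0 <= C ->
  (forall z, rnorm (simple_fun s z) <= C) -> op_bound (simple_integral E s) C.
Proof.
move=> ms C0 hs.
pose D (i : 'I_(size s)) := (nth (0, set0) s i).2.
pose h (x : X) : {ffun 'I_(size s) -> bool} := [ffun i => `[< D i x >]].
have mh b : measurable [set x | h x = b].
  have -> : [set x | h x = b] = \bigcap_(i in [set: 'I_(size s)]) (if b i then D i
    else ~` D i).
    apply/seteqP; split => x /=.
      by move=> <- i _; rewrite ffunE; case: asboolP.
    move=> hx; apply/ffunP => i; rewrite ffunE; have := hx i I.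
    by case: (b i) => /= ?; [exact/asboolP|exact/asboolPn].
  apply: fin_bigcap_measurable => // i _.
  by case: ifP => _; [exact: ms|apply: measurableC; exact: ms].
have fE x : simple_fun s x = \sum_(i < size s | h x i) (nth (0, set0) s i).1.
  rewrite /simple_fun (big_nth (0, set0)) big_mkord [RHS]big_mkcond;
    apply: eq_bigr => i _.
  rewrite ffunE indicE; case: asboolP => Dx; first by rewrite mem_set // mulr1.
  by rewrite memNset // mulr0.
have iE x : simple_integral E s x = \sum_(b : {ffun 'I_(size s) -> bool})
    (\sum_(i < size s | b i) (nth (0, set0) s i).1) *: E [set x | h x = b] x.
  under [RHS]eq_bigr do rewrite scaler_suml big_mkcond.
  rewrite exchange_big /= /simple_integral (big_nth (0, set0)) big_mkord.
  apply: eq_bigr => i _; rewrite -big_mkcond -scaler_sumr; congr (_ *: _).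
  rewrite -(fiber_pred mh (fun b => b i)); congr (E _ x).
  by apply/seteqP; split=> y /=; rewrite ffunE; case: asboolP.
move=> x; rewrite iE; apply: fiber_bound => // z; rewrite -fE; exact: hs.
Qed.

End semi.
End semispectral.

(** * Algebra of simple functions; multiplicativity for spectral measures *)

Section simple_functions.
Context {R : realType} {d : measure_display} {X : measurableType d}.
Implicit Types H K : hilbertType R.
Implicit Types (s t : seq (R[i] * set X)).

Definition scale_list (a : R[i]) s := [seq (a * cD.1, cD.2) | cD <- s].

Definition mul_list s t :=
  [seq (cD.1 * cD'.1, cD.2 `&` cD'.2) | cD <- s, cD' <- t].

Lemma meas_listP s : meas_list s <-> (forall cD, List.In cD s -> measurable cD.2).
Proof.
split.
  elim: s => [|c s ih] //= h cD [<-|]; first exact: (h 0%N).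
  by apply: ih => k; exact: (h k.+1).
elim: s => [|c s ih] h [|k] //=; first by apply: h; left.
by apply: ih => cD ?; apply: h; right.
Qed.

Lemma meas_list_cat s t : meas_list s -> meas_list t -> meas_list (s ++ t).
Proof.
move=> /meas_listP hs /meas_listP ht; apply/meas_listP => cD.
by move=> /(@List.in_app_or _ s t)[/hs|/ht].
Qed.

Lemma meas_list_scale a s : meas_list s -> meas_list (scale_list a s).
Proof.
move=> /meas_listP hs; apply/meas_listP => cD.
by move=> /List.in_map_iff[cD' [<- /hs]].
Qed.

Lemma meas_list_mul s t : meas_list s -> meas_list t -> meas_list (mul_list s t).
Proof.
move=> /meas_listP hs /meas_listP ht; apply/meas_listP => cD; rewrite /mul_list.
elim: s hs => [|c s ih] /= hs; first by [].
move=> h; have {h} := @List.in_app_or _ _ _ _ h; case.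
  move=> /List.in_map_iff[cD' [<- /ht ?]] /=; apply: measurableI => //.
  by apply: hs; left.
by apply: ih => cD' ?; apply: hs; right.
Qed.

Lemma simple_fun_cat s t x : simple_fun (s ++ t) x = simple_fun s x + simple_fun t
  x.
Proof. by rewrite /simple_fun big_cat. Qed.

Lemma simple_fun_scale a s x : simple_fun (scale_list a s) x = a * simple_fun s x.
Proof.
rewrite /simple_fun /scale_list big_map mulr_sumr; apply: eq_bigr => i _.
by rewrite mulrA.
Qed.

Lemma simple_fun_mul s t x : simple_fun (mul_list s t) x = simple_fun s x *
  simple_fun t x.
Proof.
rewrite /simple_fun /mul_list big_allpairs_dep mulr_suml; apply: eq_bigr => i _.
rewrite mulr_sumr; apply: eq_bigr => j _ /=.
by rewrite indicI /= mulrACA.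
Qed.

Lemma simple_fun_bounded s : exists2 C, 0 <= C & forall x, rnorm (simple_fun s x)
  <= C.
Proof.
exists (\sum_(cD <- s) rnorm cD.1); first exact: sumr_ge0.
move=> x; apply: le_trans (rnorm_sum _ _ _) _; apply: ler_sum => i _.
rewrite rnormM indicE ler_piMr //; case: (_ \in _); by rewrite ?rnorm1 ?rnorm0.
Qed.

Lemma simple_integral_cat H (E : set X -> H -> H) s t x :
  simple_integral E (s ++ t) x = simple_integral E s x + simple_integral E t x.
Proof. by rewrite /simple_integral big_cat. Qed.

Lemma simple_integral_scale H (E : set X -> H -> H) a s x :
  simple_integral E (scale_list a s) x = a *: simple_integral E s x.
Proof.
rewrite /simple_integral /scale_list big_map scaler_sumr; apply: eq_bigr => i _.
by rewrite scalerA.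
Qed.

Lemma simple_integral_bounded_op H (E : set X -> H -> H) s :
  semispectral_measure E -> meas_list s -> bounded_op (simple_integral E s).
Proof.
move=> hE ms; have -> : simple_integral E s =
    fun x => \sum_(i < size s) (nth (0, set0) s i).1 *: E (nth (0, set0) s i).2 x.
  by apply/funext => x; rewrite /simple_integral (big_nth (0, set0)) big_mkord.
apply: bounded_op_sum => i; apply: bounded_opZ; apply: (semispectral_bounded hE).
exact: ms.
Qed.

Section spectral.
Context (H : hilbertType R) (F : set X -> H -> H) (hF : spectral_measure F).

Let hE := hF.1.

(* If P, Q and P + Q are idempotent then PQ + QP = 0, which forces PQ = 0. *)
Lemma spectral_disjoint A B x : measurable A -> measurable B -> A `&` B = set0 ->
  F A (F B x) = 0.
Proof.
move=> mA mB AB; have lA := semispectral_linear hE mA.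
have lB := semispectral_linear hE mB.
have mAB := measurableU _ _ mA mB.
have key y : F A (F B y) + F B (F A y) = 0.
  have := hF.2 _ mAB y.
  rewrite !(semispectralU hE) // (linear_fun_add lA) (linear_fun_add lB) !hF.2 //.
  by rewrite [F B (F A y) + _]addrC addrACA -[RHS]addr0 => /addrI.
have k1 := key x; have k2 := congr1 (F A) k1.
rewrite (linear_fun_add lA) (linear_fun0 lA) (hF.2 _ mA) in k2.
have k3 := key (F A x); rewrite (hF.2 _ mA) in k3.
have k4 : F A (F B x) = F B (F A x).
  apply: (addrI (F A (F B (F A x)))).
  by rewrite k3 addrC k2.
move: k1; rewrite -k4 -mulr2n => /eqP; rewrite -scaler_nat scaler_eq0 pnatr_eq0 /=.
by move=> /eqP.
Qed.

(** Both sets are split along their intersection; by [spectral_disjoint] only the common part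
    survives. *)
Lemma spectralI A B x : measurable A -> measurable B ->
  F A (F B x) = F (A `&` B) x.
Proof.
move=> mA mB; have mI := measurableI _ _ mA mB.
have mAB := measurableD mA mB; have mBA := measurableD mB mA.
have eA : A = (A `&` B) `|` (A `\` B) by rewrite setUIDK.
have eB : B = (A `&` B) `|` (B `\` A) by rewrite [X in X `|` _]setIC setUIDK.
have dA : (A `&` B) `&` (A `\` B) = set0 by apply/seteqP; split => // y [[_ ?] []].
have dB : (A `&` B) `&` (B `\` A) = set0 by apply/seteqP; split => // y [[? _] []].
have hA y : F A y = F (A `&` B) y + F (A `\` B) y by rewrite -semispectralU // -eA.
have hB y : F B y = F (A `&` B) y + F (B `\` A) y by rewrite -semispectralU // -eB.
rewrite hA hB (linear_fun_add (semispectral_linear hE mI)).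
rewrite (linear_fun_add (semispectral_linear hE mAB)) hF.2 //.
rewrite !(@spectral_disjoint _ _ x) ?addr0 //.
- by apply/seteqP; split => // y [[? ?] []].
- by apply/seteqP; split => // y [[? ?] []].
Qed.

Lemma simple_integral_mul s t x : meas_list s -> meas_list t ->
  simple_integral F (mul_list s t) x = simple_integral F s (simple_integral F t x).
Proof.
move=> ms mt; rewrite /simple_integral /mul_list big_allpairs_dep.
rewrite !(big_nth (0, set0)) !big_mkord; apply: eq_bigr => i _.
have lF := semispectral_linear hE (ms i).
rewrite (linear_fun_sum lF) scaler_sumr (big_nth (0, set0)) big_mkord;
  apply: eq_bigr => j _ /=.
by rewrite (linear_fun_scale lF) scalerA spectralI.
Qed.

End spectral.
End simple_functions.

(** * Integrals of uniform limits of simple functions *)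

Section integrals.
Context {R : realType} {d : measure_display} {X : measurableType d}.
Implicit Types H K : hilbertType R.
Implicit Types (s t : seq (R[i] * set X)) (g h : X -> R[i]).

Definition approximable g := forall e : R, 0 < e ->
  exists2 s, meas_list s & forall z, rnorm (simple_fun s z - g z) <= e.

(** The integral in epsilon form, directly against [E]. It needs no dilation, and it agrees with
    [semispectral_integral] as soon as a dilation exists ([semispectral_integralE]). *)
Definition is_int H (E : set X -> H -> H) g (A : H -> H) := forall e : R, 0 < e ->
  exists s, [/\ meas_list s, forall z, rnorm (simple_fun s z - g z) <= e
    & op_bound (simple_integral E s \- A) e].

Lemma is_int_approximable H (E : set X -> H -> H) g A : is_int E g A ->
  approximable g.
Proof. by move=> h e /h[s [ms hs _]]; exists s. Qed.

Lemma approximable_bounded g : approximable g ->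
  exists2 C, 0 <= C & forall z, rnorm (g z) <= C.
Proof.
move=> /(_ 1 ltr01)[s _ hs]; have [C C0 hC] := simple_fun_bounded s.
exists (C + 1); first by lra.
move=> z; rewrite -(subKr (simple_fun s z) (g z)).
by apply: le_trans (rnormB _ _) _; apply: lerD.
Qed.

Lemma op_bound_eps H K (A : H -> K) c :
  (forall r, 0 < r -> op_bound A (c + r)) -> op_bound A c.
Proof.
move=> h x; apply/ler_addgt0Pr => r r0.
have x1 : 0 < rnorm x + 1 by rewrite ltr_wpDl.
have := h (r / (rnorm x + 1)); rewrite divr_gt0 // => /(_ isT x) /le_trans; apply.
rewrite mulrDl lerD2l mulrAC ler_pdivrMr // ler_pM2l //; lra.
Qed.

Lemma op_boundW H K (A : H -> K) c c' : c <= c' -> op_bound A c -> op_bound A c'.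
Proof. by move=> cc h x; apply: le_trans (h x) _; rewrite ler_wpM2r. Qed.

Lemma op_boundD H K (A B : H -> K) c c' : op_bound A c -> op_bound B c' ->
  op_bound (fun x => A x + B x) (c + c').
Proof.
by move=> hA hB x; apply: le_trans (rnormD _ _) _; rewrite mulrDl lerD.
Qed.

Section semi.
Context (H : hilbertType R) (E : set X -> H -> H) (hE : semispectral_measure E).

(** [simple_integral_bound] compares [s] with one of the approximations defining [A], so any simple
    function is as close to the integral as it is to [g]. Riemann sums are controlled in this
    way. *)
Lemma is_int_le g A : is_int E g A -> forall s e, meas_list s -> 0 <= e ->
  (forall z, rnorm (simple_fun s z - g z) <= e) ->
  op_bound (simple_integral E s \- A) e.
Proof.
move=> hA s e ms e0 hs; apply: op_bound_eps => r r0.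
have r20 : 0 < r / 2 by lra.
have [t [mt ht htA]] := hA _ r20.
have mst : meas_list (s ++ scale_list (-1) t).
  by apply: meas_list_cat => //; exact: meas_list_scale.
have : op_bound (simple_integral E (s ++ scale_list (-1) t)) (e + r / 2).
  apply: simple_integral_bound => //; first by lra.
  move=> z; rewrite simple_fun_cat simple_fun_scale mulN1r.
  have -> : simple_fun s z - simple_fun t z =
    (simple_fun s z - g z) - (simple_fun t z - g z) by ring.
  by apply: le_trans (rnormB _ _) _; apply: lerD.
move=> /op_boundD/(_ htA) h x; have := h x.
rewrite simple_integral_cat simple_integral_scale scaleN1r /=.
rewrite addrA addrNK => /le_trans; apply; rewrite ler_wpM2r //; lra.
Qed.

Lemma is_int_bound g A C : is_int E g A -> 0 <= C ->
  (forall z, rnorm (g z) <= C) -> op_bound A C.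
Proof.
move=> hA C0 hC; apply: op_bound_eps => r r0.
have r20 : 0 < r / 2 by lra.
have [s [ms hs hsA]] := hA _ r20.
have h1 : op_bound (simple_integral E s) (C + r / 2).
  apply: simple_integral_bound => //; first by lra.
  move=> z; rewrite -(subrK (g z) (simple_fun s z)) addrC.
  by apply: le_trans (rnormD _ _) _; apply: lerD.
move=> x; rewrite -(subKr (simple_integral E s x) (A x)).
apply: le_trans (rnormB _ _) _; apply: le_trans (lerD (h1 x) (hsA x)) _.
rewrite -mulrDl ler_wpM2r //; lra.
Qed.

Lemma is_int_bounded_op g A : is_int E g A -> bounded_op A.
Proof.
move=> hA; have [C C0 hC] := approximable_bounded (is_int_approximable hA).
apply: (bound_bounded_op _ (is_int_bound hA C0 hC)) => a x y.
apply/eqP; rewrite -subr_eq0; apply/eqP/rnorm0_eq0/eqP.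
rewrite eq_le rnorm_ge0 andbT; apply/ler_addgt0Pr => r r0; rewrite add0r.
pose N := rnorm (a *: x + y) + (rnorm a * rnorm x + rnorm y) + 1.
have N0 : 0 < N by rewrite ltr_wpDl // !addr_ge0 // mulr_ge0.
have r'0 : 0 < r / N by rewrite divr_gt0.
have [s [ms hs hsA]] := hA _ r'0.
have [lS _] := simple_integral_bounded_op hE ms.
have -> : A (a *: x + y) - (a *: A x + A y) =
    (a *: (simple_integral E s x - A x) + (simple_integral E s y - A y)) -
    (simple_integral E s (a *: x + y) - A (a *: x + y)).
  by rewrite lS scalerBr addrACA -opprD opprB [RHS]addrC addrA addrNK.
apply: le_trans (rnormB _ _) _; apply: le_trans (lerD (rnormD _ _) (hsA _)) _.
rewrite rnormZ; apply: le_trans (lerD (lerD (ler_wpM2l _ (hsA _)) (hsA _)) (lexx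
  _)) _ => //.
rewrite mulrCA -!mulrDr mulrAC ler_pdivrMr // ler_pM2l // /N; lra.
Qed.

Lemma is_intD g h A B : is_int E g A -> is_int E h B ->
  is_int E (fun z => g z + h z) (fun x => A x + B x).
Proof.
move=> hA hB e e0; have e20 : 0 < e / 2 by lra.
have [s [ms hs hsA]] := hA _ e20; have [t [mt ht htB]] := hB _ e20.
exists (s ++ t); split; first exact: meas_list_cat.
  move=> z; rewrite simple_fun_cat opprD addrACA [e]splitr.
  by apply: le_trans (rnormD _ _) _; exact: lerD.
move=> x; rewrite /= simple_integral_cat opprD addrACA [e]splitr mulrDl.
by apply: le_trans (rnormD _ _) _; exact: lerD (hsA x) (htB x).
Qed.

Lemma is_intZ a g A : is_int E g A ->
  is_int E (fun z => a * g z) (fun x => a *: A x).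
Proof.
move=> hA e e0; have a1 : 0 < rnorm a + 1 by rewrite ltr_wpDl.
have e'0 : 0 < e / (rnorm a + 1) by rewrite divr_gt0.
have ae : rnorm a * (e / (rnorm a + 1)) <= e.
  rewrite mulrCA ler_piMr ?(ltW e0) // ler_pdivrMr //; lra.
have [s [ms hs hsA]] := hA _ e'0.
exists (scale_list a s); split; first exact: meas_list_scale.
  move=> z; rewrite simple_fun_scale -mulrBr rnormM.
  by apply: le_trans ae; rewrite ler_wpM2l.
move=> x; rewrite /= simple_integral_scale -scalerBr rnormZ.
apply: le_trans (ler_wpM2l _ (hsA x)) _ => //.
by rewrite mulrA ler_wpM2r.
Qed.

Lemma is_intB g h A B : is_int E g A -> is_int E h B ->
  is_int E (fun z => g z - h z) (fun x => A x - B x).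
Proof.
move=> hA hB; have := is_intD hA (is_intZ (-1) hB).
have -> : (fun z => g z + -1 * h z) = (fun z => g z - h z).
  by apply/funext => z; rewrite mulN1r.
by have -> : (fun x => A x + -1 *: B x) = (fun x => A x - B x)
  by apply/funext => x; rewrite scaleN1r.
Qed.

Lemma is_int_dist g h A B c : is_int E g A -> is_int E h B -> 0 <= c ->
  (forall z, rnorm (g z - h z) <= c) -> op_bound (A \- B) c.
Proof. by move=> hA hB c0 hc; exact: (is_int_bound (is_intB hA hB)). Qed.

Lemma is_int_unique g A B : is_int E g A -> is_int E g B -> A = B.
Proof.
move=> hA hB; apply/funext => x; apply/eqP; rewrite -subr_eq0;
  apply/eqP/rnorm0_eq0/eqP.
rewrite eq_le rnorm_ge0 andbT; have := is_int_dist hA hB (lexx 0).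
move=> /(_ _ x); rewrite mul0r; apply => z; by rewrite subrr rnorm0.
Qed.

Lemma is_int_lim g A (B : nat -> H -> H) :
  (forall e, 0 < e -> exists n h, [/\ is_int E h (B n),
     forall z, rnorm (h z - g z) <= e & op_bound (B n \- A) e]) -> is_int E g A.
Proof.
move=> hB e e0; have e20 : 0 < e / 2 by lra.
have [n [h [hBn hh BA]]] := hB _ e20; have [s [ms hs hsB]] := hBn _ e20.
exists s; split=> // [z|x].
  rewrite -(subrK (h z) (simple_fun s z)) -addrA [e]splitr.
  by apply: le_trans (rnormD _ _) _; apply: lerD.
rewrite /= -(subrK (B n x) (simple_integral E s x)) -addrA [e]splitr mulrDl.
by apply: le_trans (rnormD _ _) _; apply: lerD; [exact: hsB|exact: BA].
Qed.

(** Simple functions within [1/(n+1)] of [g] have integrals that are Cauchy in operator norm; the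
    limit is taken pointwise by completeness of [H], and the uniform rate survives. *)
Lemma is_int_exists g : approximable g -> exists A, is_int E g A.
Proof.
move=> hg; have /choice[s hs] (n : nat) : exists t, meas_list t /\
    forall z, rnorm (simple_fun t z - g z) <= n.+1%:R^-1.
  by have [|t mt ht] := hg (n.+1%:R^-1); [rewrite invr_gt0|exists t].
have inv_small e : 0 < e -> exists N, forall n, (N <= n)%N -> n.+1%:R^-1 <= e :> R.
  move=> e0; exists (Num.truncn e^-1) => n Nn;
    rewrite -[e]invrK lef_pV2 ?posrE ?invr_gt0 //.
  by apply: ltW; apply: lt_le_trans (truncnS_gt _) _; rewrite ler_nat ltnS.
have hd m n : op_bound (simple_integral E (s m) \- simple_integral E (s n))
    (m.+1%:R^-1 + n.+1%:R^-1).
  move=> x; have := @simple_integral_bound _ _ _ _ _ hE (s m ++ scale_list (-1) (s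
    n)) (m.+1%:R^-1 + n.+1%:R^-1).
  have h : meas_list (s m ++ scale_list (-1) (s n)).
    by apply: meas_list_cat; [case: (hs m)|apply: meas_list_scale; case: (hs n)].
  move=> /(_ h); rewrite addr_ge0 ?invr_ge0 // => /(_ isT) k.
  have := k _ x; rewrite simple_integral_cat simple_integral_scale scaleN1r; apply.
  move=> z; rewrite simple_fun_cat simple_fun_scale mulN1r.
  have -> : simple_fun (s m) z - simple_fun (s n) z =
    (simple_fun (s m) z - g z) - (simple_fun (s n) z - g z) by ring.
  by apply: le_trans (rnormB _ _) _; apply: lerD; [case: (hs m)|case: (hs n)].
have lim x : exists l : H, simple_integral E (s n) x @[n --> \oo] --> l.
  apply: rcauchy_cvg => e e0; have x1 : 0 < rnorm x + 1 by rewrite ltr_wpDl.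
  have := inv_small (e / (2 * (rnorm x + 1))).
  rewrite divr_gt0 ?mulr_gt0 // => /(_ isT)[N hN].
  exists N => m n Nm Nn; apply: le_lt_trans (hd m n x) _.
  apply: le_lt_trans (ler_wpM2r _ (lerD (hN m Nm) (hN n Nn))) _ => //.
  rewrite -(ltr_pM2r x1);
    have -> : (e / (2 * (rnorm x + 1)) + e / (2 * (rnorm x + 1))) * rnorm x *
    (rnorm x + 1) = e * rnorm x.
    by field; rewrite gt_eqF.
  by rewrite ltr_pM2l //; lra.
have [A hA] := choice lim.
exists A => e e0; have e20 : 0 < e / 2 by lra.
have [N hN] := inv_small _ e20; exists (s N); split; first by case: (hs N).
  by move=> z; apply: le_trans (_ : _ <= e / 2) _; [apply: le_trans (hN N _);
    case: (hs N)|lra].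
move=> x; apply/ler_addgt0Pr => r r0.
have /nat_rcvgP/(_ r r0)[M hM] := hA x.
pose n := maxn M N; rewrite /= -(subrK (simple_integral E (s n) x) (simple_integral
  E (s N) x)) -addrA.
apply: le_trans (rnormD _ _) _; apply: lerD; last first.
  by apply: ltW; apply: hM; rewrite /n leq_maxl.
apply: le_trans (hd N n x) _; rewrite ler_wpM2r // [e]splitr lerD //;
  apply: hN => //.
by rewrite /n leq_maxr.
Qed.

End semi.
End integrals.

Lemma cauchy_schwarz (R : realType) (H : hilbertType R) (x y : H) :
  rnorm (inner x y) <= rnorm x * rnorm y.
Proof.
have [->|x0] := eqVneq x 0; first by rewrite inner0l !rnorm0 mul0r.
have [->|y0] := eqVneq y 0; first by rewrite inner0r !rnorm0 mulr0.
have nx := rnorm_gt0 x0; have ny := rnorm_gt0 y0.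
have := inner_le ((rnorm x)^-1%:C *: x) ((rnorm y)^-1%:C *: y).
rewrite innerZl innerZr conj_Creal ?complex_real // !rnormM !rnormZ !rnormC.
rewrite !gtr0_norm ?invr_gt0 // !mulVf ?gt_eqF // expr1n.
move=> h; have -> : rnorm (inner x y) =
    (rnorm x)^-1 * ((rnorm y)^-1 * rnorm (inner x y)) * (rnorm x * rnorm y).
  by field; rewrite !gt_eqF.
by rewrite ler_piMl ?mulr_ge0 //; lra.
Qed.

(** * Products, dilations and compressions of integrals *)

Section spectral_integrals.
Context {R : realType} {d : measure_display} {X : measurableType d}.
Implicit Types H K : hilbertType R.
Implicit Types (g h : X -> R[i]).

(** Rests on the product rule for projections, [spectralI], through [simple_integral_mul]; a general
    semi-spectral measure has no such rule. *)
Lemma is_int_mul H (F : set X -> H -> H) g h A B : spectral_measure F ->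
  is_int F g A -> is_int F h B -> is_int F (fun z => g z * h z) (A \o B).
Proof.
move=> hF hA hB e e0; have hE := hF.1.
have [C C0 hC] := approximable_bounded (is_int_approximable hA).
have [D D0 hD] := approximable_bounded (is_int_approximable hB).
have bA := is_int_bound hE hA C0 hC.
(* With [r <= 1] the error of the product is at most [r * (D + r) + C * r <= r * (C + D + 1)]. *)
pose r := Num.min 1 (e / (C + D + 1)).
have r0 : 0 < r by rewrite /r lt_min ltr01 /= divr_gt0 // ltr_wpDl // addr_ge0.
have r1 : r <= 1 by rewrite /r ge_min lexx.
have re : r * (D + r) + C * r <= e.
  apply: le_trans (_ : r * (C + D + 1) <= e); first by nra.
  rewrite -ler_pdivlMr ?ltr_wpDl ?addr_ge0 //.
  by rewrite /r ge_min lexx orbT.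
have [s [ms hs sA]] := hA _ r0; have [t [mt ht tB]] := hB _ r0.
have bt z : rnorm (simple_fun t z) <= D + r.
  rewrite -(subrK (h z) (simple_fun t z)) addrC.
  by apply: le_trans (rnormD _ _) _; apply: lerD.
have bT : op_bound (simple_integral F t) (D + r).
  by apply: simple_integral_bound => //; lra.
exists (mul_list s t); split; first exact: meas_list_mul.
  move=> z; rewrite simple_fun_mul; apply: le_trans re.
  have -> : simple_fun s z * simple_fun t z - g z * h z =
    (simple_fun s z - g z) * simple_fun t z + g z * (simple_fun t z - h z) by ring.
  apply: le_trans (rnormD _ _) _; rewrite !rnormM.
  by apply: lerD; apply: ler_pM.
move=> x; rewrite /= (simple_integral_mul hF) //.
have bA' := is_int_bounded_op hE hA.
rewrite -(subrK (A (simple_integral F t x)) (simple_integral F s _)) -addrA.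
rewrite -(linear_fun_sub bA'.1); apply: le_trans (rnormD _ _) _.
apply: le_trans (ler_wpM2r _ re) => //; rewrite mulrDl.
apply: lerD.
  by apply: le_trans (sA _) _; rewrite -mulrA ler_wpM2l // ltW.
apply: le_trans (bA _) _; rewrite -mulrA ler_wpM2l //; exact: tB.
Qed.

Lemma is_int1 H (E : set X -> H -> H) : semispectral_measure E ->
  is_int E (fun=> 1) id.
Proof.
move=> hE e e0; exists [:: (1, setT)]; split.
- by move=> [|[|k]] /=.
- move=> z; rewrite /simple_fun big_seq1 /= indicE mem_set // mul1r subrr rnorm0
  ltW //.
- move=> x; rewrite /= /simple_integral big_seq1 /= scale1r (semispectralT hE)
  subrr rnorm0.
  by rewrite mulr_ge0 // ltW.
Qed.

Lemma embedding_rnorm H K (V : H -> K) x : embedding V -> rnorm (V x) = rnorm x.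
Proof.
move=> [_ hV]; have := hV x x; rewrite !inner_normE => /complexI /eqP.
by rewrite eqrXn2 // => /eqP.
Qed.

Lemma compression_inner H K (V : H -> K) A B x y : embedding V ->
  compression V A B -> inner (A (V x)) (V y) = inner (B x) y.
Proof.
move=> [_ hV] /(_ x y); rewrite innerBl hV => /eqP; rewrite subr_eq0 => /eqP //.
Qed.

Lemma compression_unique H K (V : H -> K) A B B' : embedding V ->
  compression V A B -> compression V A B' -> B = B'.
Proof.
move=> eV h h'; apply/funext => x; apply: inner_ext => z.
by rewrite -(compression_inner _ _ eV h) -(compression_inner _ _ eV h').
Qed.

Lemma compression_linear H K (V : H -> K) A B : embedding V -> linear A ->
  compression V A B -> linear B.
Proof.
move=> eV lA h a x y; apply: inner_ext => z.
rewrite innerDl innerZl -!(compression_inner _ _ eV h) eV.1 lA.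
by rewrite innerDl innerZl.
Qed.

Lemma compression_bound H K (V : H -> K) A B c : embedding V -> 0 <= c ->
  op_bound A c -> compression V A B -> op_bound B c.
Proof.
move=> eV c0 bA h x; have [->|Bx0] := eqVneq (B x) 0.
  by rewrite rnorm0 mulr_ge0.
have n0 : 0 < rnorm (B x).
  exact: rnorm_gt0.
rewrite -(ler_pM2r n0); have := cauchy_schwarz (A (V x)) (V (B x)).
rewrite (compression_inner _ _ eV h) inner_normE rnormC ger0_norm ?sqr_ge0 //.
rewrite (embedding_rnorm _ eV) -expr2 => /le_trans; apply; rewrite ler_wpM2r //.
by apply: le_trans (bA _) _; rewrite (embedding_rnorm _ eV).
Qed.

Section dilation.
Context (H K : hilbertType R) (V : H -> K) (E : set X -> H -> H)
  (F : set X -> K -> K) (dil : spectral_dilation V E F).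

(** [spectral_dilation] asks nothing of [E] but to be a compression of [F]; positivity,
    normalisation and additivity are inherited through the sesquilinear form. *)
Lemma dilation_semispectral : semispectral_measure E.
Proof.
have [eV hF hc] := dil; have hS := hF.1.
have b1 D : measurable D -> op_bound (F D) 1.
  move=> mD; have <- : simple_integral F [:: (1, D)] = F D.
    by apply/funext => x; rewrite /simple_integral big_seq1 scale1r.
  apply: simple_integral_bound => //; first by case=> [|[|k]] /=.
  move=> z; rewrite /simple_fun big_seq1 mul1r indicE; case: (_ \in _);
    by rewrite ?rnorm1 ?rnorm0.
have ci D x y : measurable D -> inner (F D (V x)) (V y) = inner (E D x) y.
  by move=> mD; exact: compression_inner (hc _ mD).
split.
- move=> D mD; have lF := semispectral_linear hS mD.
  by apply: (@bound_bounded_op _ _ _ _ 1);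
    [exact: compression_linear (hc _ mD)|exact: compression_bound (b1 _ mD) (hc _
      mD)].
- by move=> D mD x; rewrite -ci //; exact: (semispectral_ge0 hS).
- move=> x; apply: inner_ext => y.
  by rewrite -ci // (semispectral0 hS) !inner0l.
- move=> x; apply: inner_ext => y.
  by rewrite -ci // (semispectralT hS) eV.2.
- move=> G mG tG x y; rewrite -ci; last exact: bigcupT_measurable.
  have := @semispectral_sigma_additive _ _ _ _ _ hS _ mG tG (V x) (V y).
  by under eq_fun do under eq_bigr do rewrite ci //.
Qed.

Lemma is_int_compression g A B : is_int F g B -> is_int E g A -> compression V B A.
Proof.
have [eV hF hc] := dil; move=> hB hA x y; rewrite innerBl eV.2.
apply/eqP; rewrite subr_eq0 -subr_eq0; apply/eqP/rnorm0_eq0/eqP.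
rewrite eq_le rnorm_ge0 andbT; apply/ler_addgt0Pr => r r0; rewrite add0r.
pose N := 2 * (rnorm x * rnorm y) + 1.
have N0 : 0 < N by rewrite ltr_wpDl // !mulr_ge0.
have r'0 : 0 < r / N by rewrite divr_gt0.
have [s [ms hs sB]] := hB _ r'0.
have sA := is_int_le dilation_semispectral hA ms (ltW r'0) hs.
have e1 : inner (simple_integral F s (V x)) (V y) = inner (simple_integral E s x) y.
  rewrite /simple_integral !(big_nth (0, set0)) !big_mkord !inner_suml;
    apply: eq_bigr => i _.
  by rewrite !innerZl (compression_inner _ _ eV (hc _ (ms i))).
have -> : inner (B (V x)) (V y) - inner (A x) y =
   inner (simple_integral E s x - A x) y - inner (simple_integral F s (V x) - B (V
     x)) (V y).
  by rewrite !innerBl e1; ring.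
apply: le_trans (rnormB _ _) _.
apply: le_trans (lerD (cauchy_schwarz _ _) (cauchy_schwarz _ _)) _.
have := sA x; have := sB (V x); rewrite /= !(embedding_rnorm _ eV) => h1 h2.
apply: le_trans (lerD (ler_wpM2r _ h2) (ler_wpM2r _ h1)) _ => //.
have -> : r / N * rnorm x * rnorm y + r / N * rnorm x * rnorm y = r * (2 * (rnorm x
  * rnorm y)) / N.
  by field; rewrite gt_eqF.
by rewrite ler_pdivrMr // ler_pM2l // /N; lra.
Qed.

(** The integral against [E] exists because [g] is approximable, a property of [g] alone; it is a
    compression of [B], and compressions are unique. *)
Lemma is_int_compress g A B : is_int F g B -> compression V B A -> is_int E g A.
Proof.
move=> hB cA; have [A' hA'] := is_int_exists dilation_semispectral
  (is_int_approximable hB).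
have [eV _ _] := dil.
by rewrite (compression_unique eV cA (is_int_compression hB hA')).
Qed.

End dilation.

Lemma is_spectral_integral_int H (E : set X -> H -> H) g A :
  semispectral_measure E -> is_spectral_integral E g A -> is_int E g A.
Proof.
move=> hE [bA [s [ms /uniform_rcvgP us]]].
have bS n : bounded_op (simple_integral E (s n)).
  by apply: simple_integral_bounded_op => // k; exact: ms.
move=> /(op_cvgP bS bA) cS e e0.
have [N hN] := us e e0; have [M hM] := cS e e0.
exists (s (maxn N M)); split; first by move=> k; exact: ms.
  by move=> z; apply: ltW; apply: hN => //; rewrite leq_maxl.
by apply: hM; rewrite leq_maxr.
Qed.

Lemma is_int_spectral_integral H (E : set X -> H -> H) g A :
  semispectral_measure E -> is_int E g A -> is_spectral_integral E g A.
Proof.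
move=> hE hA; have bA := is_int_bounded_op hE hA; split => //.
have /choice[s hs] (n : nat) := hA (n.+1%:R^-1) ltac:(by rewrite invr_gt0).
have inv_small e : 0 < e -> exists N, forall n, (N <= n)%N -> n.+1%:R^-1 < e :> R.
  move=> e0; exists (Num.truncn e^-1) => n Nn;
    rewrite -[e]invrK ltf_pV2 ?posrE ?invr_gt0 //.
  by apply: lt_le_trans (truncnS_gt _) _; rewrite ler_nat ltnS.
exists s; split.
- by move=> n k; have [ms _ _] := hs n; exact: ms.
- apply/uniform_rcvgP => e /inv_small[N hN]; exists N => n /hN Nn z _.
  by apply: le_lt_trans Nn; have [_ h _] := hs n.
- apply/op_cvgP => //; first by move=> n; have [ms _ _] := hs n;
  exact: simple_integral_bounded_op.
  move=> e /inv_small[N hN]; exists N => n /hN Nn.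
  by apply: op_boundW (ltW Nn) _; have [_ _] := hs n.
Qed.

(** Independence of the dilation: whichever dilation a value comes from, that value is the [is_int]
    integral against [E], which is unique. *)
Lemma semispectral_integralE H K (V : H -> K) (E : set X -> H -> H)
    (F : set X -> K -> K) g A :
  spectral_dilation V E F -> is_int E g A -> semispectral_integral E g = A.
Proof.
move=> dil hA; have hE := dilation_semispectral dil.
apply: xget_subset1; last first.
  move=> A1 A2 h1 h2; suff u A' : is_semispectral_integral E g A' -> A' = A by
    rewrite (u _ h1) (u _ h2).
  move=> [bA' [K' [V' [F' [B' [dil' hB' cB']]]]]].
  have [eV' hF' _] := dil'.
  have := is_spectral_integral_int hF'.1 hB'.
  by move=> /(is_int_compress dil')/(_ cB') hA'; exact: is_int_unique hA' hA.
have [eV hF _] := dil.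
have [B hB] := is_int_exists hF.1 (is_int_approximable hA).
split; first exact: is_int_bounded_op hA.
exists K, V, F, B; split => //; first exact: is_int_spectral_integral hF.1 hB.
exact: is_int_compression hB hA.
Qed.

End spectral_integrals.

(** * Integrals of polynomials against a semi-spectral measure of a contraction *)

Section functional_calculus.
Context {R : realType} (H : hilbertType R) (T : H -> H).
Context (E : set (circle R) -> H -> H) (hE : semispectral_measure_of T E).

Lemma semispectral_measure_ofP : semispectral_measure E.
Proof.
have [K [V [U [F [[eV uU _] [hF _] hc]]]]] := hE.
by apply: (@dilation_semispectral _ _ _ _ K V E F).
Qed.

Lemma semispectral_integral_of g A : is_int E g A -> semispectral_integral E g = A.
Proof.
have [K [V [U [F [[eV uU _] [hF _] hc]]]]] := hE.
by apply: (@semispectral_integralE _ _ _ _ K V E F).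
Qed.

Lemma is_int_exprn n : is_int E (fun z => sval z ^+ n) (iter n T).
Proof.
have [K [V [U [F [[eV uU hU] [hF iU] hc]]]]] := hE.
have dil : spectral_dilation V E F by [].
apply: (is_int_compress dil _ (hU n)).
have hU' := is_spectral_integral_int hF.1 iU.
elim: n => [|n ih]; first exact: is_int1 hF.1.
under eq_fun do rewrite exprS.
exact: (is_int_mul hF hU' ih).
Qed.

Lemma is_int_poly (p : {poly R[i]}) : is_int E (fun z => p.[sval z]) (poly_op p T).
Proof.
have hS := semispectral_measure_ofP.
have -> : (fun z : circle R => p.[sval z]) =
    (fun z => \sum_(k < size p) p`_k * sval z ^+ k).
  by apply/funext => z; rewrite horner_coef.
rewrite /poly_op; elim: (size p) => [|n ih].
  have -> : (fun x => \sum_(k < 0) p`_k *: iter k T x) = fun x => 0 *: iter 0 T x.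
    by apply/funext => x; rewrite big_ord0 scale0r.
  have -> : (fun z : circle R => \sum_(k < 0) p`_k * sval z ^+ k) = (fun z => 0 *
    sval z ^+ 0).
    by apply/funext => z; rewrite mul0r big_ord0.
  exact: is_intZ (is_int_exprn 0).
have -> : (fun x => \sum_(k < n.+1) p`_k *: iter k T x) =
    fun x => (\sum_(k < n) p`_k *: iter k T x) + p`_n *: iter n T x.
  by apply/funext => x; rewrite big_ord_recr.
have -> : (fun z : circle R => \sum_(k < n.+1) p`_k * sval z ^+ k) =
    (fun z => \sum_(k < n) p`_k * sval z ^+ k + p`_n * sval z ^+ n).
  by apply/funext => z; rewrite big_ord_recr.
by apply: is_intD => //; apply: is_intZ; exact: is_int_exprn.
Qed.

End functional_calculus.

(** * Continuous functions on the closed disk *)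

(* Type class inference does not see through the copied topology of R[i]. *)
#[global] Instance complex_nbhs_pfilter (R : realType) (z : R[i]) : ProperFilter
  (nbhs z).
Proof. exact: (@nbhs_pfilter R[i] z). Qed.

Section closed_disk.
Context {R : realType}.
Implicit Types f : R[i] -> R[i].

Lemma continuous_complex_pair : continuous (fun x : R * R => x.1 +i* x.2 : R[i]).
Proof.
move=> [a b]; apply/rcvgP => e e0; have e20 : 0 < e / 2 by lra.
have ha : x.1 @[x --> (a, b)] --> a by apply: cvg_fst.
have hb : x.2 @[x --> (a, b)] --> b by apply: cvg_snd.
near=> x; apply: le_lt_trans (rnorm_le_ReIm _) _; rewrite [e]splitr.
apply: ltrD; near: x.
  by move/cvgrPdist_lt: ha => /(_ _ e20); apply: filterS => x /=; rewrite distrC;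
    case: x.
by move/cvgrPdist_lt: hb => /(_ _ e20); apply: filterS => x /=; rewrite distrC;
  case: x.
Unshelve. all: by end_near. Qed.

Lemma near_dist (z : R[i]) (e : R) : 0 < e -> \forall w \near z, rnorm (w - z) < e.
Proof.
move=> e0; apply/(@nbhs_ballP R[i] R[i]); exists e%:C => /=; first by rewrite ltcR.
by move=> w; rewrite -ball_normE /= normr_rnorm ltcR rdistC.
Qed.

Lemma rnorm_cvg (z : R[i]) : rnorm w @[w --> z] --> rnorm z.
Proof.
apply/cvgrPdist_lt => e e0; near=> w.
have : rnorm (w - z) < e by near: w; exact: near_dist.
apply: le_lt_trans.
have := rnormD (w - z) z; have := rnormD (z - w) w.
by rewrite !subrK [rnorm (w - z)]rdistC ler_norml; lra.
Unshelve. all: by end_near. Qed.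

Lemma cdisk_compact : compact (@cdisk R).
Proof.
pose K : set (R * R) := `[-1, 1] `*` `[-1, 1].
have cK : compact K by apply: compact_setX; exact: segment_compact.
have := @continuous_compact _ _ (fun x : R * R => x.1 +i* x.2 : R[i]) K.
move=> /(_ (continuous_subspaceT continuous_complex_pair) cK) cI.
apply: subclosed_compact cI _; last first.
  move=> [a b]; rewrite cdisk_rnorm => h; exists (a, b) => //; split => /=.
    by have := le_trans (rnorm_Re _) h; rewrite in_itv /= ler_norml.
  by have := le_trans (rnorm_Im _) h; rewrite in_itv /= ler_norml.
have -> : cdisk = (fun z : R[i] => rnorm z) @^-1` [set x | x <= 1].
  by apply/seteqP; split => z; rewrite cdisk_rnorm.
by apply: preimage_closed => [z _|]; [exact: rnorm_cvg|exact: closed_le].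
Qed.

Lemma within_nbhsP (P : set R[i]) (D : set R[i]) (x : R[i]) :
  (within D (nbhs x)) P <-> exists2 d : R, 0 < d & forall w, D w -> rnorm (w - x) <
    d -> P w.
Proof.
rewrite withinE; split.
  move=> [S /(@nbhs_ballP R[i] R[i]) [e /= /gt0_complex[d d0 ->] hd] SP].
  exists d => // w Dw; rewrite rdistC => wx.
  suff : (S `&` D) w by rewrite -SP => -[].
  by split => //; apply: hd; rewrite -ball_normE /= normr_rnorm ltcR.
move=> [d d0 hd]; exists [set w | D w -> P w]; last by apply/seteqP;
  split => w /= [h Dw]; split => //; exact: h.
apply/(@nbhs_ballP R[i] R[i]); exists d%:C => /=; first by rewrite ltcR.
by move=> w; rewrite -ball_normE /= normr_rnorm ltcR rdistC => h Dw; exact: hd.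
Qed.

Lemma within_cdisk_continuousP f : {within cdisk, continuous f} <->
  forall x, cdisk x -> forall e : R, 0 < e -> exists2 d : R, 0 < d &
    forall w, cdisk w -> rnorm (w - x) < d -> rnorm (f w - f x) < e.
Proof.
rewrite subspace_continuousP; split => h x Dx.
  move=> e e0; have /rcvgP/(_ e e0) := h x Dx.
  by move=> /within_nbhsP.
by apply/rcvgP => e e0; apply/within_nbhsP; exact: h.
Qed.

(** Compactness in near-covering form: the property spread over the disk is indexed by the modulus
    [d], tending to 0 from the right. *)
Lemma cdisk_uniform_continuous f : {within cdisk, continuous f} ->
  forall e : R, 0 < e -> exists2 d : R, 0 < d &
    forall z w, cdisk z -> cdisk w -> rnorm (w - z) < d -> rnorm (f w - f z) < e.
Proof.
move=> /within_cdisk_continuousP cf e e0; have e20 : 0 < e / 2 by lra.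
have /compact_near_coveringP/near_covering_withinP := cdisk_compact.
move=> /(_ R (0^'+) (fun d x => forall w, cdisk w -> rnorm (w - x) < d -> rnorm (f
  w - f x) < e)).
case=> [|d0 /= d00 hd0].
- move=> x Dx; have [d d0 hd] := cf x Dx _ e20; have d20 : 0 < d / 2 by lra.
  near=> x' i => Dx' w Dw wx'.
  have xx' : rnorm (x' - x) < d / 2.
    near: x'; exact: near_dist.
  have id2 : i < d / 2 by near: i; exact: nbhs_right_lt.
  have -> : f w - f x' = (f w - f x) - (f x' - f x) by ring.
  apply: le_lt_trans (rnormB _ _) _; rewrite [e]splitr; apply: ltrD;
    apply: hd => //; last by lra.
  have -> : w - x = (w - x') + (x' - x) by ring.
  apply: le_lt_trans (rnormD _ _) _; apply: lt_trans (ltrD wx' xx') _.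
  by rewrite [ltRHS]splitr ltrD2r.
have d02 : 0 < d0 / 2 by lra.
exists (d0 / 2) => // z w Dz Dw wz; apply: (hd0 (d0 / 2)) => //=.
by rewrite sub0r normrN gtr0_norm //; lra.
Unshelve. all: by end_near. Qed.

Lemma cdisk_continuous_bounded f : {within cdisk, continuous f} ->
  exists C : R, forall z, cdisk z -> rnorm (f z) <= C.
Proof.
move=> /within_cdisk_continuousP cf.
have /compact_near_coveringP/near_covering_withinP := cdisk_compact.
move=> /(_ nat \oo (fun n x => rnorm (f x) <= n%:R)).
case=> [|N /= _ hN].
- move=> x Dx; have [d d0 hd] := cf x Dx _ ltr01.
  near=> x' n => Dx'.
  have h : rnorm (f x' - f x) < 1.
    apply: hd => //; near: x'; exact: near_dist.
  rewrite -(subrK (f x) (f x')); apply: le_trans (rnormD _ _) _.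
  have nn : 1 + rnorm (f x) <= n%:R by near: n; exact: nbhs_infty_ger.
  by apply: le_trans nn; rewrite lerD2r ltW.
by exists N%:R => z Dz; exact: (hN N (leqnn _)).
Unshelve. all: by end_near. Qed.

Lemma le_supnorm f z : {within cdisk, continuous f} -> cdisk z -> rnorm (f z) <=
  supnorm f.
Proof.
move=> /cdisk_continuous_bounded[C hC] Dz; apply: ub_le_sup; last by exists z.
by exists C => _ [w Dw <-]; exact: hC.
Qed.

Lemma supnorm_le f C : (forall z, cdisk z -> rnorm (f z) <= C) -> supnorm f <= C.
Proof.
move=> hC; apply: ge_sup; last by move=> _ [w Dw <-]; exact: hC.
by exists (rnorm (f 0)); exists 0 => //; rewrite cdisk_rnorm rnorm0.
Qed.

Lemma circle_cdisk (z : circle R) : cdisk (sval z).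
Proof. by rewrite cdisk_rnorm circle_rnorm. Qed.

End closed_disk.

(** * Double operator integrals as limits of Riemann sums *)

Section partitions.
Context {R : realType}.

Lemma circle_open_measurable (A : set (circle R)) : open A -> measurable A.
Proof. by move=> oA; apply: sub_sigma_algebra. Qed.

(** A 1-Lipschitz [u] has open sublevel sets; used for real and imaginary parts. *)
Lemma circle_ltr_measurable (u : R[i] -> R) (b : R) :
  (forall z w, `|u z - u w| <= rnorm (z - w)) ->
  measurable [set z : circle R | u (sval z) < b].
Proof.
move=> hu; apply: circle_open_measurable.
have -> : [set z : circle R | u (sval z) < b] = sval @^-1` [set w : R[i] | u w < b]
  by [].
apply: open_comp; first by move=> z _; exact: initial_continuous.
rewrite openE => w /= wb; apply/(@nbhs_ballP R[i] R[i]); exists (b - u w)%:C.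
  by rewrite /= ltcR subr_gt0.
move=> v; rewrite -ball_normE /= normr_rnorm ltcR => h.
by have := hu w v; rewrite ler_norml; lra.
Qed.

(** A square grid on real and imaginary parts, with a tag chosen in each nonempty cell. The index of
    an empty cell is never of the form [h z], so its tag is arbitrary. *)
Lemma circle_partition (e : R) : 0 < e -> exists (I : finType) (h : circle R -> I)
  (pt : I -> circle R), (forall i, measurable [set z | h z = i]) /\
  forall z, rnorm (sval (pt (h z)) - sval z) < e.
Proof.
(* The mesh is [1 / M.+1] in each coordinate, and the two coordinates add. *)
move=> e0; pose M := Num.truncn (2 / e).
have Me : 2 / M.+1%:R < e.
  rewrite ltr_pdivrMr // mulrC -ltr_pdivrMr //; exact: truncnS_gt.
have M0 : (0 : R) < M.+1%:R by [].
(* The extra index is for [x = 1], where [(x + 1) * M.+1] equals [2 * M.+1]. *)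
pose q (x : R) : 'I_(2 * M.+1).+1 := inord (Num.truncn ((x + 1) * M.+1%:R)).
have qP x (i : 'I_(2 * M.+1).+1) : `|x| <= 1 ->
    (q x = i) <-> (i%:R <= (x + 1) * M.+1%:R < i.+1%:R).
  rewrite ler_norml => x1.
  have y0 : 0 <= (x + 1) * M.+1%:R by rewrite mulr_ge0 //; lra.
  rewrite -truncn_eq //.
  have y2 : (Num.truncn ((x + 1) * M.+1%:R) < (2 * M.+1).+1)%N.
    rewrite truncn_lt_nat // -[ltRHS]natr1 natrM.
    have : (x + 1) * M.+1%:R <= 2 * M.+1%:R by rewrite ler_wpM2r //; lra.
    by lra.
  split=> [<-|/eqP h]; first by rewrite inordK.
  by apply: val_inj; rewrite /q /= inordK.
pose h (z : circle R) := (q (complex.Re (sval z)), q (complex.Im (sval z))).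
have Re1 (z : circle R) : `|complex.Re (sval z)| <= 1 by rewrite -(circle_rnorm z)
  rnorm_Re.
have Im1 (z : circle R) : `|complex.Im (sval z)| <= 1 by rewrite -(circle_rnorm z)
  rnorm_Im.
have mq u i : (forall z w, `|u z - u w| <= rnorm (z - w)) -> (forall z : circle R,
  `|u (sval z)| <= 1) ->
    measurable [set z : circle R | q (u (sval z)) = i].
  move=> hu u1; have -> : [set z : circle R | q (u (sval z)) = i] =
     [set z : circle R | u (sval z) < i.+1%:R / M.+1%:R - 1] `\` [set z : circle R
       | u (sval z) < i%:R / M.+1%:R - 1].
    apply/seteqP; split => z /=.
      move=> /qP-/(_ (u1 z))/andP[h1 h2]; split.
        by rewrite ltrBrDr ltr_pdivlMr.
      by apply/negP; rewrite -leNgt lerBlDr ler_pdivrMr.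
    move=> [h1 /negP]; rewrite -leNgt => h2; apply/qP => //.
    by move: h1 h2; rewrite ltrBrDr ltr_pdivlMr // lerBlDr ler_pdivrMr // => -> ->.
  by apply: measurableD; exact: circle_ltr_measurable.
have ReB (z w : R[i]) : complex.Re z - complex.Re w = complex.Re (z - w) by case:
  z; case: w.
have ImB (z w : R[i]) : complex.Im z - complex.Im w = complex.Im (z - w) by case:
  z; case: w.
exists _, h, (fun i => xget point [set z | h z = i]); split.
  move=> [i j]; have -> : [set z | h z = (i, j)] =
      [set z : circle R | q (complex.Re (sval z)) = i] `&` [set z : circle R | q
        (complex.Im (sval z)) = j].
    by apply/seteqP; split => z; rewrite /h /=; [case=> -> ->|case=> -> ->].
  by apply: measurableI; apply: mq => // z w; rewrite ?ReB ?ImB ?rnorm_Re ?rnorm_Im.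
move=> z; have : h (xget point [set w | h w = h z]) = h z.
  by apply: (@xgetPex _ point [set w | h w = h z]); exists z.
move: (xget _ _) => w [/qP-/(_ (Re1 w)) h1 /qP-/(_ (Im1 w)) h2].
have /qP-/(_ (Re1 z)) h3 := erefl (q (complex.Re (sval z))).
have /qP-/(_ (Im1 z)) h4 := erefl (q (complex.Im (sval z))).
have key (a b i : R) : i <= (a + 1) * M.+1%:R < i + 1 -> i <= (b + 1) * M.+1%:R < i
  + 1 ->
    `|a - b| < M.+1%:R^-1.
  move=> /andP[k1 k2] /andP[k3 k4].
  have MV : M.+1%:R^-1 * M.+1%:R = 1 :> R by rewrite mulVf // gt_eqF.
  rewrite ltr_norml -(ltr_pM2r M0) -[X in _ && X](ltr_pM2r M0) mulNr MV; lra.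
apply: le_lt_trans (rnorm_le_ReIm _) _; rewrite -ReB -ImB; apply: lt_trans Me.
rewrite -[2]/(1 + 1) mulrDl !mul1r; apply: ltrD.
  by apply: (key _ _ (q (complex.Re (sval z)))%:R); rewrite natr1.
by apply: (key _ _ (q (complex.Im (sval z)))%:R); rewrite natr1.
Qed.

End partitions.

Lemma rcvg_sum (R : realType) (V : normedModType R[i]) I (r : seq I)
    (F : I -> nat -> V) (l : I -> V) :
  (forall i, F i n @[n --> \oo] --> l i) ->
  \sum_(i <- r) F i n @[n --> \oo] --> \sum_(i <- r) l i.
Proof.
move=> h; elim: r => [|i r ih].
  by rewrite big_nil; under eq_fun do rewrite big_nil; exact: cvg_cst.
by rewrite big_cons; under eq_fun do rewrite big_cons; exact: cvgD.
Qed.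

(** * Tagged Riemann sums and their limits *)

Section sampling.
Context {R : realType} (H : hilbertType R) (E : set (circle R) -> H -> H).
Context (hE : semispectral_measure E).
Implicit Types (f g : circle R -> R[i]) (Psi : circle R -> circle R -> R[i]).

Definition uniformly_continuous f := forall e : R, 0 < e -> exists2 d : R, 0 < d &
  forall z w : circle R, rnorm (sval z - sval w) < d -> rnorm (f z - f w) <= e.

Section partition.
Context (I : finType) (h : circle R -> I) (pt : I -> circle R).
Context (mh : forall i, measurable [set z | h z = i]).

Definition cell_list f := [seq (f (pt i), [set z | h z = i]) | i <- enum I].

Lemma cell_list_measurable f : meas_list (cell_list f).
Proof. by apply/meas_listP => cD /List.in_map_iff[i [<- _]]; exact: mh. Qed.

Lemma simple_fun_cell_list f z : simple_fun (cell_list f) z = f (pt (h z)).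
Proof.
rewrite /simple_fun big_map /= big_enum /= (bigD1 (h z)) //= big1 ?addr0.
  by rewrite indicE mem_set // mulr1.
by move=> i ih; rewrite indicE memNset ?mulr0 //= => hi; rewrite hi eqxx in ih.
Qed.

Definition sample f x := \sum_i f (pt i) *: E [set z | h z = i] x.

Definition double_sample (K : H -> H) Psi x := \sum_i \sum_j
  Psi (pt i) (pt j) *: E [set z | h z = i] (K (E [set z | h z = j] x)).

Lemma fiber_linear i : linear (E [set z | h z = i]).
Proof. exact: semispectral_linear. Qed.

Lemma sample_bound f C : 0 <= C -> (forall z, rnorm (f z) <= C) -> op_bound (sample
  f) C.
Proof. by move=> C0 hC; apply: (fiber_bound hE mh (c := fun i => f (pt i))). Qed.

Lemma sample_dist f A e : is_int E f A -> 0 <= e ->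
  (forall z, rnorm (f (pt (h z)) - f z) <= e) -> op_bound (sample f \- A) e.
Proof.
move=> hA e0 he; have -> : sample f = simple_integral E (cell_list f).
  by apply/funext => x; rewrite /simple_integral big_map /= big_enum.
apply: (is_int_le hE hA) => //; first exact: cell_list_measurable.
by move=> z; rewrite simple_fun_cell_list.
Qed.

Context (K : H -> H) (lK : linear K).

Lemma double_sample_tensor f g x :
  double_sample K (fun z u => f z * g u) x = sample f (K (sample g x)).
Proof.
rewrite /double_sample /sample (linear_fun_sum lK); apply: eq_bigr => i _.
rewrite (linear_fun_sum (fiber_linear i)) scaler_sumr; apply: eq_bigr => j _.
by rewrite (linear_fun_scale lK) (linear_fun_scale (fiber_linear i)) scalerA.
Qed.

Lemma double_sampleB Psi Psi' x : double_sample K (fun z u => Psi z u - Psi' z u) x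
  =
  double_sample K Psi x - double_sample K Psi' x.
Proof.
rewrite /double_sample -sumrB; apply: eq_bigr => i _; rewrite -sumrB.
by apply: eq_bigr => j _; rewrite scalerBl.
Qed.

Lemma double_sample_series (f g : nat -> circle R -> R[i]) n x :
  double_sample K (fun z u => series (fun k => f k z * g k u) n) x =
  \sum_(k < n) sample (f k) (K (sample (g k) x)).
Proof.
under [RHS]eq_bigr do rewrite -double_sample_tensor.
rewrite /double_sample [RHS]exchange_big /=; apply: eq_bigr => i _.
rewrite [RHS]exchange_big /=; apply: eq_bigr => j _.
by rewrite /series /= big_mkord scaler_suml.
Qed.

(** For a fixed partition the sum is finite, so the pointwise convergence given by
    [tensor_representation] is enough. *)
Lemma double_sample_cvg (Psi : nat -> circle R -> circle R -> R[i]) Psi0 x :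
  (forall z u, Psi n z u @[n --> \oo] --> Psi0 z u) ->
  double_sample K (Psi n) x @[n --> \oo] --> double_sample K Psi0 x.
Proof.
by move=> hP; apply: rcvg_sum => i; apply: rcvg_sum => j; apply: cvgZr_tmp;
  exact: hP.
Qed.

End partition.

Context (K : H -> H) (lK : linear K) (c : R) (c0 : 0 <= c) (bK : op_bound K c).

(** [S] is within [e] of the Riemann sums over all sufficiently fine tagged partitions. A tag need
    only be close to the points of its cell, not belong to it. *)
Definition samples_to Psi (S : H -> H) (e : R) := exists2 d : R, 0 < d &
  forall (I : finType) (h : circle R -> I) (pt : I -> circle R),
    (forall i, measurable [set z | h z = i]) ->
    (forall z, rnorm (sval (pt (h z)) - sval z) < d) ->
    op_bound (S \- double_sample h pt K Psi) e.

Lemma samples_to_tensor f g A B a b e : is_int E f A -> is_int E g B ->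
  0 <= a -> 0 <= b -> (forall z, rnorm (f z) <= a) -> (forall z, rnorm (g z) <= b)
    ->
  uniformly_continuous f -> uniformly_continuous g -> 0 < e ->
  samples_to (fun z u => f z * g u) (A \o K \o B) e.
Proof.
move=> hA hB a0 b0 fa gb uf ug e0.
(* Replacing [f] and then [g] by their samples costs [r * c * b] and [a * c * r]. *)
pose r := e / (c * (a + b) + 1).
have D0 : 0 < c * (a + b) + 1 by rewrite ltr_wpDl // mulr_ge0 // addr_ge0.
have r0 : 0 < r by rewrite divr_gt0.
have re : r * (c * (a + b)) <= e.
  rewrite /r mulrAC ler_pdivrMr // ler_pM2l //; lra.
have [d1 d10 hd1] := uf _ r0; have [d2 d20 hd2] := ug _ r0.
exists (Num.min d1 d2); first by rewrite lt_min d10.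
move=> I h pt mh hd x.
have h1 z : rnorm (f (pt (h z)) - f z) <= r.
  by apply: hd1; apply: lt_le_trans (hd z) _; rewrite ge_min lexx.
have h2 z : rnorm (g (pt (h z)) - g z) <= r.
  by apply: hd2; apply: lt_le_trans (hd z) _; rewrite ge_min lexx orbT.
have sA := sample_dist mh hA (ltW r0) h1; have sB := sample_dist mh hB (ltW r0) h2.
have bA := is_int_bound hE hA a0 fa.
have bS := sample_bound pt mh b0 gb.
rewrite /= (double_sample_tensor pt mh lK) rdistC.
set y := sample h pt g x; set F := sample h pt f.
have [lA _] := is_int_bounded_op hE hA.
have -> : F (K y) - A (K (B x)) = (F (K y) - A (K y)) + A (K (y - B x)).
  by rewrite (linear_fun_sub lK) (linear_fun_sub lA) addrA subrK.
apply: le_trans (rnormD _ _) _; apply: le_trans (ler_wpM2r _ re) => //.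
have -> : r * (c * (a + b)) * rnorm x = r * (c * (b * rnorm x)) + a * (c * (r *
  rnorm x)) by ring.
apply: lerD.
  apply: le_trans (sA _) _; apply: ler_wpM2l; first exact: ltW.
  by apply: le_trans (bK _) _; apply: ler_wpM2l => //; exact: bS.
apply: le_trans (bA _) _; apply: ler_wpM2l => //.
by apply: le_trans (bK _) _; apply: ler_wpM2l => //; exact: sB.
Qed.

Context (f g : nat -> circle R -> R[i]) (A B : nat -> H -> H) (a b : nat -> R).
Context (hA : forall n, is_int E (f n) (A n)) (hB : forall n, is_int E (g n) (B n)).
Context (fa : forall n z, rnorm (f n z) <= a n) (gb : forall n z, rnorm (g n z) <=
  b n).
Context (uf : forall n, uniformly_continuous (f n)).
Context (ug : forall n, uniformly_continuous (g n)).

Let a0 n : 0 <= a n. Proof. exact: le_trans (fa n (expi 0)). Qed.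
Let b0 n : 0 <= b n. Proof. exact: le_trans (gb n (expi 0)). Qed.

(** The admissible mesh depends on [N]. This is harmless, since the tail estimate in
    [samples_to_series] is uniform in the partition and lets [N] be fixed before the mesh. *)
Lemma samples_to_sum N e : 0 < e ->
  samples_to (fun z u => series (fun k => f k z * g k u) N)
    (fun x => \sum_(n < N) A n (K (B n x))) e.
Proof.
elim: N e => [|N ih] e e0.
  exists 1 => // I h pt mh _ x;
    rewrite /= (double_sample_series pt mh lK) !big_ord0 subrr rnorm0.
  by rewrite mulr_ge0 // ltW.
have e20 : 0 < e / 2 by lra.
have [d1 d10 h1] := ih _ e20.
have [d2 d20 h2] := samples_to_tensor (hA N) (hB N) (a0 N) (b0 N) (fa N) (gb N) (uf
  N) (ug N) e20.
exists (Num.min d1 d2); first by rewrite lt_min d10.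
move=> I h pt mh hd x.
have m1 : Num.min d1 d2 <= d1 by rewrite ge_min lexx.
have m2 : Num.min d1 d2 <= d2 by rewrite ge_min lexx orbT.
have k1 := h1 I h pt mh (fun z => lt_le_trans (hd z) m1) x.
have k2 := h2 I h pt mh (fun z => lt_le_trans (hd z) m2) x.
move: k1 k2; rewrite /= !(double_sample_series pt mh lK) (double_sample_tensor pt
  mh lK) !big_ord_recr /=.
move=> k1 k2; rewrite opprD addrACA [e]splitr mulrDl.
by apply: le_trans (rnormD _ _) _; apply: lerD.
Qed.

(* Whatever the representation of [Psi], the partial sums of the double operator
   integral are close to the Riemann sums [double_sample], in which only the
   values of [Psi] enter; this is why the integral does not depend on it. *)
Lemma samples_to_series Psi e : cvgn (series (fun n => a n * b n)) ->
  (forall z u, series (fun n => f n z * g n u) @ \oo --> Psi z u) -> 0 < e ->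
  exists N0, forall N, (N0 <= N)%N ->
    samples_to Psi (fun x => \sum_(n < N) A n (K (B n x))) e.
Proof.
move=> cab hPsi e0; have e20 : 0 < e / 2 by lra.
have eta0 : 0 < e / 2 / (c + 1) by rewrite divr_gt0 // ltr_wpDl.
have ce : c * (e / 2 / (c + 1)) <= e / 2.
  by rewrite mulrCA ler_piMr ?(ltW e20) // ler_pdivrMr ?ltr_wpDl //; lra.
have /cauchy_cvgP/cauchy_seriesP/(_ _ eta0)[[P Q] /= [[N1 _ hN1] [N2 _ hN2]] hPQ]
  := cab.
exists (maxn N1 N2) => N hN.
have tail N' : (N <= N')%N -> \sum_(N <= k < N') a k * b k <= e / 2 / (c + 1).
  move=> NN'; have n1 : (N1 <= N)%N by apply: leq_trans hN; exact: leq_maxl.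
  have n2 : (N2 <= N')%N by apply: leq_trans NN'; apply: leq_trans hN;
    exact: leq_maxr.
  have := hPQ (N, N') (conj (hN1 _ n1) (hN2 _ n2)) => /= h.
  by apply: ltW; apply: le_lt_trans h; exact: ler_norm.
have [d d0 hd] := samples_to_sum N e20.
exists d => // I h pt mh hz x; have k1 := hd I h pt mh hz x.
rewrite /= in k1 *.
set S := \sum_(n < N) _ in k1 *.
set D := double_sample _ _ _ _ _ in k1; set D' := double_sample _ _ _ _ _.
(* Uniform in the partition: past index [N] a sampled term is at most [c * a k * b k] times [|x|],
   and for the given partition the sums up to [N'] tend to [D']. *)
have k2 : rnorm (D - D') <= e / 2 * rnorm x.
  apply/ler_addgt0Pr => r r0.
  have : double_sample h pt K (fun z u => series (fun k => f k z * g k u) n) x @[n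
    --> \oo] --> D'.
    by apply: double_sample_cvg.
  move=> /nat_rcvgP/(_ r r0)[N3 hN3].
  pose N' := maxn N N3; have NN' : (N <= N')%N by exact: leq_maxl.
  have := hN3 N' (leq_maxr _ _); set D'' := double_sample _ _ _ _ _ => k3.
  have -> : D - D' = (D - D'') + (D'' - D') by rewrite addrA subrK.
  apply: le_trans (rnormD _ _) _; apply: lerD; last exact: ltW.
  rewrite rdistC /D'' /D !(double_sample_series pt mh lK) -!(big_mkord xpredT (fun
    k => sample h pt (f k) (K (sample h pt (g k) x)))).
  rewrite (big_cat_nat _ NN') //=. rewrite [X in rnorm X]addrAC subrr add0r.
  apply: le_trans (rnorm_sum _ _ _) _.
  apply: le_trans (_ : \sum_(N <= k < N') (a k * b k) * (c * rnorm x) <= _).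
    apply: ler_sum => k _.
    apply: le_trans (sample_bound pt mh (a0 k) (fa k) _) _.
    rewrite -mulrA ler_wpM2l //; apply: le_trans (bK _) _.
    rewrite mulrCA ler_wpM2l //; exact: sample_bound.
  rewrite -mulr_suml mulrA ler_wpM2r //; apply: le_trans ce.
  by rewrite mulrC ler_wpM2l // tail.
have -> : S - D' = (S - D) + (D - D') by rewrite addrA subrK.
by apply: le_trans (rnormD _ _) _; rewrite [e]splitr mulrDl; apply: lerD.
Qed.

End sampling.

(** * Polynomials as functions of a point and of an operator *)

Lemma poly_lipschitz (R : realType) (p : {poly R[i]}) (r : R) :
  exists2 B : R, 0 < B & forall z w : R[i], rnorm z <= r -> rnorm w <= r ->
    rnorm (p.[w] - p.[z]) <= B * rnorm (w - z).
Proof.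
elim/poly_ind: p => [|p c [B B0 hB]].
  by exists 1 => // z w _ _; rewrite !horner0 subrr rnorm0 mul1r.
(* [M] bounds [p] on the disk of radius [r]; the absolute value keeps the constant positive when [r]
   is negative and the estimate vacuous. *)
pose M := rnorm p.[0] + B * `|r|.
have M0 : 0 <= M by rewrite addr_ge0 // mulr_ge0 // ltW.
exists (B * `|r| + M + 1); first by rewrite ltr_wpDl // addr_ge0 // mulr_ge0 // ltW.
move=> z w zr wr; rewrite !hornerMXaddC.
have r0 : 0 <= r by apply: le_trans zr.
have -> : p.[w] * w + c - (p.[z] * z + c) = (p.[w] - p.[z]) * w + p.[z] * (w - z)
  by ring.
apply: le_trans (rnormD _ _) _; rewrite !rnormM.
have h1 := hB _ _ zr wr.
have h2 : rnorm p.[z] <= M.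
  rewrite -(subrK p.[0] p.[z]) addrC; apply: le_trans (rnormD _ _) _;
    rewrite lerD2l.
  apply: le_trans (hB 0 z _ zr) _; first by rewrite rnorm0.
  by rewrite subr0 ger0_norm // ler_wpM2l // ltW.
rewrite ger0_norm //; have := rnorm_ge0 (w - z); have := rnorm_ge0 w.
have := rnorm_ge0 (p.[w] - p.[z]).
move: (rnorm (w - z)) (rnorm w) (rnorm p.[z]) (rnorm (p.[w] - p.[z])) h1 h2 wr => a
  b d f h1 h2 wr f0 b0 a0.
have : f * b <= B * a * r by apply: ler_pM.
have : d * a <= M * a by apply: ler_wpM2r.
lra.
Qed.

Lemma poly_continuous (R : realType) (p : {poly R[i]}) : continuous (horner p :
  R[i] -> R[i]).
Proof.
move=> z; apply/rcvgP => e e0; have [B B0 hB] := poly_lipschitz p (rnorm z + 1).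
have eB : 0 < Num.min 1 (e / B) by rewrite lt_min ltr01 divr_gt0.
near=> w.
have : rnorm (w - z) < Num.min 1 (e / B) by near: w; exact: near_dist.
rewrite lt_min => /andP[w1 w2].
apply: le_lt_trans (hB z w _ _) _; first by lra.
  rewrite -(subrK z w); apply: le_trans (rnormD _ _) _; lra.
by rewrite mulrC -ltr_pdivlMr.
Unshelve. all: by end_near. Qed.

(** By the factor theorem the difference quotient at [z] is a polynomial [q], which is continuous at
    [z]. *)
Lemma poly_derivable (R : realType) (p : {poly R[i]}) (z : R[i]) : derivable
  (horner p) z 1.
Proof.
have [q hq] : exists q, p - p.[z]%:P = q * ('X - z%:P).
  by apply/factor_theorem; rewrite /root !hornerE subrr.
rewrite /derivable; apply/cvg_ex; exists q.[z];
  apply: (proj2 (@rcvgP R R[i] _ _ _ _ _)) => e e0.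
have [B B0 hB] := poly_lipschitz q (rnorm z + 1).
have eB : 0 < Num.min 1 (e / B) by rewrite lt_min ltr01 divr_gt0.
apply/(@nbhs_ballP R[i] R[i]); exists (Num.min 1 (e / B))%:C;
  first by rewrite /= ltcR.
move=> h; rewrite -ball_normE /= normr_rnorm ltcR sub0r rnormN lt_min => /andP[h1
  h2] h0.
have hz : p.[h + z] - p.[z] = q.[h + z] * h.
  by have := congr1 (horner^~ (h + z)) hq; rewrite !hornerE addrK.
have -> : h *: (1 : R[i]) = h by exact: mulr1.
rewrite hz; have -> : h^-1 *: (q.[h + z] * h) = q.[h + z].
  by rewrite -[LHS]/(h^-1 * (q.[h + z] * h)) mulrCA mulVf // mulr1.
apply: le_lt_trans (hB z (h + z) _ _) _; first by lra.
  by apply: le_trans (rnormD _ _) _; lra.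
by rewrite addrK mulrC -ltr_pdivlMr.
Qed.

Lemma poly_disk_algebra (R : realType) (p : {poly R[i]}) : disk_algebra (horner p).
Proof.
split; first by move=> z _; exact: poly_derivable.
by apply: continuous_subspaceT; exact: poly_continuous.
Qed.

Section polynomial_operators.
Context {R : realType} (H : hilbertType R) (T : H -> H) (lT : linear T).
Implicit Types p : {poly R[i]}.

Lemma poly_op_widen p n x : (size p <= n)%N ->
  poly_op p T x = \sum_(k < n) p`_k *: iter k T x.
Proof.
move=> pn; rewrite /poly_op (big_ord_widen n (fun k => p`_k *: iter k T x)) //.
rewrite big_mkcond; apply: eq_bigr => k _; case: ltnP => // h.
by rewrite nth_default // scale0r.
Qed.

(** [T] is absorbed from the right here and from the left in [poly_op_mulXl]; these serve the terms
    [f_n(T) T Q g_n(T)] and [f_n(T) Q T g_n(T)] respectively. *)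
Lemma poly_op_mulXr p x : poly_op (p * 'X) T x = poly_op p T (T x).
Proof.
rewrite (@poly_op_widen _ (size p).+1); last first.
  by have [->|p0] := eqVneq p 0; rewrite ?mul0r ?size_poly0 // size_mulX.
rewrite big_ord_recl coefMX /= scale0r add0r; apply: eq_bigr => k _.
by rewrite coefMX /= -iterSr.
Qed.

Lemma poly_op_mulXl p x : poly_op (p * 'X) T x = T (poly_op p T x).
Proof.
rewrite (@poly_op_widen _ (size p).+1); last first.
  by have [->|p0] := eqVneq p 0; rewrite ?mul0r ?size_poly0 // size_mulX.
rewrite big_ord_recl coefMX /= scale0r add0r (linear_fun_sum lT);
  apply: eq_bigr => k _.
by rewrite coefMX /= (linear_fun_scale lT).
Qed.

End polynomial_operators.

(** * From a polynomial representation of the divided difference to the commutator formula *)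

Section main_reduction.
Context {R : realType}.

Lemma disk_algebra_uniformly_continuous (f : R[i] -> R[i]) : disk_algebra f ->
  uniformly_continuous (f \o sval).
Proof.
move=> [_ cf] e e0; have [d d0 hd] := cdisk_uniform_continuous cf e0.
by exists d => // z w zw; apply: ltW; apply: hd => //; exact: circle_cdisk.
Qed.

Lemma uniformly_continuous_approximable (f : circle R -> R[i]) :
  uniformly_continuous f -> approximable f.
Proof.
move=> uf e e0; have [d d0 hd] := uf e e0.
have [I [h [pt [mh hz]]]] := circle_partition d0.
exists (cell_list h pt f); first exact: cell_list_measurable.
by move=> z; rewrite simple_fun_cell_list; apply: hd; exact: hz.
Qed.

Context (H : hilbertType R) (T Q : H -> H) (E : set (circle R) -> H -> H).
Context (hT : bounded_op T) (hQ : bounded_op Q) (hE : semispectral_measure_of T E).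
Context (phi : R[i] -> R[i]) (P : nat -> {poly R[i]}).
Context (hP : forall e : R, 0 < e -> exists N, forall n, (N <= n)%N ->
  forall z, cdisk z -> rnorm ((P n).[z] - phi z) < e).

Let hS : semispectral_measure E := semispectral_measure_ofP hE.

Lemma is_int_disk_algebra f : disk_algebra f ->
  is_int E (f \o sval) (semispectral_integral E (f \o sval)).
Proof.
move=> /disk_algebra_uniformly_continuous/uniformly_continuous_approximable.
by move=> /(is_int_exists hS)[A hA]; rewrite (semispectral_integral_of hE hA).
Qed.

(** Takes the place of von Neumann's inequality: whichever polynomials are used, the norm limit [A]
    is the integral of [phi], hence does not depend on them. *)
Lemma is_int_uniform_limit (p : nat -> {poly R[i]}) A :
  (forall e : R, 0 < e -> exists N, forall n, (N <= n)%N ->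
    forall z, cdisk z -> rnorm ((p n).[z] - phi z) < e) ->
  bounded_op A -> op_cvg (fun n => poly_op (p n) T) A -> is_int E (phi \o sval) A.
Proof.
move=> hp bA; have bp n : bounded_op (poly_op (p n) T).
  exact (is_int_bounded_op hS (is_int_poly hE (p n))).
move=> /(op_cvgP bp bA) cA;
  apply: (@is_int_lim _ _ _ _ _ _ _ (fun n => poly_op (p n) T)).
move=> e e0; have [N hN] := hp e e0; have [M hM] := cA e e0.
exists (maxn N M), (fun z => (p (maxn N M)).[sval z]); split;
  first exact: is_int_poly.
  by move=> z; apply: ltW; apply: hN; [rewrite leq_maxl|exact: circle_cdisk].
by apply: hM; rewrite leq_maxr.
Qed.

(** The integral of [phi] exists because [phi] is a uniform limit of polynomials, and [is_int_dist]
    transfers the convergence to the operators; so the choice in [disk_calculus] is not the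
    default. *)
Lemma is_int_disk_calculus : is_int E (phi \o sval) (disk_calculus phi T).
Proof.
have bp n : bounded_op (poly_op (P n) T).
  exact (is_int_bounded_op hS (is_int_poly hE (P n))).
have [A hA] : exists A, is_int E (phi \o sval) A.
  apply: (is_int_exists hS) => e e0; have e20 : 0 < e / 2 by lra.
  have [N hN] := hP e20.
  have [s [ms hs _]] := is_int_poly hE (P N) e20.
  exists s => // z.
  rewrite -(subrK (P N).[sval z] (simple_fun s z)) -addrA [e]splitr.
  apply: le_trans (rnormD _ _) _; apply: lerD => //.
  by apply: ltW; apply: hN => //; exact: circle_cdisk.
have bA := is_int_bounded_op hS hA.
suff -> : disk_calculus phi T = A by [].
have u A' : is_disk_calculus phi T A' -> A' = A.
  move=> [bA' [p [/uniform_rcvgP up cp]]].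
  exact (is_int_unique hS (is_int_uniform_limit up bA' cp) hA).
apply: xget_subset1; last by move=> A1 A2 /u -> /u ->.
split => //; exists P; split; first by apply/uniform_rcvgP.
apply/op_cvgP => // e e0; have [N hN] := hP e0; exists N => n Nn.
apply: (is_int_dist hS (is_int_poly hE (P n)) hA (ltW e0)) => z.
by apply: ltW; apply: hN => //; exact: circle_cdisk.
Qed.

(** Both operators are compared with one Riemann sum, over a partition finer than both moduli. *)
Lemma samples_to_unique (K : H -> H) Psi S S' :
  (forall e, 0 < e -> samples_to E K Psi S e) ->
  (forall e, 0 < e -> samples_to E K Psi S' e) -> S = S'.
Proof.
move=> h h'; apply/funext => x; apply/eqP; rewrite -subr_eq0;
  apply/eqP/rnorm0_eq0/eqP.
rewrite eq_le rnorm_ge0 andbT.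
suff : op_bound (S \- S') 0 by move=> /(_ x); rewrite mul0r.
apply: op_bound_eps => r r0; rewrite add0r; have r20 : 0 < r / 2 by lra.
have [d d0 hd] := h _ r20; have [d' d'0 hd'] := h' _ r20.
have m0 : 0 < Num.min d d' by rewrite lt_min d0.
have m1 : Num.min d d' <= d by rewrite ge_min lexx.
have m2 : Num.min d d' <= d' by rewrite ge_min lexx orbT.
have [I [k [pt [mh hz]]]] := circle_partition m0.
move=> y; have h1 := hd I k pt mh (fun z => lt_le_trans (hz z) m1) y.
have h2 := hd' I k pt mh (fun z => lt_le_trans (hz z) m2) y.
have -> : (S \- S') y = (S y - double_sample E k pt K Psi y) - (S' y -
  double_sample E k pt K Psi y).
  by rewrite opprB addrA addrNK.
by apply: le_trans (rnormB _ _) _; rewrite [r]splitr mulrDl; apply: lerD.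
Qed.

Lemma is_double_operator_integral_samples (K : H -> H) Psi S : bounded_op K ->
  is_double_operator_integral E E Psi K S ->
  forall e, 0 < e -> samples_to E K Psi S e.
Proof.
move=> bK [bS [f [g [[hfg cfg sfg] cS]]]] e e0; have e20 : 0 < e / 2 by lra.
have [c c0 hc] := bounded_op_bound bK; have [lK _] := bK.
have hA n := is_int_disk_algebra (hfg n).1;
  have hB n := is_int_disk_algebra (hfg n).2.
have [] := @samples_to_series _ _ _ hS K lK c c0 hc (fun n => f n \o sval) (fun n
  => g n \o sval)
  _ _ (fun n => supnorm (f n)) (fun n => supnorm (g n)) hA hB _ _ _ _ Psi _ cfg sfg
    e20.
- by move=> n z; apply: le_supnorm; [exact: (hfg n).1.2|exact: circle_cdisk].
- by move=> n z; apply: le_supnorm; [exact: (hfg n).2.2|exact: circle_cdisk].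
- by move=> n; exact: disk_algebra_uniformly_continuous (hfg n).1.
- by move=> n; exact: disk_algebra_uniformly_continuous (hfg n).2.
move=> N0 hN0.
have bp n : bounded_op (\sum_(k < n) (semispectral_integral E (f k \o sval) \o K \o
               semispectral_integral E (g k \o sval))).
  have -> : \sum_(k < n) (semispectral_integral E (f k \o sval) \o K \o
               semispectral_integral E (g k \o sval)) = fun x => \sum_(k < n)
                 (semispectral_integral E (f k \o sval) \o K \o
               semispectral_integral E (g k \o sval)) x.
    by apply/funext => x; rewrite fct_sumE.
  apply: bounded_op_sum => k.
  exact (bounded_op_comp (bounded_op_comp (is_int_bounded_op hS (hA k)) bK)
    (is_int_bounded_op hS (hB k))).
have /(op_cvgP bp bS)/(_ _ e20)[N1 hN1] := cS.
have [d d0 hd] := hN0 (maxn N0 N1) (leq_maxl _ _).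
exists d => // I h pt mh hz x; have k1 := hd I h pt mh hz x.
have k2 := hN1 (maxn N0 N1) (leq_maxr _ _) x.
move: k1 k2; rewrite /= fct_sumE; move: (\sum_(_ < _) _) => s k1 k2.
have -> : S x - double_sample E h pt K Psi x = (s - double_sample E h pt K Psi x) -
  (s - S x).
  by rewrite opprB [RHS]addrC addrA addrNK.
by apply: le_trans (rnormB _ _) _; rewrite [e]splitr mulrDl; apply: lerD.
Qed.

Context (F G : nat -> {poly R[i]}).
Context (hFG : tensor_representation (divided_difference phi) (fun n => horner (F
  n)) (fun n => horner (G n))).

Lemma commutator_is_double_operator_integral :
  is_double_operator_integral E E (divided_difference phi) ((T \o Q) \- (Q \o T))
    ((disk_calculus phi T \o Q) \- (Q \o disk_calculus phi T)).
Proof.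
have hA := is_int_disk_calculus; set A := disk_calculus phi T in hA *.
have bA := is_int_bounded_op hS hA.
have bS : bounded_op ((A \o Q) \- (Q \o A)).
  by apply: bounded_opB; exact: bounded_op_comp.
split=> //; exists (fun n => horner (F n)), (fun n => horner (G n)); split => //.
have eI p : semispectral_integral E (horner p \o sval) = poly_op p T.
  by apply: (semispectral_integral_of hE); exact: is_int_poly.
have bp p : bounded_op (poly_op p T) by exact (is_int_bounded_op hS (is_int_poly hE
  p)).
have bC : bounded_op ((T \o Q) \- (Q \o T)).
  by apply: bounded_opB; exact: bounded_op_comp.
(* In [F (T Q - Q T) G] the first [T] is absorbed by [F k] and the second by [G k]; only [Q] stays
   in the middle. *)
have eF n : \sum_(k < n) (semispectral_integral E (horner (F k) \o sval) \o ((T \o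
  Q) \- (Q \o T)) \o
               semispectral_integral E (horner (G k) \o sval)) =
  fun x => \sum_(k < n) poly_op (F k * 'X) T (Q (poly_op (G k) T x)) - \sum_(k < n)
    poly_op (F k) T (Q (poly_op (G k * 'X) T x)).
  apply/funext => x; rewrite fct_sumE -sumrB; apply: eq_bigr => k _.
  rewrite !eI /= (linear_fun_sub (bp _).1) poly_op_mulXr (poly_op_mulXl hT.1) //.
apply/op_cvgP => // [n|e e0].
  rewrite eF; apply: bounded_opB; apply: bounded_op_sum => k;
  by apply: (@bounded_op_comp _ _ _ _ (poly_op _ T));
    [exact: bp|apply: (@bounded_op_comp _ _ _ _ Q)].
have [c c0 hc] := bounded_op_bound hQ; have [lQ _] := hQ.
have e30 : 0 < e / 3 by lra.
have [hfg cfg sfg] := hFG.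
have leF n (z : circle R) : rnorm (F n).[sval z] <= supnorm (horner (F n)).
  by apply: le_supnorm; [exact: (hfg n).1.2|exact: circle_cdisk].
have leG n (z : circle R) : rnorm (G n).[sval z] <= supnorm (horner (G n)).
  by apply: le_supnorm; [exact: (hfg n).2.2|exact: circle_cdisk].
have ucp p : uniformly_continuous (fun z : circle R => p.[sval z]).
  by apply: disk_algebra_uniformly_continuous; exact: poly_disk_algebra.
have XE p (z : circle R) : (p * 'X).[sval z] = p.[sval z] * sval z by rewrite
  hornerMX.
have [||||||||N1 hN1] := @samples_to_series _ _ _ hS Q lQ c c0 hc (fun n z => (F n
  * 'X).[sval z]) (fun n z => (G n).[sval z])
  (fun n => poly_op (F n * 'X) T) (fun n => poly_op (G n) T)
  (fun n => supnorm (horner (F n))) (fun n => supnorm (horner (G n))) _ _ _ _ _ _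
    (fun z u => sval z * divided_difference phi z u) (e / 3) cfg.
- by move=> n; exact: is_int_poly.
- by move=> n; exact: is_int_poly.
- by move=> n z; rewrite XE rnormM circle_rnorm mulr1.
- by [].
- by move=> n; exact: ucp.
- by move=> n; exact: ucp.
- move=> z u; rewrite (_ : series _ = fun n => sval z * series (fun n => (F
  n).[sval z] * (G n).[sval u]) n).
    by apply: cvgZl_tmp; exact: sfg.
  apply/funext => n; rewrite /series /= mulr_sumr; apply: eq_bigr => k _.
  by rewrite XE; ring.
- exact: e30.
have [||||||||N2 hN2] := @samples_to_series _ _ _ hS Q lQ c c0 hc (fun n z => (F
  n).[sval z]) (fun n z => (G n * 'X).[sval z])
  (fun n => poly_op (F n) T) (fun n => poly_op (G n * 'X) T)
  (fun n => supnorm (horner (F n))) (fun n => supnorm (horner (G n))) _ _ _ _ _ _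
    (fun z u => sval u * divided_difference phi z u) (e / 3) cfg.
- by move=> n; exact: is_int_poly.
- by move=> n; exact: is_int_poly.
- by [].
- by move=> n z; rewrite XE rnormM circle_rnorm mulr1.
- by move=> n; exact: ucp.
- by move=> n; exact: ucp.
- move=> z u; rewrite (_ : series _ = fun n => sval u * series (fun n => (F
  n).[sval z] * (G n).[sval u]) n).
    by apply: cvgZl_tmp; exact: sfg.
  apply/funext => n; rewrite /series /= mulr_sumr; apply: eq_bigr => k _.
  by rewrite XE; ring.
- exact: e30.
(* The two series are allowed [e / 3] each, the two products with the constant 1 [e / 6] each. *)
have e60 : 0 < e / 6 by lra.
have ucphi : uniformly_continuous (phi \o sval).
  move=> r r0; have r30 : 0 < r / 3 by lra.
  have [N hN] := hP r30; have [d d0 hd] := ucp (P N) _ r30.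
  exists d => // z w zw; have -> : (phi \o sval) z - (phi \o sval) w =
     ((P N).[sval z] - (P N).[sval w]) - ((P N).[sval z] - phi (sval z)) + ((P
       N).[sval w] - phi (sval w)).
    by rewrite /=; ring.
  have k1 := hd _ _ zw; have k2 := hN N (leqnn _) _ (circle_cdisk z);
    have k3 := hN N (leqnn _) _ (circle_cdisk w).
  apply: le_trans (rnormD _ _) _; apply: le_trans (lerD (rnormB _ _) (lexx _)) _.
  lra.
have [C C0 hC] := approximable_bounded (is_int_approximable hA).
have uc1 : uniformly_continuous (fun _ : circle R => 1 : R[i]).
  by move=> r r0; exists 1 => // z w _; rewrite subrr rnorm0 ltW.
have n1 (z : circle R) : rnorm (1 : R[i]) <= 1 by rewrite rnorm1.
have [d3 d30 h3] := samples_to_tensor hS lQ c0 hc hA (is_int1 hS) C0 ler01 hC n1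
  ucphi uc1 e60.
have [d4 d40 h4] := samples_to_tensor hS lQ c0 hc (is_int1 hS) hA ler01 C0 n1 hC
  uc1 ucphi e60.
exists (maxn N1 N2) => n Nn.
have [d1 d10 h1] := hN1 n (leq_trans (leq_maxl _ _) Nn).
have [d2 d20 h2] := hN2 n (leq_trans (leq_maxr _ _) Nn).
have m0 : 0 < Num.min (Num.min d1 d2) (Num.min d3 d4) by rewrite !lt_min d10 d20
  d30.
have m1 : Num.min (Num.min d1 d2) (Num.min d3 d4) <= d1 by rewrite !ge_min lexx.
have m2 : Num.min (Num.min d1 d2) (Num.min d3 d4) <= d2 by rewrite !ge_min lexx
  !orbT.
have m3 : Num.min (Num.min d1 d2) (Num.min d3 d4) <= d3 by rewrite !ge_min lexx
  !orbT.
have m4 : Num.min (Num.min d1 d2) (Num.min d3 d4) <= d4 by rewrite !ge_min lexx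
  !orbT.
have [I [h [pt [mh hz]]]] := circle_partition m0.
move=> x; rewrite eF.
have k1 := h1 I h pt mh (fun z => lt_le_trans (hz z) m1) x.
have k2 := h2 I h pt mh (fun z => lt_le_trans (hz z) m2) x.
have k3 := h3 I h pt mh (fun z => lt_le_trans (hz z) m3) x.
have k4 := h4 I h pt mh (fun z => lt_le_trans (hz z) m4) x.
rewrite /= in k1 k2 k3 k4 *.
(* All four Riemann sums use the same partition, so the identity between kernels can be applied
   pointwise; on the diagonal both of its sides are 0. *)
have ds : double_sample E h pt Q (fun z u => sval z * divided_difference phi z u) x
  -
   double_sample E h pt Q (fun z u => sval u * divided_difference phi z u) x =
   double_sample E h pt Q (fun z u => phi (sval z) * 1) x -
   double_sample E h pt Q (fun z u => 1 * phi (sval u)) x.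
  rewrite -!double_sampleB; congr (double_sample E h pt Q _ x).
  apply/funext => z; apply/funext => u;
    rewrite -mulrBl mulr1 mul1r /divided_difference.
  case: eqVneq => [->|zu]; first by rewrite !subrr mul0r.
  rewrite mulrCA mulfV ?mulr1 //; rewrite subr_eq0; apply: contra_neq zu;
    exact: val_inj.
move: k1 k2 k3 k4 ds.
move: (double_sample _ _ _ _ _ _) => v1; move: (double_sample _ _ _ _ _ _) => v2.
move: (double_sample _ _ _ _ _ _) => v3; move: (double_sample _ _ _ _ _ _) => v4.
move: (\sum_(_ < _) _) => s1; move: (\sum_(_ < _) _) => s2 k1 k2 k3 k4 ds.
have -> : s1 - s2 - (A (Q x) - Q (A x)) =
    ((s1 - v1) - (s2 - v2)) - ((A (Q x) - v3) - (Q (A x) - v4)).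
  have e1 (a b c' d : H) : (a - b) - (c' - d) = (a - c') - (b - d).
    by rewrite !opprD !opprK addrACA.
  have e2 (a b w : H) : (a - w) - (b - w) = a - b by rewrite opprB addrA addrNK.
  by rewrite (e1 s1 v1) (e1 (A (Q x))) ds e2.
apply: le_trans (rnormB _ _) _; apply: le_trans (lerD (rnormB _ _) (rnormB _ _)) _.
apply: le_trans (lerD (lerD k1 k2) (lerD k3 k4)) _.
have ee : e / 3 + e / 3 + (e / 6 + e / 6) = e by field.
by rewrite -[X in _ <= X * _]ee !mulrDl.
Qed.

(** The commutator is an admissible value, and [samples_to_unique] makes it the only one, so [xget]
    returns it. *)
Lemma commutator_eq_double_operator_integral :
  (disk_calculus phi T \o Q) \- (Q \o disk_calculus phi T) =
  double_operator_integral E E (divided_difference phi) ((T \o Q) \- (Q \o T)).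
Proof.
have bC : bounded_op ((T \o Q) \- (Q \o T)).
  by apply: bounded_opB; exact: bounded_op_comp.
have h := commutator_is_double_operator_integral.
apply/esym/xget_subset1 => // S S' hS1 hS2.
exact: samples_to_unique (is_double_operator_integral_samples bC hS1)
  (is_double_operator_integral_samples bC hS2).
Qed.

End main_reduction.

(** * Polynomials on the circle *)

Section polynomial_bounds.
Context {R : realType}.
Local Notation C := R[i].
Implicit Types (p : {poly C}) (z u w : C) (M : R).

(** [X^n - 1] splits over the closed field and is separable in characteristic 0, so it has [n]
    distinct roots, a primitive one among them. *)
Lemma complex_prim_root_exists n : (0 < n)%N -> exists z : C, n.-primitive_root z.
Proof.
pose p : {poly C} := 'X^n - 1; have [r Dp] := closed_field_poly_normal p.
move=> n_gt0; rewrite (monicP _) ?monicXnsubC // scale1r in Dp.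
have rn1: all n.-unity_root r by apply/allP=> z; rewrite -root_prod_XsubC -Dp.
have sz_r: (n < (size r).+1)%N.
  by rewrite -(size_prod_XsubC r id) -Dp size_XnsubC.
have [|z] := hasP (has_prim_root n_gt0 rn1 _ sz_r); last by exists z.
by rewrite -separable_prod_XsubC -Dp separable_Xn_sub_1 // pnatr_eq0 -lt0n.
Qed.

Definition circle_bound p M := forall z, rnorm z = 1 -> rnorm p.[z] <= M.

Lemma circle_bound_ge0 p M : circle_bound p M -> 0 <= M.
Proof. by move=> h; apply: le_trans (h 1 rnorm1). Qed.

Lemma unity_rnorm w n : (0 < n)%N -> w ^+ n = 1 -> rnorm w = 1.
Proof.
move=> n0 /(congr1 (@rnorm R C)); rewrite rnormX rnorm1 => /eqP.
by rewrite pexpr_eq1 // => /eqP.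
Qed.

Lemma unimodular_conj w j : rnorm w = 1 -> w ^+ j * Num.conj (w ^+ j) = 1.
Proof. by move=> h; rewrite -normCK normr_rnorm rnormX h !expr1n. Qed.

Lemma root_of_unity_orthogonality n w i j : n.-primitive_root w ->
  (i < n)%N -> (j < n)%N ->
  \sum_(l < n) (w ^+ l) ^+ i * Num.conj ((w ^+ l) ^+ j) = (if i == j then n%:R else
    0).
Proof.
move=> pw il jl; have n0 := prim_order_gt0 pw; have wn := prim_expr_order pw.
have w1 : rnorm w = 1 by exact: unity_rnorm wn.
have w0 k : w ^+ k != 0 by apply: expf_neq0; apply/eqP => h; move: w1;
  rewrite h rnorm0 => /eqP; rewrite eq_sym oner_eq0.
pose v := w ^+ i * Num.conj (w ^+ j).
have -> : \sum_(l < n) (w ^+ l) ^+ i * Num.conj ((w ^+ l) ^+ j) = \sum_(l < n) v ^+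
  l.
  by apply: eq_bigr => l _; rewrite /v exprMn -rmorphXn -!exprM ![(_ * l)%N]mulnC.
have vE : v * w ^+ j = w ^+ i by rewrite /v -mulrA [X in _ * X]mulrC
  unimodular_conj // mulr1.
have vn : v ^+ n = 1.
  by rewrite /v exprMn -rmorphXn /= -!exprM ![(_ * n)%N]mulnC !exprM wn !expr1n
    rmorph1 mulr1.
case: eqVneq => [ij|ij].
  have -> : v = 1 by rewrite /v ij unimodular_conj.
  under eq_bigr do rewrite expr1n.
  by rewrite sumr_const card_ord.
have v1 : v != 1.
  apply: contra_neq ij => h; move: vE; rewrite h mul1r => /esym /eqP.
  by rewrite (eq_prim_root_expr pw) !modn_small // => /eqP.
apply: (mulfI (_ : v - 1 != 0)); first by rewrite subr_eq0.
by rewrite -subrX1 vn subrr mulr0.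
Qed.

Lemma rnorm_nat n : rnorm (n%:R : C) = n%:R.
Proof. by rewrite -(rmorph_nat (real_complex R)) rnormC normr_nat. Qed.

(** A coefficient is an exact average over the [n]-th roots of unity once [n] exceeds both the
    degree and [k]. *)
Lemma circle_bound_coef p M k : circle_bound p M -> rnorm p`_k <= M.
Proof.
move=> hp; pose n := maxn (size p) k.+1.
have n0 : (0 < n)%N by rewrite leq_max orbT.
have [w pw] := complex_prim_root_exists n0.
have w1 : rnorm w = 1 by apply: unity_rnorm n0 (prim_expr_order pw).
have nR : (0 : R) < n%:R by rewrite ltr0n.
have E : n%:R * p`_k = \sum_(l < n) p.[w ^+ l] * Num.conj ((w ^+ l) ^+ k).
  have -> : \sum_(l < n) p.[w ^+ l] * Num.conj ((w ^+ l) ^+ k) =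
     \sum_(i < n) p`_i * \sum_(l < n) (w ^+ l) ^+ i * Num.conj ((w ^+ l) ^+ k).
    under [RHS]eq_bigr do rewrite mulr_sumr.
    rewrite exchange_big /=; apply: eq_bigr => l _.
    rewrite (horner_coef_wide _ (leq_maxl (size p) k.+1)) mulr_suml.
    by apply: eq_bigr => i _; rewrite mulrA.
  have kn : (k < n)%N by rewrite leq_max leqnn orbT.
  rewrite (bigD1 (Ordinal kn)) //= (root_of_unity_orthogonality pw) // eqxx big1
    ?addr0 1?mulrC //.
  move=> i ik; rewrite (root_of_unity_orthogonality pw) // ifN ?mulr0 //.
have wl l : rnorm (w ^+ l) = 1 by rewrite rnormX w1 expr1n.
have cj (v : C) : rnorm (Num.conj v) = rnorm v by rewrite /rnorm norm_conjC.
rewrite -(ler_pM2l nR).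
have -> : n%:R * rnorm p`_k = rnorm (n%:R * p`_k).
  by rewrite rnormM rnorm_nat.
rewrite E; apply: le_trans (rnorm_sum _ _ _) _.
apply: le_trans (_ : \sum_(l < n) M <= _);
  last by rewrite sumr_const card_ord mulr_natl.
by apply: ler_sum => l _; rewrite rnormM cj rnormX wl expr1n mulr1 hp.
Qed.

Lemma bernoulli (t : R) k : 0 <= t -> 1 + k%:R * t <= (1 + t) ^+ k.
Proof.
move=> t0; elim: k => [|k ih]; first by rewrite mul0r addr0 expr0.
rewrite exprS -natr1; have k0 : (0 : R) <= k%:R by []; nra.
Qed.

(* Applying the crude bound [|p z| <= M / (1 - |z|)] to the powers of [p]
   removes the factor [1 / (1 - |z|)]. *)
Lemma maximum_principle p M z : circle_bound p M -> rnorm z <= 1 -> rnorm p.[z] <=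
  M.
Proof.
move=> hp; have M0 := circle_bound_ge0 hp.
rewrite le_eqVlt => /predU1P[/hp //|z1].
(* Coefficients are at most [N], and the geometric sum is at most [1 / (1 - |z|)]. *)
have crude q N : circle_bound q N -> rnorm q.[z] * (1 - rnorm z) <= N.
  move=> hq; have N0 := circle_bound_ge0 hq.
  have z1' : 0 <= 1 - rnorm z by lra.
  have h : rnorm q.[z] <= \sum_(i < size q) N * rnorm z ^+ i.
    rewrite horner_coef; apply: le_trans (rnorm_sum _ _ _) _; apply: ler_sum => i _.
    by rewrite rnormM rnormX ler_wpM2r ?exprn_ge0 // circle_bound_coef.
  apply: le_trans (ler_wpM2r z1' h) _.
  rewrite -mulr_sumr -mulrA ler_piMr //.
  have := subrX1 (rnorm z) (size q); set S := \sum_(_ < _) _ => hS.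
  have : 0 <= rnorm z ^+ size q by rewrite exprn_ge0.
  have -> : S * (1 - rnorm z) = - ((rnorm z - 1) * S) by ring.
  by rewrite -hS; lra.
have pow k : rnorm p.[z] ^+ k * (1 - rnorm z) <= M ^+ k.
  rewrite -rnormX -horner_exp; apply: crude => w w1.
  by rewrite horner_exp rnormX; apply: lerXn2r; rewrite ?nnegrE // hp.
rewrite leNgt; apply/negP => lt.
have [M00|Mp] := eqVneq M 0.
  have := pow 1%N; rewrite !expr1 M00; rewrite M00 in lt; nra.
have {}Mp : 0 < M by rewrite lt_neqAle eq_sym Mp.
pose t := rnorm p.[z] / M - 1.
have t0 : 0 < t by rewrite subr_gt0 ltr_pdivlMr // mul1r.
have pE : rnorm p.[z] = M * (1 + t) by rewrite /t; field; rewrite gt_eqF.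
have bd k : (1 + t) ^+ k * (1 - rnorm z) <= 1.
  have := pow k; rewrite pE exprMn -mulrA -[X in _ <= X]mulr1 ler_pM2l // exprn_gt0
    //.
have z1' : 0 < 1 - rnorm z by lra.
(* By Bernoulli's inequality the power [k.+1] exceeds [1 / (1 - |z|)], against [bd]. *)
pose k := Num.truncn ((1 - rnorm z)^-1 / t).
have k1 : (1 - rnorm z)^-1 < k.+1%:R * t by rewrite -ltr_pdivrMr // truncnS_gt.
have := bernoulli k.+1 (ltW t0); have := bd k.+1.
rewrite -ler_pdivlMr // mul1r; lra.
Qed.

(* Average [p (z v) * |1 + v + ... + v^(a-1)|^2] over the [n]-th roots of unity
   [v], for [n] large: the second factor is a Fejer kernel. *)
Lemma fejer_bound p M a z : circle_bound p M -> rnorm z = 1 ->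
  rnorm (\sum_(i < size p) (a - i)%:R * (p`_i * z ^+ i)) <= a%:R * M.
Proof.
move=> hp z1; have M0 := circle_bound_ge0 hp.
have [-> |a0] := posnP a.
  rewrite big1 ?rnorm0 ?mul0r // => i _; by rewrite sub0n mul0r.
(* [n] exceeds every exponent [k + i] and [j] that occurs, so orthogonality applies without
   aliasing. *)
pose n := (size p + a)%N; have n0 : (0 < n)%N by rewrite addn_gt0 a0 orbT.
have [w pw] := complex_prim_root_exists n0.
have w1 : rnorm w = 1 by apply: unity_rnorm n0 (prim_expr_order pw).
have wl l : rnorm (w ^+ l) = 1 by rewrite rnormX w1 expr1n.
pose D v : C := \sum_(i < a) v ^+ i.
pose K v : R := rnorm (D v) ^+ 2.
have KE v : (K v)%:C = \sum_(i < a) \sum_(j < a) v ^+ i * Num.conj (v ^+ j).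
  rewrite /K rmorphXn /= -normr_rnorm normCK /D rmorph_sum mulr_suml.
  by apply: eq_bigr => i _; rewrite mulr_sumr.
(* The average counts the pairs [(i, j)] with [j = k + i < a]. Exponent 0 is included even for
   [p = 0], since it gives the total mass of [K]. *)
have count (k : nat) : (k < size p)%N || (k == 0%N) -> \sum_(l < n) (w ^+ l) ^+ k *
  (K (w ^+ l))%:C = n%:R * (a - k)%:R.
  move=> kp; under eq_bigr do rewrite KE mulr_sumr.
  rewrite exchange_big /=.
  have -> : \sum_(i < a) \sum_(l < n) (w ^+ l) ^+ k * (\sum_(j < a) (w ^+ l) ^+ i *
    Num.conj ((w ^+ l) ^+ j)) =
    \sum_(i < a) (if (k + i < a)%N then n%:R else 0).
    apply: eq_bigr => i _.
    under eq_bigr do rewrite mulr_sumr.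
    rewrite exchange_big /=.
    have kin : (k + i < n)%N.
      rewrite /n; case/orP: kp => [kp|/eqP ->]; have := ltn_ord i; lia.
    have E j : (j < a)%N -> \sum_(l < n) (w ^+ l) ^+ k * ((w ^+ l) ^+ i * Num.conj
      ((w ^+ l) ^+ j)) =
        (if (k + i)%N == j then n%:R else 0).
      move=> ja; under eq_bigr do rewrite mulrA -exprD.
      by apply: root_of_unity_orthogonality => //; rewrite /n; lia.
    case: ltnP => kia.
      rewrite (bigD1 (Ordinal kia)) //= E // eqxx big1 ?addr0 // => j jk.
      by rewrite E // ifN // eq_sym.
    rewrite big1 // => j _; rewrite E // ifN //; have := ltn_ord j; lia.
  rewrite -big_mkcond sumr_const [RHS]mulr_natr; congr (_ *+ _).
  transitivity (\sum_(i < a | (k + i < a)%N) 1)%N; first by rewrite sum1_card.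
  rewrite (eq_bigl (fun i : 'I_a => (i < a - k)%N)); last by move=> i /=; lia.
  rewrite -(big_ord_widen a (fun=> 1%N)) ?leq_subr //.
  by rewrite sum1_card card_ord.
have nR : (0 : R) < n%:R by rewrite ltr0n.
have E : n%:R * (\sum_(i < size p) (a - i)%:R * (p`_i * z ^+ i)) =
    \sum_(l < n) p.[z * w ^+ l] * (K (w ^+ l))%:C.
  under [RHS]eq_bigr do rewrite horner_coef mulr_suml.
  rewrite exchange_big mulr_sumr; apply: eq_bigr => i _ /=.
  under eq_bigr do rewrite exprMn mulrA -mulrA.
  rewrite -mulr_sumr count ?ltn_ord //; ring.
have sK : \sum_(l < n) K (w ^+ l) = n%:R * a%:R.
  apply: (@complexI R);
    rewrite rmorph_sum rmorphM !rmorph_nat -[X in (_ * X%:R)](subn0 a) -count ?orbT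
    //.
  by apply: eq_bigr => l _; rewrite expr0 mul1r.
rewrite -(ler_pM2l nR).
have -> : forall v : C, n%:R * rnorm v = rnorm (n%:R * v).
  by move=> v; rewrite rnormM rnorm_nat.
rewrite E; apply: le_trans (rnorm_sum _ _ _) _.
rewrite mulrA -sK mulr_suml; apply: ler_sum => l _.
rewrite rnormM rnormC ger0_norm ?sqr_ge0 // mulrC ler_wpM2l ?sqr_ge0 // hp //.
by rewrite rnormM z1 wl mulr1.
Qed.

End polynomial_bounds.

(** * The projective norm of a dyadic block *)

Section block_representation.
Context {R : realType}.
Local Notation C := R[i].
Implicit Types (p : {poly C}) (z u w : C) (M : R) (m n k : nat).

(** The square sum [S] of [p_(j+l) z^j u^l] is computed twice: setting aside the row [j = 0] leaves
    [z] times the double sum, setting aside the column [l = 0] leaves [u] times it. *)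
Lemma hankel_divided_difference p n z u : (size p <= n)%N ->
  (z - u) * (\sum_(j < n) \sum_(l < n) p`_(j + l).+1 * (z ^+ j * u ^+ l)) =
  p.[z] - p.[u].
Proof.
move=> pn; pose S := \sum_(j < n.+1) \sum_(l < n.+1) p`_(j + l) * (z ^+ j * u ^+ l).
have nz k : (n <= k)%N -> p`_k = 0 by move=> h;
  rewrite nth_default // (leq_trans pn).
have pE (v : C) : p.[v] = \sum_(i < n.+1) p`_i * v ^+ i.
  by rewrite (horner_coef_wide _ (leqW pn)).
have S1 : S = p.[u] + z * (\sum_(j < n) \sum_(l < n) p`_(j + l).+1 * (z ^+ j * u ^+
  l)).
  rewrite /S big_ord_recl /=; congr (_ + _).
    by rewrite pE; apply: eq_bigr => l _; rewrite mul1r.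
  rewrite mulr_sumr; apply: eq_bigr => j _.
  rewrite big_ord_recr /= nz ?mul0r ?addr0; last by rewrite /bump; lia.
  rewrite mulr_sumr; apply: eq_bigr => l _; rewrite /bump leq0n addSn exprS; ring.
have S2 : S = p.[z] + u * (\sum_(j < n) \sum_(l < n) p`_(j + l).+1 * (z ^+ j * u ^+
  l)).
  rewrite /S exchange_big big_ord_recl /=; congr (_ + _).
    by rewrite pE; apply: eq_bigr => l _; rewrite mulr1 addn0.
  rewrite exchange_big /= mulr_sumr big_ord_recr /= [X in _ + X]big1 ?addr0;
    last first.
    by move=> j _; rewrite nz ?mul0r //; rewrite /bump; lia.
  apply: eq_bigr => j _.
  rewrite mulr_sumr; apply: eq_bigr => l _; rewrite /bump leq0n addnS exprS; ring.
move: S1; rewrite S2; move: (\sum_(_ < n) _) => D e.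
have {}e : z * D = p.[z] + u * D - p.[u] by rewrite e; ring.
by rewrite mulrBl e; ring.
Qed.

Definition left_shift k p := \poly_(l < size p) p`_(l + k).

(** The weight [min(1, l/m)] is a ramp in place of the sharp cut-off at frequency [k], which has no
    bound uniform in the degree. *)
Definition smoothed_shift m k p := \poly_(l < size p) ((minn m l)%:R / m%:R * p`_(l
  + k)).

Lemma left_shift_bound p M k : circle_bound p M -> (forall i, (i < k)%N -> p`_i =
  0) ->
  circle_bound (left_shift k p) M.
Proof.
move=> hp p0 z z1.
have -> : rnorm (left_shift k p).[z] = rnorm p.[z]; last exact: hp.
have e : p = left_shift k p * 'X^k.
  apply/polyP => i; rewrite coefMXn coef_poly; case: ltnP => ik; first exact: p0.
  rewrite subnK //; case: ltnP => // h;
    by rewrite nth_default // (leq_trans h (leq_subr _ _)).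
by rewrite [in RHS]e hornerM hornerXn rnormM rnormX z1 expr1n mulr1.
Qed.

(* [min(m, n - k)] is [m - (k + m - n) + (k - n)] for truncated subtraction, so
   the smoothed shift is a combination of [p] and two Fejer means. *)
Lemma smoothed_shift_bound p M m k : (0 < m)%N -> (k <= 4 * m)%N -> circle_bound p
  M ->
  circle_bound (smoothed_shift m k p) (10 * M).
Proof.
move=> m0 k4 hp z z1; have M0 := circle_bound_ge0 hp.
have mR : (0 : R) < m%:R by rewrite ltr0n.
have mC : (m%:R : C) != 0 by rewrite pnatr_eq0 -lt0n.
have zk : rnorm (z ^+ k) = 1 by rewrite rnormX z1 expr1n.
have E : m%:R * (z ^+ k * (smoothed_shift m k p).[z]) =
   m%:R * p.[z] - \sum_(i < size p) ((k + m) - i)%:R * (p`_i * z ^+ i)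
   + \sum_(i < size p) (k - i)%:R * (p`_i * z ^+ i).
  rewrite [p.[z]]horner_coef [X in X - _ + _]mulr_sumr -sumrB -big_split /=.
  have -> : \sum_(i < size p) (m%:R * (p`_i * z ^+ i) - (k + m - i)%:R * (p`_i * z
    ^+ i)
     + (k - i)%:R * (p`_i * z ^+ i)) = \sum_(i < size p + k) (minn m (i - k))%:R *
       (p`_i * z ^+ i).
    rewrite big_split_ord /= [X in _ + X]big1 ?addr0.
      apply: eq_bigr => i _; rewrite -mulrBl -mulrDl; congr (_ * _).
      have -> : (m%:R : C) = (minn m (i - k) + (k + m - i) - (k - i))%:R.
        by congr (_%:R); lia.
      rewrite natrB; last lia.
      by rewrite natrD; ring.
    by move=> i _; rewrite nth_default ?mul0r ?mulr0 // leq_addr.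
  rewrite addnC big_split_ord /= [X in X + _]big1 ?add0r; last first.
    move=> i _; have -> : (i - k = 0)%N by have := ltn_ord i; lia.
    by rewrite minn0 mul0r.
  rewrite horner_poly !mulr_sumr; apply: eq_bigr => i _.
  by rewrite addKn addnC exprD; field.
have B : m%:R * rnorm (smoothed_shift m k p).[z] <= m%:R * M + (k + m)%:R * M +
  k%:R * M.
  have -> : m%:R * rnorm (smoothed_shift m k p).[z] = rnorm (m%:R * (z ^+ k *
    (smoothed_shift m k p).[z])).
    by rewrite !rnormM rnorm_nat zk mul1r.
  rewrite E; apply: le_trans (rnormD _ _) _; apply: lerD; last exact: fejer_bound.
  apply: le_trans (rnormB _ _) _; apply: lerD; last exact: fejer_bound.
  by rewrite rnormM rnorm_nat ler_wpM2l // hp.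
rewrite -(ler_pM2l mR); apply: le_trans B _.
(* Origin of the constant 10: [m + (k + m) + k <= 10 m] for [k <= 4 m]. *)
have k4R : (k%:R : R) <= 4 * m%:R by rewrite -natrM ler_nat.
rewrite natrD; nra.
Qed.

(** Vanishing below [m] makes each shift by [j + 1 <= m] a unimodular multiple of [p] on the circle.
    The remaining [4m] terms are indexed by the exponent of [u]. Terms from [5m] on are 0, so that
    any larger number of them may be summed. *)
Lemma block_representation p M m : (0 < m)%N -> (size p <= 4 * m)%N ->
  (forall i, (i < m)%N -> p`_i = 0) -> circle_bound p M ->
  exists F G : nat -> {poly C},
    (forall j, exists a b, [/\ circle_bound (F j) a, circle_bound (G j) b & a * b
      <= 10 * M]) /\
    forall n z u, (5 * m <= n)%N ->
      (z - u) * (\sum_(j < n) (F j).[z] * (G j).[u]) = p.[z] - p.[u].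
Proof.
move=> m0 pm p0 hp; have M0 := circle_bound_ge0 hp.
have mR : (0 : R) < m%:R by rewrite ltr0n.
have mC : (m%:R : C) != 0 by rewrite pnatr_eq0 -lt0n.
exists (fun j => if (j < m)%N then 'X^j else if (j < 5 * m)%N then smoothed_shift m
  (j - m).+1 p else 0).
exists (fun j => if (j < m)%N then ((m - j)%:R / m%:R) *: left_shift j.+1 p else
  'X^(j - m)).
have Xb k : circle_bound ('X^k) 1 by move=> z z1; rewrite hornerXn rnormX z1 expr1n.
split.
  move=> j; case: ltnP => jm.
    exists 1, M; split => //; last by lra.
    move=> z z1; rewrite hornerZ rnormM -[M]mul1r; apply: ler_pM => //.
      rewrite rnormM rnormV !rnorm_nat ler_pdivrMr // mul1r ler_nat; lia.
    by apply: left_shift_bound => // i ij; apply: p0; lia.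
  case: ltnP => j5.
    exists (10 * M), 1; split => //; last by rewrite mulr1.
    by apply: smoothed_shift_bound => //; lia.
  exists 0, 1; split => //; last by rewrite mul0r mulr_ge0.
  by move=> z _; rewrite horner0 rnorm0.
move=> n z u n5; rewrite -(hankel_divided_difference z u pm); congr (_ * _).
have -> : (n = m + 4 * m + (n - 5 * m))%N by lia.
rewrite 2!big_split_ord /= [X in _ + X]big1 ?addr0; last first.
  by move=> i _; rewrite !ifN ?horner0 ?mul0r // -leqNgt; lia.
have sw : (size p <= 4 * m)%N := pm.
have shiftE (a : nat -> C) k (v : C) : (\poly_(l < size p) (a l * p`_(l + k))).[v] =
    \sum_(l < 4 * m) a l * p`_(l + k) * v ^+ l.
  rewrite horner_poly (big_ord_widen (4 * m) (fun l => a l * p`_(l + k) * v ^+ l))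
    // big_mkcond.
  apply: eq_bigr => l _; case: ltnP => // h.
  by rewrite nth_default ?mulr0 ?mul0r // (leq_trans h (leq_addr _ _)).
have e1 : \sum_(i < m) (if (i < m)%N then 'X^i else if (i < 5 * m)%N then
  smoothed_shift m (i - m).+1 p else 0).[z] *
     (if (i < m)%N then ((m - i)%:R / m%:R) *: left_shift i.+1 p else 'X^(i -
       m)).[u] =
   \sum_(j < 4 * m) \sum_(l < 4 * m) ((m - j)%:R / m%:R) * (p`_(j + l).+1 * (z ^+ j
     * u ^+ l)).
  have mm : (m <= 4 * m)%N by lia.
  rewrite (big_ord_widen (4 * m) (fun i => (if (i < m)%N then 'X^i else if (i < 5 *
    m)%N then smoothed_shift m (i - m).+1 p else 0).[z] *
     (if (i < m)%N then ((m - i)%:R / m%:R) *: left_shift i.+1 p else 'X^(i -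
       m)).[u])) // big_mkcond.
  apply: eq_bigr => j _; case: ltnP => jm.
    rewrite hornerXn hornerZ /left_shift.
    have -> : \poly_(l < size p) p`_(l + j.+1) = \poly_(l < size p) (1 * p`_(l +
      j.+1)).
      by apply/polyP => l; rewrite !coef_poly mul1r.
    rewrite (shiftE (fun=> 1)) !mulr_sumr; apply: eq_bigr => l _.
    by rewrite addnS addnC; ring.
  have -> : (m - j = 0)%N by lia.
  by rewrite big1 // => l _; rewrite !mul0r.
have e2 : \sum_(i < 4 * m) (if (m + i < m)%N then 'X^(m + i) else if (m + i < 5 *
  m)%N then smoothed_shift m (m + i - m).+1 p else 0).[z] *
     (if (m + i < m)%N then ((m - (m + i))%:R / m%:R) *: left_shift (m + i).+1 p
       else 'X^(m + i - m)).[u] =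
   \sum_(j < 4 * m) \sum_(l < 4 * m) ((minn m j)%:R / m%:R) * (p`_(j + l).+1 * (z
     ^+ j * u ^+ l)).
  (* The weight sits on the exponent of [z], while the terms of this half are indexed by the
     exponent of [u]. *)
  rewrite [RHS]exchange_big; apply: eq_bigr => k _ /=.
  have -> : (m + k < m)%N = false by lia.
  have -> : (m + k < 5 * m)%N by have := ltn_ord k; lia.
  rewrite addKn hornerXn (shiftE (fun l => (minn m l)%:R / m%:R)) mulr_suml.
  by apply: eq_bigr => l _; rewrite addnS; ring.
rewrite e1 e2 -big_split; apply: eq_bigr => j _ /=.
rewrite -big_split; apply: eq_bigr => l _ /=.
rewrite -mulrDl -mulrDl -natrD.
(* The two weights add up to 1; the truncated [m - j] is 0 for [j >= m]. *)
have -> : (m - j + minn m j = m)%N by lia.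
by rewrite mulfV // mul1r.
Qed.

End block_representation.

(** * Fourier coefficients and convolutions *)

Section circle_integrals.
Context {R : realType}.
Implicit Types f g : circle R -> R[i].

Let mcos : measurable_fun [set: measurableTypeR R] (@cos R).
Proof. by apply: continuous_measurable_fun; exact: continuous_cos. Qed.

Let msin : measurable_fun [set: measurableTypeR R] (@sin R).
Proof. by apply: continuous_measurable_fun; exact: continuous_sin. Qed.

Let integrable_cos (h : R -> R) : (angle R).-integrable setT (EFin \o h) ->
  (angle R).-integrable setT (fun t => (h t * cos t)%:E).
Proof.
move=> ih; apply: (integrableMl measurableT ih mcos).
by exists 1; split => // x x1 t _; apply: le_trans (ltW x1);
  rewrite ler_norml cos_geN1 cos_le1.
Qed.

Let integrable_sin (h : R -> R) : (angle R).-integrable setT (EFin \o h) ->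
  (angle R).-integrable setT (fun t => (h t * sin t)%:E).
Proof.
move=> ih; apply: (integrableMl measurableT ih msin).
by exists 1; split => // x x1 t _; apply: le_trans (ltW x1);
  rewrite ler_norml sin_geN1 sin_le1.
Qed.

Lemma circle_integrableD f g : circle_integrable f -> circle_integrable g ->
  circle_integrable (fun z => f z + g z).
Proof.
move=> [f1 f2] [g1 g2]; split.
  under eq_fun do rewrite Re_add EFinD; exact: integrableD.
under eq_fun do rewrite Im_add EFinD; exact: integrableD.
Qed.

Let ReM (a b : R[i]) : complex.Re (a * b) = complex.Re a * complex.Re b -
  complex.Im a * complex.Im b.
Proof. by case: a; case: b. Qed.

Let ImM (a b : R[i]) : complex.Im (a * b) = complex.Re a * complex.Im b +
  complex.Im a * complex.Re b.
Proof. by case: a; case: b. Qed.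

Lemma circle_integrableZ a f : circle_integrable f -> circle_integrable (fun z => a
  * f z).
Proof.
move=> [f1 f2]; split.
  under eq_fun do rewrite ReM EFinB !EFinM; apply: integrableB => //;
    exact: integrableZl.
under eq_fun do rewrite ImM EFinD !EFinM; apply: integrableD => //;
  exact: integrableZl.
Qed.

Lemma circle_integrableM f : circle_integrable f -> circle_integrable (fun z => f z
  * sval z).
Proof.
move=> [f1 f2]; split.
  have -> : (fun t => (complex.Re (f (expi t) * sval (expi t)))%:E) = (fun t =>
      (complex.Re (f (expi t)) * cos t)%:E - (complex.Im (f (expi t)) * sin
        t)%:E)%E.
    by apply/funext => t; rewrite ReM.
  apply: integrableB => //; [exact: integrable_cos|exact: integrable_sin].
have -> : (fun t => (complex.Im (f (expi t) * sval (expi t)))%:E) = (fun t =>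
    (complex.Re (f (expi t)) * sin t)%:E + (complex.Im (f (expi t)) * cos t)%:E)%E.
  by apply/funext => t; rewrite ImM.
apply: integrableD => //; [exact: integrable_sin|exact: integrable_cos].
Qed.

Lemma circle_invE (z : circle R) : (sval z)^-1 = Num.conj (sval z).
Proof.
have z0 : sval z != 0.
  by apply/eqP => h; have := circle_rnorm z; rewrite h rnorm0 => /eqP;
    rewrite eq_sym oner_eq0.
apply: (mulfI z0); rewrite mulfV //.
by have := unimodular_conj 1 (circle_rnorm z); rewrite expr1 => ->.
Qed.

Lemma circle_integrableV f : circle_integrable f -> circle_integrable (fun z => f z
  * (sval z)^-1).
Proof.
move=> [f1 f2]; split.
  have -> : (fun t => (complex.Re (f (expi t) * (sval (expi t))^-1))%:E) = (fun t =>
      (complex.Re (f (expi t)) * cos t)%:E + (complex.Im (f (expi t)) * sin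
        t)%:E)%E.
    by apply/funext => t; rewrite circle_invE ReM /= mulrN opprK.
  apply: integrableD => //; [exact: integrable_cos|exact: integrable_sin].
have -> : (fun t => (complex.Im (f (expi t) * (sval (expi t))^-1))%:E) = (fun t =>
    (complex.Im (f (expi t)) * cos t)%:E - (complex.Re (f (expi t)) * sin t)%:E)%E.
  by apply/funext => t; rewrite circle_invE ImM /= mulrN addrC.
apply: integrableB => //; [exact: integrable_cos|exact: integrable_sin].
Qed.

Lemma circle_integrable_exprz f (k : int) : circle_integrable f ->
  circle_integrable (fun z => f z * sval z ^ k).
Proof.
move=> hf; have hn (n : nat) : circle_integrable (fun z => f z * sval z ^+ n).
  elim: n => [|n ih].
    by have -> : (fun z : circle R => f z * sval z ^+ 0) = f by apply/funext => z;
      rewrite mulr1.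
  have -> : (fun z : circle R => f z * sval z ^+ n.+1) = fun z => f z * sval z ^+ n
    * sval z.
    by apply/funext => z; rewrite exprSr mulrA.
  exact: circle_integrableM.
have hv (n : nat) : circle_integrable (fun z => f z * sval z ^- n).
  elim: n => [|n ih].
    by have -> : (fun z : circle R => f z * sval z ^- 0) = f by apply/funext => z;
      rewrite expr0 invr1 mulr1.
  have -> : (fun z : circle R => f z * sval z ^- n.+1) = fun z => f z * sval z ^- n
    * (sval z)^-1.
    by apply/funext => z; rewrite exprS invfM mulrA mulrAC.
  exact: circle_integrableV.
by case: k => n; [exact: hn|exact: hv].
Qed.

Lemma circle_integralD f g : circle_integrable f -> circle_integrable g ->
  circle_integral (fun z => f z + g z) = circle_integral f + circle_integral g.
Proof.
move=> [f1 f2] [g1 g2]; rewrite /circle_integral.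
under [X in X +i* _]eq_Rintegral do rewrite Re_add.
under [X in _ +i* X]eq_Rintegral do rewrite Im_add.
by rewrite !RintegralD.
Qed.

Lemma circle_integralZ a f : circle_integrable f ->
  circle_integral (fun z => a * f z) = a * circle_integral f.
Proof.
move=> [f1 f2]; rewrite /circle_integral.
under [X in X +i* _]eq_Rintegral do rewrite ReM.
under [X in _ +i* X]eq_Rintegral do rewrite ImM.
have iZ (b : R) h : (angle R).-integrable setT (EFin \o h) -> (angle R).-integrable
  setT (EFin \o (fun t => b * h t)).
  move=> ih; have -> : EFin \o (fun t => b * h t) = fun t => (b%:E * (EFin \o h)
    t)%E by apply/funext => t /=; rewrite EFinM.
  exact: integrableZl.
rewrite RintegralB ?RintegralD //; try exact: iZ.
rewrite !RintegralZl //; case: a => a b; apply/eqP; rewrite eq_complex /=.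
by rewrite !eqxx.
Qed.

Lemma circle_integral_sum n (a : nat -> R[i]) (F : nat -> circle R -> R[i]) :
  (forall k, circle_integrable (F k)) ->
  circle_integral (fun z => \sum_(k < n) a k * F k z) =
  \sum_(k < n) a k * circle_integral (F k).
Proof.
move=> hF; suff [] : circle_integrable (fun z => \sum_(k < n) a k * F k z) /\
  circle_integral (fun z => \sum_(k < n) a k * F k z) =
  \sum_(k < n) a k * circle_integral (F k) by [].
elim: n => [|n [ih1 ih2]].
  have -> : (fun z => \sum_(k < 0) a k * F k z) = (fun z => 0 * F 0%N z).
    by apply/funext => z; rewrite big_ord0 mul0r.
  by rewrite big_ord0 circle_integralZ // mul0r; split => //;
    exact: circle_integrableZ.
have -> : (fun z => \sum_(k < n.+1) a k * F k z) =
    fun z => \sum_(k < n) a k * F k z + a n * F n z.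
  by apply/funext => z; rewrite big_ord_recr.
rewrite big_ord_recr /= circle_integralD ?circle_integralZ ?ih2 //;
  last exact: circle_integrableZ.
by split => //; apply: circle_integrableD => //; exact: circle_integrableZ.
Qed.

(** Convolution with a polynomial acts as a Fourier multiplier. [g] is prescribed only on the
    circle, hence the packing of [z / u] as a point of it. *)
Lemma convolution_poly f n (a : nat -> R[i]) (g : R[i] -> R[i]) (z : circle R) :
  circle_integrable f -> (forall u : circle R, g (sval u) = \sum_(k < n) a k * sval
    u ^+ k) ->
  convolution f g z = \sum_(k < n) a k * fourier f k%:Z * sval z ^+ k.
Proof.
move=> hf hg; rewrite /convolution.
have key (u : circle R) : f u * g (sval z / sval u) =
   \sum_(k < n) (a k * sval z ^+ k) * (f u * sval u ^ (- k%:Z)).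
  have zu : `|sval z / sval u| == 1.
    by rewrite normf_div !normr_rnorm !circle_rnorm divr1.
  have -> : sval z / sval u = sval (exist (fun z : R[i] => `|z| == 1) _ zu : circle
    R) by [].
  rewrite hg mulr_sumr; apply: eq_bigr => k _ /=.
  by rewrite exprMn exprVn -exprnN; ring.
have -> : (fun u : circle R => f u * g (sval z / sval u)) =
   fun u => \sum_(k < n) (a k * sval z ^+ k) * (f u * sval u ^ (- k%:Z)).
  by apply/funext.
rewrite (@circle_integral_sum n (fun k => a k * sval z ^+ k) (fun k u => f u * sval
  u ^ (- k%:Z))).
  by apply: eq_bigr => k _; rewrite /fourier; ring.
by move=> k; exact: circle_integrable_exprz.
Qed.

End circle_integrals.

(** * From the essential supremum to a bound at every point of the circle *)

Section essential_supremum.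
Context {R : realType}.

Lemma expi_surjective (z : circle R) : exists t : R, [/\ 0 <= t, t < 2 * pi & expi
  t = z].
Proof.
case: z => -[x y] zP; have /eqP := zP; rewrite normc_def /= => /complexI h.
have xy : x ^+ 2 + y ^+ 2 = 1.
  have := sqr_sqrtr (addr_ge0 (sqr_ge0 x) (sqr_ge0 y)); rewrite h expr1n => <- //.
have x1 : -1 <= x <= 1 by rewrite -ler_norml -(expr_le1 (n := 2)) // real_normK
  ?num_real //; have := sqr_ge0 y; lra.
have pi0 := pi_gt0 R.
have cx : cos (acos x) = x by rewrite acosK // in_itv /=.
have sx : sin (acos x) = `|y|.
  by rewrite sin_acos // -sqrtr_sqr; congr (Num.sqrt _); lra.
have a0 : 0 <= acos x by rewrite acos_ge0.
have a1 : acos x <= pi by rewrite acos_lepi.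
have [y0|y0] := leP 0 y.
  exists (acos x); split => //; first by lra.
  by apply: val_inj; rewrite /= cx sx ger0_norm.
(* Strict, so that [2 * pi - acos x] stays below [2 * pi]. *)
have a2 : 0 < acos x.
  rewrite lt_neqAle a0 andbT; apply/eqP => a00.
  by move: sx; rewrite -a00 sin0 ltr0_norm // => /eqP;
    rewrite eq_sym oppr_eq0 => /eqP; lra.
exists (2 * pi - acos x); split; [lra|lra|].
have e : 2 * pi - acos x = - acos x + pi *+ 2 by rewrite -mulr_natl; lra.
apply: val_inj; rewrite /= e (periodicn (@cosD2pi R) 1%N) (periodicn (@sinD2pi R)
  1%N) cosN sinN cx sx ltr0_norm // opprK //.
Qed.

Lemma angle_itv_gt0 (a b : R) : 0 <= a -> a < b -> b <= 2 * pi ->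
  (0 < angle R [set` `]a, b[])%E.
Proof.
move=> a0 ab b2; rewrite /angle /= /uniform_prob.
have -> : (\int[lebesgue_measure]_(x in `]a, b[) (uniform_pdf 0 (2 * pi) x)%:E)%E =
   (\int[lebesgue_measure]_(x in `]a, b[) ((2 * pi - 0)^-1)%:E)%E.
  apply: eq_integral => x; rewrite inE /= in_itv /= => /andP[x1 x2].
  by rewrite /uniform_pdf ifT //; apply/andP; split; lra.
rewrite integral_cst //= lebesgue_measure_itv /= lte_fin ab -EFinB -EFinM lte_fin.
have := pi_gt0 R => pi0; rewrite mulr_gt0 ?invr_gt0 ?subr_gt0 //; lra.
Qed.

(** A violation at [t] persists by continuity on an interval []t, b[] inside [[0, 2 * pi]], which
    has positive measure. Going to the right of [t] covers the endpoint 0 as well. *)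
Lemma continuous_ae_le (h : R -> R) (L : R) : continuous h ->
  (\forall t \ae angle R, h t <= L) -> forall t, 0 <= t -> t < 2 * pi -> h t <= L.
Proof.
move=> ch [N [mN N0 sN]] t t0 t2; rewrite leNgt; apply/negP => Lt.
have e0 : 0 < h t - L by rewrite subr_gt0.
have /cvgrPdist_lt/(_ _ e0) /nbhs_ballP[d /= d0 hd] := ch t.
pose b := Num.min (t + d) (2 * pi).
have tb : t < b by rewrite lt_min t2 andbT; lra.
have b2 : b <= 2 * pi by rewrite ge_min lexx orbT.
have sI : `]t, b[ `<=` N.
  move=> s; rewrite /= in_itv /= => /andP[ts sb]; apply: sN => /= hs.
  have : ball t d s.
    rewrite /ball /= ltr0_norm; last by lra.
    by move: sb; rewrite lt_min => /andP[]; lra.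
  by move=> /hd /=; rewrite ltr_norml => /andP[]; lra.
have := angle_itv_gt0 t0 tb b2; rewrite ltNge => /negP; apply.
by rewrite -N0; apply: le_measure => //; rewrite inE.
Qed.

Lemma circle_Lnorm_bound (g : circle R -> R[i]) (p : {poly R[i]}) (L : R) :
  (forall z, g z = p.[sval z]) -> circle_Lnorm +oo%E g = L%:E -> circle_bound p L.
Proof.
move=> gp; rewrite /circle_Lnorm unlock /=.
(* The norm for the exponent [+oo] is the essential supremum because the total mass is positive. *)
rewrite probability_setT lte01 => hL.
have hae : \forall t \ae angle R, (`|(rnorm (g (expi t)))%:E| <= L%:E)%E.
  by apply/ess_supP; rewrite hL.
pose h (t : R) := rnorm (g (expi t)).
have ch : continuous h.
  move=> t; have [B B0 hB] := poly_lipschitz p 1.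
  have B2 : 0 < 2 * B by lra.
  apply/cvgrPdist_lt => e e0; have e20 : 0 < e / (2 * B) by rewrite divr_gt0.
  have /cvgrPdist_lt/(_ _ e20) hc := @continuous_cos R t.
  have /cvgrPdist_lt/(_ _ e20) hs := @continuous_sin R t.
  near=> s.
  have k1 : `|cos t - cos s| < e / (2 * B) by near: s.
  have k2 : `|sin t - sin s| < e / (2 * B) by near: s.
  have k3 : rnorm (sval (expi t) - sval (expi s)) < e / B.
    apply: le_lt_trans (rnorm_le_ReIm _) _ => /=.
    have -> : e / B = e / (2 * B) + e / (2 * B) by field; rewrite gt_eqF.
    exact: ltrD.
  have k4 : rnorm (p.[sval (expi t)] - p.[sval (expi s)]) < e.
    apply: le_lt_trans (hB _ _ _ _) _; rewrite ?circle_rnorm //.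
    by rewrite mulrC -ltr_pdivlMr.
  apply: le_lt_trans k4; rewrite /h !gp ler_norml; apply/andP; split.
    rewrite lerNl opprB lerBlDr rdistC.
    by apply: le_trans (rnormD _ _); rewrite subrK.
  by rewrite lerBlDr; apply: le_trans (rnormD _ _); rewrite subrK.
have key := continuous_ae_le ch (_ : \forall t \ae angle R, h t <= L).
move=> z z1; have zP : `|z| == 1 by rewrite normr_rnorm z1.
have [t [t0 t2 tz]] := expi_surjective (exist (fun z : R[i] => `|z| == 1) z zP).
have -> : z = sval (expi t) by rewrite tz.
rewrite -gp; apply: key => //; case: hae => N [mN N0 sN].
exists N; split => // s hs; apply: sN => hs'; apply: hs.
by move: hs'; rewrite /= lee_fin ger0_norm.
Unshelve. all: by end_near. Qed.

End essential_supremum.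

(** * Besov blocks as polynomials *)

Section besov_blocks.
Context {R : realType}.
Implicit Types f : circle R -> R[i].

(** The multiplier of [W_n] at nonnegative frequencies. For [n = 0] it keeps 0 and 1; the frequency
    -1 of [W_0] meets a vanishing Fourier coefficient in [convolution_besov]. *)
Definition besov_coef (n k : nat) : R[i] :=
  if n is 0 then (k <= 1)%:R else (besov_window (k%:R / 2 ^+ n))%:C.

Definition besov_poly f n : {poly R[i]} := \poly_(k < 2 ^ n.+1) (besov_coef n k *
  fourier f k%:Z).

Lemma besov_window_le0 (x : R) : x <= 2^-1 -> besov_window x = 0.
Proof.
rewrite /besov_window => x2; case: ifPn => [/andP[h _]|_].
  have -> : x = 2^-1 by apply/eqP; rewrite eq_le x2.
  by rewrite mulfV ?subrr.
by rewrite ifF //; apply/negbTE/negP => /andP[h _]; have := le_trans h x2; lra.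
Qed.

Lemma besov_window_ge2 (x : R) : 2 <= x -> besov_window x = 0.
Proof.
rewrite /besov_window => x2; rewrite ifF; last by apply/negbTE/negP => /andP[_ h];
  lra.
by case: ifPn => // /andP[_ h]; lra.
Qed.

Lemma besov_WE n (u : circle R) : (0 < n)%N ->
  besov_W n (sval u) = \sum_(k < 2 ^ n.+1) besov_coef n k * sval u ^+ k.
Proof.
case: n => // n _; rewrite /besov_W.
have p2 : (0 : R) < 2 ^+ n.+1 by rewrite exprn_gt0.
rewrite (fsbigE [seq Posz k | k <- iota 0 (2 ^ n.+2)]) //=.
- rewrite big_map -[X in iota 0 X]subn0 -/(index_iota 0 _) big_mkord.
  by apply: eq_big => [k|k _]; rewrite ?in_setT // -pmulrn.
- by rewrite map_inj_uniq ?iota_uniq // => i j [].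
- case=> k _ h.
    rewrite besov_window_ge2 ?mul0r //.
    rewrite -pmulrn ler_pdivlMr // -exprS -natrX ler_nat leqNgt;
      apply: contra h => h.
    by rewrite mem_map ?mem_iota // => i j [].
  rewrite besov_window_le0 ?mul0r // NegzE mulrNz mulNr.
  by apply: le_trans (_ : 0 <= _) => //; rewrite oppr_le0 divr_ge0 // ltW.
Qed.

Lemma convolution_besov f n z : circle_integrable f -> fourier f (- 1%:Z) = 0 ->
  convolution f (besov_W n) z = (besov_poly f n).[sval z].
Proof.
move=> hf f1; rewrite /besov_poly horner_poly; case: n => [|n]; last first.
  by rewrite (convolution_poly _ hf (fun u => besov_WE u (ltn0Sn n))).
rewrite /convolution expn1 !big_ord_recl big_ord0 /= !mul1r mulr1 addr0.
have i0 : circle_integrable (fun u => f u * sval u ^ (- 0%:Z)) by exact: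
  circle_integrable_exprz.
have i1 : circle_integrable (fun u => f u * sval u ^ (- 1%:Z)) by exact:
  circle_integrable_exprz.
have im : circle_integrable (fun u => f u * sval u ^ (- (- 1%:Z))) by exact:
  circle_integrable_exprz.
have -> : (fun u => f u * ((sval z / sval u)^* + 1 + sval z / sval u)) =
  (fun u => ((sval z)^-1 * (f u * sval u ^ (- (- 1%:Z))) + f u * sval u ^ (- 0%:Z))
    + sval z * (f u * sval u ^ (- 1%:Z))).
  apply/funext => u.
  have -> : Num.conj (sval z / sval u) = (sval z)^-1 * sval u.
    by rewrite rmorphM /= -circle_invE circle_invE [in X in _ * X]circle_invE
      conjCK.
  rewrite opprK oppr0 expr0z expr1z -[_ ^ (-1)]/((sval u)^-1); ring.
rewrite circle_integralD ?circle_integralD ?circle_integralZ //.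
- by rewrite -/(fourier f (- 1%:Z)) f1 mulr0 add0r -/(fourier f 0%:Z) -/(fourier f
  1%:Z) mulrC expr1.
- exact: circle_integrableZ.
- by apply: circle_integrableD => //; exact: circle_integrableZ.
- exact: circle_integrableZ.
Qed.

Lemma besov_blocks f : besov_plus 1 +oo%E 1%:E f -> exists M : nat -> R,
  (forall n, circle_bound (besov_poly f n) (M n)) /\
  cvgn (series (fun n => 2 ^+ n * M n)).
Proof.
move=> [[hf h1 _] hneg].
have f1 : fourier f (- 1%:Z) = 0 by exact: hneg.
move: h1; rewrite /in_ell Lnorm_counting // invr1 poweRe1; last first.
  by apply: nneseries_ge0 => n _ _; rewrite poweR_ge0.
pose L n := circle_Lnorm +oo%E (convolution f (besov_W n)).
have L0 n : (0 <= L n)%E by exact: Lnorm_ge0.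
have a0 n : (0 <= (2 ^+ n)%:E * L n)%E by rewrite mule_ge0 // lee_fin exprn_ge0.
have aE n : (`|(2 `^ (n%:R * 1))%:E * L n| `^ 1 = (2 ^+ n)%:E * L n)%E.
  by rewrite poweRe1 ?abse_ge0 // mulr1 powR_mulrn // gee0_abs.
rewrite (eq_eseriesr (g := fun n => ((2 ^+ n)%:E * L n)%E)); last by move=> n _;
  exact: aE.
move=> sfin.
have part N : (\sum_(0 <= k < N) (2 ^+ k)%:E * L k <= \sum_(k <oo) (2 ^+ k)%:E * L
  k)%E.
  by apply: nneseries_lim_ge => k _.
(* Since [2 ^ n >= 1], [L n] is at most a term of a series with finite sum. *)
have Lfin n : L n \is a fin_num.
  rewrite ge0_fin_numE //; apply: le_lt_trans sfin; apply: le_trans (part n.+1).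
  rewrite big_nat_recr //=; apply: le_trans (leeDr _ _); last by apply: sume_ge0.
  by apply: lee_pemull => //; rewrite lee_fin exprn_ege1 // ler1n.
exists (fun n => fine (L n)); split.
  move=> n; apply: (@circle_Lnorm_bound _ (convolution f (besov_W n))) => [z|].
    exact: convolution_besov.
  by rewrite fineK.
apply: nondecreasing_is_cvgn.
  apply/nondecreasing_seqP => n; rewrite /series /= big_nat_recr //= lerDl.
  by rewrite mulr_ge0 ?exprn_ge0 // fine_ge0.
exists (fine (\sum_(k <oo) (2 ^+ k)%:E * L k)%E) => _ [N _ <-].
have sf : (\sum_(k <oo) (2 ^+ k)%:E * L k)%E \is a fin_num.
  by rewrite ge0_fin_numE //; apply: nneseries_ge0 => n _ _.
rewrite -lee_fin fineK // -sumEFin; apply: le_trans (part N).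
by apply: lee_sum => k _; rewrite EFinM fineK.
Qed.

End besov_blocks.

(** * The analytic extension and its divided difference *)

Section uniform_limits.
Context {R : realType}.

Lemma nonneg_series_tail (b : nat -> R) (e : R) : (forall n, 0 <= b n) -> cvgn
  (series b) ->
  0 < e -> exists N, forall m n, (N <= m)%N -> (m <= n)%N -> \sum_(m <= k < n) b k
    <= e.
Proof.
move=> b0 /cauchy_cvgP/cauchy_seriesP cb e0.
have [[P Q] /= [[N1 _ hN1] [N2 _ hN2]] hPQ] := cb e e0.
exists (maxn N1 N2) => m n; rewrite geq_max => /andP[m1 m2] mn.
have := hPQ (m, n) (conj (hN1 _ m1) (hN2 _ (leq_trans m2 mn))) => /= h.
by apply: ltW; apply: le_lt_trans h; exact: ler_norm.
Qed.

Lemma real_cauchy_cvg (v : nat -> R) :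
  (forall e : R, 0 < e -> exists N, forall m n, (N <= m)%N -> (N <= n)%N ->
    `|v m - v n| < e) -> exists l : R, v @ \oo --> l.
Proof.
move=> h; have : cauchy_ex (v n @[n --> \oo]).
  move=> e e0; have [N hN] := h e e0; exists (v N).
  by exists N => // n /= Nn; rewrite -ball_normE /=; exact: hN.
move=> /cauchy_exP/cauchy_cvg c; exists (lim (v n @[n --> \oo])); exact: c.
Qed.

Lemma complex_cauchy_cvg (v : nat -> R[i]) :
  (forall e : R, 0 < e -> exists N, forall m n, (N <= m)%N -> (N <= n)%N ->
    rnorm (v m - v n) < e) -> exists l : R[i], v @ \oo --> l.
Proof.
move=> h.
have ReB (z w : R[i]) : complex.Re z - complex.Re w = complex.Re (z - w) by case:
  z; case: w.
have ImB (z w : R[i]) : complex.Im z - complex.Im w = complex.Im (z - w) by case: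
  z; case: w.
have [a ha] : exists a : R, (fun n => complex.Re (v n)) @ \oo --> a.
  apply: real_cauchy_cvg => e /h[N hN]; exists N => m n Nm Nn.
  by rewrite ReB; apply: le_lt_trans (rnorm_Re _) _; exact: hN.
have [b hb] : exists b : R, (fun n => complex.Im (v n)) @ \oo --> b.
  apply: real_cauchy_cvg => e /h[N hN]; exists N => m n Nm Nn.
  by rewrite ImB; apply: le_lt_trans (rnorm_Im _) _; exact: hN.
exists (a +i* b); apply/nat_rcvgP => e e0; have e20 : 0 < e / 2 by lra.
have /cvgrPdist_lt/(_ _ e20)[N1 _ hN1] := ha.
have /cvgrPdist_lt/(_ _ e20)[N2 _ hN2] := hb.
exists (maxn N1 N2) => n; rewrite geq_max => /andP[n1 n2].
apply: le_lt_trans (rnorm_le_ReIm _) _; rewrite -ReB -ImB [e]splitr.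
by apply: ltrD; rewrite distrC; [exact: hN1|exact: hN2].
Qed.

(** Weierstrass M-test, over an arbitrary set so that it serves on the closed disk and on its
    square. *)
Lemma uniform_series_limit (X : Type) (D : set X) (u : nat -> X -> R[i]) (b : nat
  -> R) :
  (forall n, 0 <= b n) -> (forall n x, D x -> rnorm (u n x) <= b n) -> cvgn (series
    b) ->
  exists phi : X -> R[i], forall e : R, 0 < e -> exists N, forall n, (N <= n)%N ->
    forall x, D x -> rnorm (\sum_(k < n) u k x - phi x) < e.
Proof.
move=> b0 ub cb.
have dist m n x : D x -> (m <= n)%N ->
    rnorm (\sum_(k < n) u k x - \sum_(k < m) u k x) <= \sum_(m <= k < n) b k.
  move=> Dx mn; rewrite -!(big_mkord xpredT (fun k => u k x)) (big_cat_nat _ mn)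
    //= addrAC subrr add0r.
  by apply: le_trans (rnorm_sum _ _ _) _; apply: ler_sum => k _; exact: ub.
have tail := nonneg_series_tail b0 cb.
have /choice[phi hphi] (x : X) : exists l : R[i], D x -> (fun n => \sum_(k < n) u k
  x) @ \oo --> l.
  have [Dx|nDx] := pselect (D x); last by exists 0.
  have [l hl] : exists l : R[i], (fun n => \sum_(k < n) u k x) @ \oo --> l.
    apply: complex_cauchy_cvg => e e0; have e20 : 0 < e / 2 by lra.
    have [N hN] := tail _ e20; exists N.
    have key m n : (N <= m)%N -> (m <= n)%N -> rnorm (\sum_(k < n) u k x - \sum_(k
      < m) u k x) < e.
      move=> Nm mn; apply: le_lt_trans (dist _ _ _ Dx mn) _.
      by apply: le_lt_trans (hN _ _ Nm mn) _; lra.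
    move=> m n Nm Nn; have [mn|/ltnW mn] := leqP m n; last exact: key.
    by rewrite rdistC; exact: key.
  by exists l.
exists phi => e e0; have e30 : 0 < e / 3 by lra.
have [N hN] := tail _ e30; exists N => n Nn x Dx.
have /nat_rcvgP/(_ _ e30)[N' hN'] := hphi x Dx.
have nm := leq_maxl n N'; have N'm := leq_maxr n N'.
have -> : \sum_(k < n) u k x - phi x = (\sum_(k < maxn n N') u k x - phi x) -
   (\sum_(k < maxn n N') u k x - \sum_(k < n) u k x) by ring.
apply: le_lt_trans (rnormB _ _) _.
have k1 := hN' _ N'm; have k2 := le_trans (dist _ _ _ Dx nm) (hN _ _ Nn nm).
apply: le_lt_trans (lerD (ltW k1) k2) _; lra.
Qed.

Lemma uniform_limit_continuous (P : nat -> {poly R[i]}) (phi : R[i] -> R[i]) :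
  (forall e : R, 0 < e -> exists N, forall n, (N <= n)%N ->
    forall z, cdisk z -> rnorm ((P n).[z] - phi z) < e) ->
  forall x, cdisk x -> forall e : R, 0 < e -> exists2 d : R, 0 < d &
    forall w, cdisk w -> rnorm (w - x) < d -> rnorm (phi w - phi x) < e.
Proof.
move=> hP x Dx e e0; have e30 : 0 < e / 3 by lra.
have [N hN] := hP _ e30; have [B B0 hB] := poly_lipschitz (P N) 1.
exists (e / 3 / B); first by rewrite divr_gt0.
move=> w Dw; rewrite ltr_pdivlMr // => wx.
have k1 := hN N (leqnn _) _ Dx; have k2 := hN N (leqnn _) _ Dw.
move: Dx Dw; rewrite !cdisk_rnorm => Dx Dw.
have k3 := hB _ _ Dx Dw; rewrite mulrC in wx; have k4 := le_lt_trans k3 wx.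
have -> : phi w - phi x = ((P N).[x] - phi x) - ((P N).[w] - phi w) + ((P N).[w] -
  (P N).[x]) by ring.
apply: le_lt_trans (rnormD _ _) _;
  apply: le_lt_trans (lerD (rnormB _ _) (lexx _)) _.
have -> : e = e / 3 + e / 3 + e / 3 by field.
by apply: ltrD => //; exact: ltrD.
Qed.

End uniform_limits.

(** * Flattening a family of blocks into one sequence *)

Section dyadic_enumeration.

(** Slot [i] is written [i + 1 = 2^B + j] with [j < 2^B]: block [B] occupies [2^B] consecutive
    slots, and the first [N] blocks exactly fill [2^N - 1] of them. *)
Definition block_index i := trunc_log 2 i.+1.
Definition block_offset i := (i.+1 - 2 ^ block_index i)%N.

Lemma block_indexE B j : (j < 2 ^ B)%N ->
  block_index (2 ^ B - 1 + j) = B /\ block_offset (2 ^ B - 1 + j) = j.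
Proof.
move=> jB; have p2 : (0 < 2 ^ B)%N by rewrite expn_gt0.
have e : (2 ^ B - 1 + j).+1 = (2 ^ B + j)%N by lia.
have h : block_index (2 ^ B - 1 + j) = B.
  by rewrite /block_index e; apply: trunc_log_eq => //; rewrite expnS; lia.
by split=> //; rewrite /block_offset h e addKn.
Qed.

Lemma dyadic_sum (V : zmodType) (t : nat -> nat -> V) N :
  \sum_(i < 2 ^ N - 1) t (block_index i) (block_offset i) =
  \sum_(B < N) \sum_(j < 2 ^ B) t B j.
Proof.
elim: N => [|N ih]; first by rewrite expn0 subnn !big_ord0.
have -> : (2 ^ N.+1 - 1 = 2 ^ N - 1 + 2 ^ N)%N.
  by have : (0 < 2 ^ N)%N by [rewrite expn_gt0]; rewrite expnS; lia.
rewrite big_split_ord /= ih big_ord_recr /=; congr (_ + _).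
by apply: eq_bigr => j _; have [-> ->] := block_indexE (ltn_ord j).
Qed.

End dyadic_enumeration.

(** * Sums of blocks and the analytic extension *)

Section block_sums.
Context {R : realType}.

(** The falling edge of one window and the rising edge of the next add up to 1, so the partial sums
    are trapezoids with plateau up to [2^N]. *)
Lemma besov_coef_sum N k :
  [/\ (k <= 2 ^ N)%N -> \sum_(n < N.+1) besov_coef n k = 1 :> R[i],
      (2 ^ N <= k)%N -> (k <= 2 ^ N.+1)%N ->
        \sum_(n < N.+1) besov_coef n k = (2 - k%:R / 2 ^+ N)%:C :> R[i] &
      (2 ^ N.+1 <= k)%N -> \sum_(n < N.+1) besov_coef n k = 0 :> R[i]].
Proof.
elim: N => [|N [ih1 ih2 ih3]].
  rewrite big_ord_recl big_ord0 addr0 /= expr0 divr1; split.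
  - by move=> ->.
  - by case: k => [|[|[|k]]] // _ _ /=; apply/eqP; rewrite eq_complex /=;
    apply/andP; split; apply/eqP; lra.
  - by case: k => [|[|k]].
have p2 n : (0 : R) < 2 ^+ n by rewrite exprn_gt0.
have nR n : (2 ^ n)%:R = 2 ^+ n :> R by rewrite natrX.
pose x : R := k%:R / 2 ^+ N.+1.
have xE : k%:R / 2 ^+ N = 2 * x :> R.
  rewrite /x exprS; field; exact: lt0r_neq0.
have leX n : (k <= 2 ^ n)%N = (k%:R <= 2 ^+ n :> R) by rewrite -nR ler_nat.
have geX n : (2 ^ n <= k)%N = (2 ^+ n <= k%:R :> R) by rewrite -nR ler_nat.
have x1 : (k <= 2 ^ N.+1)%N = (x <= 1) by rewrite leX ler_pdivrMr // mul1r.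
have x2 : (k <= 2 ^ N)%N = (x <= 2^-1).
  by rewrite leX ler_pdivrMr // exprS mulKf.
have x3 : (2 ^ N.+1 <= k)%N = (1 <= x) by rewrite geX ler_pdivlMr // mul1r.
have x4 : (2 ^ N.+2 <= k)%N = (2 <= x) by rewrite geX ler_pdivlMr // -exprS.
have x5 : (k <= 2 ^ N.+2)%N = (x <= 2) by rewrite leX ler_pdivrMr // -exprS.
have w1 : x <= 1 -> 2^-1 <= x -> besov_window x = 2 * x - 1.
  by move=> h h'; rewrite /besov_window h h'.
have w2 : 1 <= x -> x <= 2 -> besov_window x = 2 - x.
  move=> h h'; rewrite /besov_window h h' /=; case: ifP => // /andP[_ h''].
  have -> : x = 1 by apply/eqP; rewrite eq_le h h''.
  lra.
rewrite big_ord_recr /= -/x; split.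
- rewrite x1 => h; have [xs|xs] := leP x 2^-1.
    by rewrite besov_window_le0 // ih1 ?x2 // addr0.
  rewrite ih2 ?w1 ?x1 //; last 2 first.
  + exact: ltW.
  + by rewrite leqNgt; apply: contraTN xs; rewrite -leNgt -x2; exact: ltnW.
  by rewrite xE -rmorphD /=; congr (_%:C); lra.
- by rewrite x3 x5 => h h'; rewrite ih3 ?x3 // add0r w2.
- rewrite x4 => h; rewrite ih3 ?x3 ?besov_window_ge2 ?addr0 //; lra.
Qed.

Context (f : circle R -> R[i]) (M : nat -> R).
Context (hM : forall n, circle_bound (besov_poly f n) (M n)).
Context (cM : cvgn (series (fun n => 2 ^+ n * M n))).

Let c k := fourier f k%:Z.
Let P N := \sum_(n < N) besov_poly f n.

Lemma block_bound_ge0 n : 0 <= M n.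
Proof. exact: circle_bound_ge0 (hM n). Qed.

Lemma block_bound_cvg : cvgn (series M).
Proof.
apply: series_le_cvg cM => n; first exact: block_bound_ge0.
  by rewrite mulr_ge0 ?exprn_ge0 // block_bound_ge0.
by rewrite ler_peMl ?block_bound_ge0 // exprn_ege1 // ler1n.
Qed.

Lemma block_sum_bounded : exists B : R, forall N, \sum_(n < N) M n <= B.
Proof.
have nd : nondecreasing_seq (series M).
  apply/nondecreasing_seqP => n; rewrite /series /= big_nat_recr //= lerDl.
  exact: block_bound_ge0.
exists (limn (series M)) => N.
have := nondecreasing_cvgn_le nd block_bound_cvg N.
by rewrite /series /= big_mkord.
Qed.

Lemma block_sum_coef N k : (P N.+1)`_k = (\sum_(n < N.+1) besov_coef n k) * c k.
Proof.
rewrite /P coef_sum mulr_suml; apply: eq_bigr => n _; rewrite coef_poly;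
  case: ltnP => // h.
suff -> : besov_coef n k = 0 :> R[i] by rewrite mul0r.
case: n h => -[|n] _ /=; first by rewrite expn1 => h; case: k h => [|[|k]].
move=> h; rewrite besov_window_ge2 // ler_pdivlMr ?exprn_gt0 //.
by rewrite -exprS -natrX ler_nat.
Qed.

Lemma block_sum_coef_eq N k : (k <= 2 ^ N)%N -> (P N.+1)`_k = c k.
Proof. by rewrite block_sum_coef => h; have [-> //] := besov_coef_sum N k;
  rewrite mul1r. Qed.

Lemma block_sum_size N : (size (P N.+1) <= 2 ^ N.+1)%N.
Proof.
apply/leq_sizeP => k h; rewrite block_sum_coef.
by have [_ _ -> //] := besov_coef_sum N k; rewrite mul0r.
Qed.

Lemma block_sum_circle_bound N : circle_bound (P N) (\sum_(n < N) M n).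
Proof.
move=> z z1; rewrite /P horner_sum; apply: le_trans (rnorm_sum _ _ _) _.
by apply: ler_sum => n _; exact: hM.
Qed.

Lemma block_sum_limit : exists phi : R[i] -> R[i], forall e : R, 0 < e ->
  exists N, forall n, (N <= n)%N -> forall z, cdisk z -> rnorm ((P n).[z] - phi z)
    < e.
Proof.
have [|phi hphi] := @uniform_series_limit R R[i] cdisk (fun n z => (besov_poly f
  n).[z]) M
  block_bound_ge0 _ block_bound_cvg.
  by move=> n z; rewrite cdisk_rnorm => z1; exact: maximum_principle (hM n) z1.
exists phi => e /hphi[N hN]; exists N => n Nn z Dz.
by rewrite /P horner_sum; exact: hN.
Qed.

(** [P N.+1] has the Fourier coefficients of [f] up to degree [2^N], and one constant [B] bounds all
    coefficients; inside the disk it differs from a partial sum of the power series by a geometric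
    tail. *)
Lemma power_series_limit phi z : (forall e : R, 0 < e ->
    exists N, forall n, (N <= n)%N -> forall z, cdisk z -> rnorm ((P n).[z] - phi
      z) < e) ->
  rnorm z < 1 -> power_series_extension f z = phi z.
Proof.
move=> hphi z1; apply: cvg_lim; first exact: (@norm_hausdorff _ R[i]).
have [B hB] := block_sum_bounded.
have B0 : 0 <= B by apply: le_trans (hB 0%N); rewrite big_ord0.
have cB N k : rnorm (P N)`_k <= B.
  by apply: le_trans (hB N); apply: circle_bound_coef;
    exact: block_sum_circle_bound.
pose r := rnorm z; have r0 : 0 <= r by exact: rnorm_ge0.
have r1 : 0 < 1 - r by rewrite subr_gt0.
have geo K L : \sum_(K <= k < L) r ^+ k <= r ^+ K / (1 - r).
  rewrite ler_pdivlMr // mulr_suml.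
  have [KL|LK] := leqP K L; last by rewrite big_geq ?exprn_ge0 // ltnW.
  have -> : \sum_(K <= k < L) r ^+ k * (1 - r) = \sum_(K <= k < L) - (r ^+ k.+1 - r
    ^+ k).
    by apply: eq_bigr => k _; rewrite exprS; ring.
  by rewrite sumrN telescope_sumr // opprB lerBlDr lerDl exprn_ge0.
have key K : rnorm (series (fun k => fourier f k%:Z * z ^+ k) K - phi z) <= B * (r
  ^+ K / (1 - r)).
  apply/ler_addgt0Pr => e e0; have [N0 hN0] := hphi _ e0.
  (* Gives [K <= 2^N], so the first [K] coefficients of [P N.+1] are those of the series. *)
  pose N := maxn N0 K; have NN : (N0 <= N.+1)%N by rewrite leqW // leq_maxl.
  have z1' : cdisk z by rewrite cdisk_rnorm ltW.
  have k1 := hN0 _ NN _ z1'.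
  have K2 : (K <= 2 ^ N)%N.
    by apply: leq_trans (_ : (N <= _)%N); [exact: leq_maxr|exact/ltnW/ltn_expl].
  have K3 : (K <= 2 ^ N.+1)%N by rewrite (leq_trans K2) // leq_exp2l.
  have -> : series (fun k => fourier f k%:Z * z ^+ k) K - phi z =
     ((P N.+1).[z] - phi z) - ((P N.+1).[z] - series (fun k => fourier f k%:Z * z
       ^+ k) K) by ring.
  apply: le_trans (rnormB _ _) _; rewrite addrC; apply: lerD; last exact: ltW.
  rewrite (horner_coef_wide _ (block_sum_size N)) -(big_mkord xpredT (fun k => (P
    N.+1)`_k * z ^+ k)).
  rewrite (big_cat_nat _ K3) //= /series /= addrAC.
  rewrite -[X in X + _]sumrB [X in X + _]big1_seq ?add0r; last first.
    move=> k; rewrite mem_index_iota => /andP[_ /andP[_ kK]].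
    by rewrite block_sum_coef_eq ?subrr // (leq_trans (ltnW kK)).
  apply: le_trans (rnorm_sum _ _ _) _;
    apply: le_trans (_ : \sum_(K <= k < 2 ^ N.+1) B * r ^+ k <= _).
    by apply: ler_sum => k _; rewrite rnormM rnormX ler_wpM2r ?exprn_ge0.
  by rewrite -mulr_sumr ler_wpM2l.
apply/nat_rcvgP => e e0.
have B1 : 0 < B / (1 - r) + 1 by rewrite ltr_wpDl // divr_ge0 // ltW.
have e'0 : 0 < e / (B / (1 - r) + 1) by rewrite divr_gt0.
have /cvgrPdist_lt/(_ _ e'0)[N _ hN] : r ^+ n @[n --> \oo] --> 0.
  by apply: cvg_expr; rewrite ger0_norm.
exists N => n Nn; apply: le_lt_trans (key n) _.
have := hN n Nn; rewrite sub0r normrN ger0_norm ?exprn_ge0 // ltr_pdivlMr // => h.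
apply: le_lt_trans h; rewrite mulrDr mulr1 mulrCA lerDl exprn_ge0 //.
Qed.

(** The radial points [(1 - t) z] lie in the disk. Properness is what determines a [lim] at a
    boundary point. *)
Lemma within_disk_pfilter (z : R[i]) : rnorm z = 1 -> ProperFilter (within disk
  (nbhs z)).
Proof.
move=> z1; apply: Build_ProperFilter_ex => A /within_nbhsP[d d0 hd].
pose t := Num.min (d / 2) (2^-1).
have t0 : 0 < t by rewrite lt_min; apply/andP; split; lra.
have td : t < d by rewrite gt_min; apply/orP; left; lra.
have t1 : t <= 2^-1 by rewrite ge_min lexx orbT.
exists ((1 - t)%:C * z); apply: hd.
  by rewrite disk_rnorm rnormM z1 mulr1 rnormC ger0_norm; lra.
have -> : (1 - t)%:C * z - z = - (t%:C * z) by rewrite rmorphB rmorph1; ring.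
by rewrite rnormN rnormM z1 mulr1 rnormC gtr0_norm.
Qed.

Lemma analytic_extensionE phi z : (forall e : R, 0 < e ->
    exists N, forall n, (N <= n)%N -> forall z, cdisk z -> rnorm ((P n).[z] - phi
      z) < e) ->
  cdisk z -> analytic_extension f z = phi z.
Proof.
move=> hphi Dz; rewrite /analytic_extension.
have -> : (`|z| < 1) = (rnorm z < 1) by rewrite normr_rnorm -(ltcR (rnorm z) 1).
case: ltP => z1; first exact: power_series_limit.
have {}z1 : rnorm z = 1 by apply/eqP; rewrite eq_le z1 andbT -cdisk_rnorm.
have pf := within_disk_pfilter z1.
apply: cvg_lim; first exact: (@norm_hausdorff _ R[i]).
apply/rcvgP => e e0; apply/within_nbhsP.
have [d d0 hd] := uniform_limit_continuous hphi Dz e0.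
exists d => // w; rewrite disk_rnorm => w1 wz.
rewrite (power_series_limit hphi w1); apply: hd => //.
by rewrite cdisk_rnorm ltW.
Qed.

End block_sums.

Lemma within_cdisk_dnbhsP (R : realType) (z : R[i]) (P : set R[i]) :
  (within cdisk z^') P <-> exists2 d : R, 0 < d &
    forall w, w != z -> cdisk w -> rnorm (w - z) < d -> P w.
Proof.
split.
  move=> /(@nbhs_ballP R[i] R[i]) [e /= /gt0_complex[d d0 ->] hd].
  exists d => // w wz Dw wd; apply: (hd w) => //.
  by rewrite -ball_normE /= normr_rnorm ltcR rdistC.
move=> [d d0 hd]; apply/(@nbhs_ballP R[i] R[i]); exists d%:C => /=;
  first by rewrite ltcR.
by move=> w; rewrite -ball_normE /= normr_rnorm ltcR rdistC => wd wz Dw; exact: hd.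
Qed.

Lemma within_cdisk_dnbhs_pfilter (R : realType) (z : R[i]) : rnorm z = 1 ->
  ProperFilter (within cdisk z^').
Proof.
move=> z1.
have FF : Filter (within cdisk z^') by apply: within_filter; exact: dnbhs_filter.
apply: Build_ProperFilter_ex => A /within_cdisk_dnbhsP[d d0 hd].
pose t := Num.min (d / 2) (2^-1).
have t0 : 0 < t by rewrite lt_min; apply/andP; split; lra.
have td : t < d by rewrite gt_min; apply/orP; left; lra.
have t1 : t <= 2^-1 by rewrite ge_min lexx orbT.
have e : rnorm ((1 - t)%:C * z - z) = t.
  have -> : (1 - t)%:C * z - z = - (t%:C * z) by rewrite rmorphB rmorph1; ring.
  by rewrite rnormN rnormM z1 mulr1 rnormC gtr0_norm.
exists ((1 - t)%:C * z); apply: hd; rewrite ?e //.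
  by rewrite -subr_eq0; apply/eqP => h; move: e; rewrite h rnorm0; lra.
by rewrite cdisk_rnorm rnormM z1 mulr1 rnormC ger0_norm; lra.
Qed.

(** * Assembling the blocks into a representation of the divided difference *)

Section tensor_representation.
Context {R : realType} (f : circle R -> R[i]) (M : nat -> R).
Context (hM : forall n, circle_bound (besov_poly f n) (M n)).
Context (cM : cvgn (series (fun n => 2 ^+ n * M n))).

Let M0 n : 0 <= M n. Proof. exact: (block_bound_ge0 hM). Qed.

(** Removing the constant coefficient, which the difference on the right does not see, makes block 0
    vanish below [m = 1] too; it costs a factor 2, whence 20. With [m = 2 ^ n.-1] the [5m] terms
    number at most [2 ^ n.+3], an exponent dictated by [n = 0]. *)
Lemma besov_block_representation n : exists F G : nat -> {poly R[i]},
  (forall j, exists a b, [/\ circle_bound (F j) a, circle_bound (G j) b & a * b <=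
    20 * M n]) /\
  forall z u, (z - u) * (\sum_(j < 2 ^ n.+3) (F j).[z] * (G j).[u]) =
    (besov_poly f n).[z] - (besov_poly f n).[u].
Proof.
pose q := besov_poly f n - ((besov_poly f n)`_0)%:P.
have [||||F [G [hFG hq]]] := @block_representation R q (M n + M n) (2 ^ n.-1).
- by rewrite expn_gt0.
- apply/leq_sizeP => k kn; rewrite coefB coefC coef_poly ifF; last first.
    apply/negbTE; rewrite -leqNgt; apply: leq_trans kn.
    by case: (n) => [|m] //=; rewrite !expnS; lia.
  rewrite ifF ?subrr //; apply/negbTE; apply: contraTneq kn => ->.
  by rewrite -ltnNge muln_gt0 expn_gt0.
- case=> [|k] kn; first by rewrite coefB coefC subrr.
  rewrite coefB coefC subr0 coef_poly; case: ifP => // _.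
  clear q; case: n kn => [|m] /= kn; first by rewrite expn0 in kn.
  rewrite besov_window_le0 ?mul0r // ler_pdivrMr ?exprn_gt0 // exprS mulKf //.
  by rewrite -natrX ler_nat ltnW.
- move=> z z1; rewrite hornerD hornerN hornerC.
  by apply: le_trans (rnormB _ _) _; apply: lerD;
    [exact: hM|exact: circle_bound_coef].
exists F, G; split.
  move=> j; have [a [b [ha hb hab]]] := hFG j; exists a, b; split => //; lra.
move=> z u; rewrite hq; last by case: (n) => [|m] //=; rewrite !expnS; lia.
by rewrite /q !hornerE; ring.
Qed.

(** [Phi] sums all block series on the closed bidisk. Off the diagonal,
    [(z - w) Phi = phi z - phi w] passes to the limit; on the diagonal the derivative is the limit
    of [Phi (w, z)], found by continuity in the first variable. *)
Lemma besov_tensor_representation : exists F G : nat -> {poly R[i]},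
  tensor_representation (divided_difference (analytic_extension f))
    (fun n => horner (F n)) (fun n => horner (G n)).
Proof.
have [phi hphi] := block_sum_limit hM cM.
have phiE z : cdisk z -> analytic_extension f z = phi z by exact:
  analytic_extensionE hphi.
have /choice[Fs hFs] := besov_block_representation.
have /choice[Gs hFG] := hFs.
(* slot (B, j) of the dyadic enumeration carries the [j]-th term of block
   [B - 3], which has at most [2 ^ B] terms *)
pose Ft B j : {poly R[i]} := if (B < 3)%N then 0 else Fs (B - 3)%N j.
pose Gt B j : {poly R[i]} := if (B < 3)%N then 0 else Gs (B - 3)%N j.
pose F i := Ft (block_index i) (block_offset i).
pose G i := Gt (block_index i) (block_offset i).
pose m B : R := if (B < 3)%N then 0 else 20 * M (B - 3)%N.
have m0 B : 0 <= m B by rewrite /m; case: ifP => // _; rewrite mulr_ge0.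
have sle (p : {poly R[i]}) a : circle_bound p a -> supnorm (horner p) <= a.
  by move=> h; apply: supnorm_le => z; rewrite cdisk_rnorm;
    exact: maximum_principle.
have sge (p : {poly R[i]}) z : cdisk z -> rnorm p.[z] <= supnorm (horner p).
  by apply: le_supnorm; exact: (poly_disk_algebra p).2.
have s0 (p : {poly R[i]}) : 0 <= supnorm (horner p).
  by apply: le_trans (sge p 0 _) => //; rewrite cdisk_rnorm rnorm0.
have FGm i : supnorm (horner (F i)) * supnorm (horner (G i)) <= m (block_index i).
  rewrite /F /G /Ft /Gt /m; case: ifP => _.
    have -> : supnorm (horner (0 : {poly R[i]})) = 0; last by rewrite mul0r.
    by apply/eqP; rewrite eq_le s0 andbT; apply: sle => z _; rewrite horner0 rnorm0.
  have [a [b [ha hb hab]]] := (hFG (block_index i - 3)%N).1 (block_offset i).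
  by apply: le_trans hab; apply: ler_pM => //; exact: sle.
pose a i := supnorm (horner (F i)) * supnorm (horner (G i)).
have a0 i : 0 <= a i by rewrite mulr_ge0.
have [C hC] : exists C : R, forall N, \sum_(n < N) 2 ^+ n * M n <= C.
  have nd : nondecreasing_seq (series (fun n => 2 ^+ n * M n)).
    apply/nondecreasing_seqP => n; rewrite /series /= big_nat_recr //= lerDl.
    by rewrite mulr_ge0 ?exprn_ge0.
  exists (limn (series (fun n => 2 ^+ n * M n))) => N.
  by have := nondecreasing_cvgn_le nd cM N; rewrite /series /= big_mkord.
(* Block [n] fills [2 ^ (3 + n)] slots of size at most [20 * M n], and [8 * 20 = 160]. *)
have sm N : \sum_(i < 2 ^ N - 1) m (block_index i) <= 160 * C.
  rewrite (dyadic_sum (fun B _ => m B)).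
  under eq_bigr do rewrite sumr_const card_ord.
  apply: le_trans (_ : \sum_(B < 3 + N) m B *+ 2 ^ B <= _).
    rewrite addnC big_split_ord /= lerDl; apply: sumr_ge0 => B _.
    exact: mulrn_wge0.
  rewrite big_split_ord /= big1 ?add0r; last first.
    by move=> B _; rewrite /m ltn_ord mul0rn.
  apply: le_trans (ler_wpM2l _ (hC N)); last by [].
  rewrite mulr_sumr; apply: ler_sum => B _.
  have -> : m (3 + B)%N = 20 * M B by rewrite /m addKn.
  have -> : 20 * M B *+ 2 ^ (3 + B) = 160 * (2 ^+ B * M B).
    by rewrite -mulr_natl natrX exprD; ring.
  by [].
have ca : cvgn (series a).
  apply: nondecreasing_is_cvgn.
    by apply/nondecreasing_seqP => n; rewrite /series /= big_nat_recr //= lerDl.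
  exists (160 * C) => _ [N _ <-]; rewrite /series /= big_mkord.
  apply: le_trans (sm N);
    have NN : (N <= 2 ^ N - 1)%N by have := ltn_expl N (ltnSn 1); lia.
  rewrite -(subnKC NN) big_split_ord /=; apply: ler_wpDr.
    by apply: sumr_ge0 => i _; apply: le_trans (FGm _); exact: a0.
  by apply: ler_sum => i _; exact: FGm.
(* The closed bidisk rather than the torus, because [cdisk_derive] takes limits within the closed
   disk. *)
pose D2 : set (R[i] * R[i]) := [set x | cdisk x.1 /\ cdisk x.2].
have [|Phi hPhi] := @uniform_series_limit R (R[i] * R[i])%type D2
  (fun i x => (F i).[x.1] * (G i).[x.2]) a a0 _ ca.
  by move=> i [z w] [/= Dz Dw]; rewrite rnormM; apply: ler_pM => //; exact: sge.
have hdiff z w : cdisk z -> cdisk w -> (z - w) * Phi (z, w) = phi z - phi w.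
  move=> Dz Dw; apply/eqP; rewrite -subr_eq0; apply/eqP/rnorm0_eq0/eqP.
  rewrite eq_le rnorm_ge0 andbT; apply/ler_addgt0Pr => e e0; rewrite add0r.
  have e40 : 0 < e / 4 by lra.
  have [N1 hN1] := hPhi _ e40; have [N2 hN2] := hphi _ e40.
  (* After [2 ^ (3 + N) - 1] slots exactly the blocks below [N] have been summed. *)
  pose N := maxn N1 N2; have n1 : (N1 <= 2 ^ (3 + N) - 1)%N.
    have := ltn_expl (3 + N) (ltnSn 1); have := leq_maxl N1 N2; rewrite -/N; lia.
  have n2 : (N2 <= N)%N by exact: leq_maxr.
  have k1 := hN1 _ n1 (z, w) (conj Dz Dw); have k2 := hN2 _ n2 _ Dz;
    have k3 := hN2 _ n2 _ Dw.
  have E : (z - w) * \sum_(k < 2 ^ (3 + N) - 1) (F k).[z] * (G k).[w] =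
     (\sum_(n < N) besov_poly f n).[z] - (\sum_(n < N) besov_poly f n).[w].
    rewrite (dyadic_sum (fun B j => (Ft B j).[z] * (Gt B j).[w])) big_split_ord /=.
    rewrite big1 ?add0r; last first.
      by move=> B _; rewrite big1 // => j _; rewrite /Ft ltn_ord horner0 mul0r.
    rewrite !horner_sum -sumrB mulr_sumr; apply: eq_bigr => n _.
    rewrite -(hFG n).2; congr (_ * _); apply: eq_bigr => j _.
    by rewrite /Ft /Gt /= addKn.
  have -> : (z - w) * Phi (z, w) - (phi z - phi w) =
     (((\sum_(n < N) besov_poly f n).[z] - phi z) - ((\sum_(n < N) besov_poly f
       n).[w] - phi w))
     - (z - w) * (\sum_(k < 2 ^ (3 + N) - 1) (F k).[z] * (G k).[w] - Phi (z, w)).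
    by rewrite mulrBr E; ring.
  apply: le_trans (rnormB _ _) _; rewrite rnormM.
  have zw : rnorm (z - w) <= 2.
    by move: Dz Dw; rewrite !cdisk_rnorm => Dz Dw; apply: le_trans (rnormB _ _) _;
      lra.
  have k4 : rnorm (z - w) * rnorm (\sum_(k < 2 ^ (3 + N) - 1) (F k).[z] * (G k).[w]
    - Phi (z, w)) <= 2 * (e / 4).
    by apply: ler_pM => //; exact: ltW.
  apply: le_trans (lerD (rnormB _ _) k4) _;
    apply: le_trans (lerD (lerD (ltW k2) (ltW k3)) (lexx _)) _.
  lra.
exists F, G; split.
- by move=> n; split; exact: poly_disk_algebra.
- exact: ca.
move=> z u; have Dz := circle_cdisk z; have Du := circle_cdisk u.
have -> : divided_difference (analytic_extension f) z u = Phi (sval z, sval u).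
  rewrite /divided_difference; case: eqVneq => [<-|zu]; last first.
    rewrite !phiE // -hdiff // mulrAC mulfV ?mul1r // subr_eq0.
    by apply: contra_neq zu; exact: val_inj.
  have pf := within_cdisk_dnbhs_pfilter (circle_rnorm z).
  rewrite /cdisk_derive; apply: cvg_lim; first exact: (@norm_hausdorff _ R[i]).
  apply/rcvgP => e e0; apply/within_cdisk_dnbhsP.
  (* With the second variable frozen at [z] the partial sums are polynomials in [w], so their
     uniform limit is continuous. *)
  have [r r0|d d0 hd] := @uniform_limit_continuous R (fun n => \sum_(i < n) (G
    i).[sval z] *: F i)
    (fun w => Phi (w, sval z)) _ (sval z) Dz e e0.
    have [N hN] := hPhi r r0; exists N => n Nn w Dw.
    rewrite horner_sum; have := hN n Nn (w, sval z) (conj Dw Dz) => /=.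
    by under eq_bigr do rewrite mulrC -hornerZ.
  exists d => // w wz Dw wd;
    rewrite !phiE // -hdiff // mulrAC mulfV ?subr_eq0 // mul1r.
  exact: hd.
apply/nat_rcvgP => e e0; have [N hN] := hPhi e e0; exists N => n Nn.
by rewrite /series /= big_mkord; exact: (hN n Nn (sval z, sval u)).
Qed.

End tensor_representation.

Theorem theorem4p5 (R : realType) (f : circle R -> R[i])
    (hf : besov_plus 1 +oo%E 1%:E f)
    (H : hilbertType R) (T Q : H -> H)
    (hT : contraction_op T) (hQ : bounded_op Q)
    (E : set (circle R) -> H -> H) (hE : semispectral_measure_of T E) :
  let phi := analytic_extension f in
  (disk_calculus phi T \o Q) \- (Q \o disk_calculus phi T) =
  double_operator_integral E E (divided_difference phi)
    ((T \o Q) \- (Q \o T)).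
Proof.
move=> phi; have [M [hM cM]] := besov_blocks hf.
have [F [G hFG]] := besov_tensor_representation hM cM.
have [psi hpsi] := block_sum_limit hM cM.
apply: (@commutator_eq_double_operator_integral R H T Q E hT.1 hQ hE phi
  (fun N => \sum_(n < N) besov_poly f n) _ F G hFG).
move=> e /hpsi[N hN]; exists N => n Nn z Dz.
by rewrite /phi (analytic_extensionE hM cM hpsi Dz); exact: hN.
Qed.
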